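(* For any $T>0$, $r>1/2$, $R>0$ and $\gamma\in[0,2]$ there are constants $\tau_R>0$ and $C_{R,T,\gamma,r}>0$ ($C_{R,T,\gamma,r}$ depending on $R,T,\gamma,r$ but not on $\tau$) such that the following holds for all $\tau\in(0,\tau_R)$. Let $u(t)$ be the exact solution of the cubic nonlinear Schrödinger equation $i\partial_tu=-\partial_x^2u+\mu|u|^2u$ on $[0,T]\times\mathbb{T}$, $u(0)=u_0$, let $u^n$, $n\ge0$, be the iterates of the resonance-based midpoint rule for the NLSE with $u^0=u_0$, and let $t_n=n\tau$. If $\sup_{t\in[0,T]}\|u(t)\|_{H^{r+\gamma}}<R/2$, then $$\|u(t_n)-u^n\|_{H^r}\le C_{R,T,\gamma,r}\,\tau^\gamma\qquad\text{for all }0\le n\le\lfloor T/\tau\rfloor .$$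
   Context: $\mathbb{T}=\mathbb{R}/(2\pi\mathbb{Z})$; $\mu\in\mathbb{R}$ is fixed; $\hat u_m=\frac1{2\pi}\int_{\mathbb T}e^{-imx}u\,\mathrm{d}x$; $H^r=H^r(\mathbb{T})$ (complex-valued) has norm $\|u\|_{H^r}^2=\sum_{m}\langle m\rangle^{2r}|\hat u_m|^2$, $\langle m\rangle=|m|$ ($m\neq0$), $\langle0\rangle=1$. Define $$\mathcal F(\tau;w)=-i\mu\sum_{k\in\mathbb Z}e^{ikx}\sum_{k+k_1=k_2+k_3}\frac1\tau\int_0^\tau\big[e^{-2iskk_1}+e^{2isk_2k_3}-1\big]\mathrm{d}s\;\overline{\hat w_{k_1}}\hat w_{k_2}\hat w_{k_3}.$$ Resonance-based midpoint rule for the NLSE: $$u^{n+1}=e^{i\tau\partial_x^2}u^n+\tau e^{i\tau\partial_x^2}\mathcal F\Big(\tau;\tfrac12\big(u^n+e^{-i\tau\partial_x^2}u^{n+1}\big)\Big).$$ The implicit equation is solved by fixed-point iteration: $u^{n+1}$ is the limit of the iteration $w\mapsto e^{i\tau\partial_x^2}u^n+\tau e^{i\tau\partial_x^2}\mathcal F(\tau;\frac12(u^n+e^{-i\tau\partial_x^2}w))$ started at $w=e^{i\tau\partial_x^2}u^n$ (which exists for sufficiently small $\tau$). *)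

(* Defs.v *)
From HB Require Import structures.
From mathcomp Require Import all_boot all_order all_algebra.
From mathcomp Require Import all_classical all_reals all_analysis.
From mathcomp Require Import complex.
Import Order.TTheory GRing.Theory Num.Theory.
Import numFieldNormedType.Exports.

Set Implicit Arguments.
Unset Strict Implicit.
Unset Printing Implicit Defensive.

Local Open Scope classical_set_scope.
Local Open Scope complex_scope.
Local Open Scope ring_scope.

Section ComplexAnalysis.
Context {R : realType}.

Definition cis (a : R) : R[i] := cos a +i* sin a.

Definition cintegral (a b : R) (f : R -> R[i]) : R[i] :=
  (\int[lebesgue_measure]_(x in `[a, b]) complex.Re (f x))
  +i* (\int[lebesgue_measure]_(x in `[a, b]) complex.Im (f x)).

(* Unconditional sums. For an absolutely summable family these are the usual
   sums; otherwise [fine] sends an infinite positive or negative part to 0. *)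
Definition rsum {I : choiceType} (D : set I) (f : I -> R) : R :=
  fine (\esum_(i in D) (Num.max (f i) 0)%:E)
  - fine (\esum_(i in D) (Num.max (- f i) 0)%:E).

Definition csum {I : choiceType} (D : set I) (f : I -> R[i]) : R[i] :=
  rsum D (fun i => complex.Re (f i)) +i* rsum D (fun i => complex.Im (f i)).

Definition is_cderive (f : R -> R[i]) (t : R) (d : R[i]) : Prop :=
  is_derive t 1 (fun s => complex.Re (f s)) (complex.Re d) /\
  is_derive t 1 (fun s => complex.Im (f s)) (complex.Im d).

End ComplexAnalysis.

Section SobolevTorus.
Context {R : realType}.

(* Functions on the torus R/(2 pi Z) are 2 pi-periodic functions on R. *)
Definition torus_L2 (u : R -> R[i]) : Prop :=
  [/\ forall x : R, u (x + 2 * pi) = u x,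
      measurable_fun setT (fun x => complex.Re (u x)),
      measurable_fun setT (fun x => complex.Im (u x)) &
      (\int[lebesgue_measure]_(x in `[0%R, (2 * pi)%R])
         (Normc.normc (u x) ^+ 2)%:E < +oo)%E].

Definition fcoef (u : R -> R[i]) (m : int) : R[i] :=
  ((2 * pi)^-1)%:C *
  cintegral 0 (2 * pi) (fun x => cis (- (m%:~R * x)) * u x).

Definition bracket (m : int) : R := if m == 0 then 1 else `|m%:~R|.

Definition Hnorm (r : R) (u : R -> R[i]) : \bar R :=
  sqrte (\esum_(m in [set: int])
           (bracket m `^ (2 * r) * Normc.normc (fcoef u m) ^+ 2)%:E).

(* Intended for r >= 0, where H^r is a subspace of L^2. *)
Definition inH (r : R) (u : R -> R[i]) : Prop :=
  torus_L2 u /\ (Hnorm r u < +oo)%E.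

(* The free propagator e^{i t d_x^2}, i.e. the Fourier multiplier e^{-i t k^2}.
   The series converges absolutely for u in H^r with r > 1/2. *)
Definition schrodinger (t : R) (u : R -> R[i]) (x : R) : R[i] :=
  csum [set: int]
    (fun k => cis (k%:~R * x) * cis (- (t * k%:~R ^+ 2)) * fcoef u k).

End SobolevTorus.

Section NLS.
Context {R : realType}.

(* Solutions in C([0,T]; H^r) of i d_t u = - d_x^2 u + mu |u|^2 u in the sense
   of distributions in x: for r < 2 the term d_x^2 u need not be a function, so
   the equation is tested against each e^{-ikx}, d_x^2 acting as -k^2. *)
Definition nls_solution (mu r T : R) (u0 : R -> R[i]) (u : R -> R -> R[i]) :
    Prop :=
  [/\ forall t : R, 0 <= t <= T -> inH r (u t),
      forall t : R, 0 <= t <= T ->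
        Hnorm r (u s \- u t) @[s --> within `[0, T] (nbhs t)] --> 0%E,
      u 0 = u0 &
      forall (t : R) (k : int), 0 < t < T ->
        exists2 d : R[i], is_cderive (fun s => fcoef (u s) k) t d &
          ('i)%C * d = (k%:~R ^+ 2)%:C * fcoef (u t) k
                 + mu%:C * fcoef (fun x => (Normc.normc (u t x) ^+ 2)%:C * u t x) k].

End NLS.

Section ResonanceMidpoint.
Context {R : realType}.

Definition res_kernel (tau : R) (k k1 k2 k3 : int) : R[i] :=
  (tau^-1)%:C *
  cintegral 0 tau
    (fun s => cis (- (2 * s * k%:~R * k1%:~R))
            + cis (2 * s * k2%:~R * k3%:~R) - 1).

(* The inner sum runs over ((k1, k2), k3). *)
Definition rbm_F (mu tau : R) (w : R -> R[i]) (x : R) : R[i] :=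
  - (('i)%C * mu%:C) *
  csum [set: int] (fun k => cis (k%:~R * x) *
    csum [set p : int * int * int | k + p.1.1 = p.1.2 + p.2]
      (fun p => res_kernel tau k p.1.1 p.1.2 p.2
              * (((fcoef w p.1.1)^*)%C * fcoef w p.1.2 * fcoef w p.2))).

Definition rbm_map (mu tau : R) (v w : R -> R[i]) : R -> R[i] :=
  let mid x := (2^-1)%:C * (v x + schrodinger (- tau) w x) in
  fun x => schrodinger tau v x
         + tau%:C * schrodinger tau (rbm_F mu tau mid) x.

Definition rbm_fixpoint_iter (mu tau : R) (v : R -> R[i]) (j : nat) :
    R -> R[i] :=
  iter j (rbm_map mu tau v) (schrodinger tau v).

Definition rbm_step (mu r tau : R) (v v' : R -> R[i]) : Prop :=
  inH r v' /\
  Hnorm r (rbm_fixpoint_iter mu tau v j \- v') @[j --> \oo] --> 0%E.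

(* U 0, ..., U N are iterates of the scheme; they are determined up to equality
   almost everywhere, and U n is unconstrained for n > N. *)
Definition rbm_iterates (mu r tau : R) (u0 : R -> R[i]) (N : nat)
    (U : nat -> R -> R[i]) : Prop :=
  U 0%N = u0 /\
  forall n, (n < N)%N -> rbm_step mu r tau (U n) (U n.+1).

End ResonanceMidpoint.

(* Main.v *)
(* In the interaction picture v(t) = e^{-it d_x^2} u(t), the Fourier coefficients satisfy
   v_k' = -i mu sum e^{is Phi} conj(v_k1) v_k2 v_k3 over k + k1 = k2 + k3, with phase
   Phi = -2 k k1 + 2 k2 k3.  Over one step, freezing v at m = (v(0) + v(tau)) / 2 costs
   O(tau^(1+gamma)): the first-order term of v(s) - m is odd about s = tau/2, and
   |e^{is Phi} - 1| is at most a power s^theta times theta-powers of the frequencies.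
   Replacing e^{isA+isB} by e^{isA} + e^{isB} - 1, as the scheme does, changes the kernel by
   (e^{isA} - 1)(e^{isB} - 1) = O(s^gamma (k k1 k2 k3)^(gamma/2)), which gamma extra
   derivatives absorb.  For r > 1/2 the trilinear sums are tame on H^r, so the fixed-point
   iteration contracts and a discrete Gronwall argument, run first in a weaker norm r' < r,
   adds up the local errors.

   Passing between functions and coefficients needs that an L^2 function with vanishing
   coefficients is zero a.e.: it is orthogonal to all trigonometric polynomials, in
   particular to p_n(c(x)) with p_n(q) = 1 - (1 - q^n)^(2^n) and c an affine image of
   cos(x - b/2); these converge boundedly to the indicator of [0, b], so the primitive of
   the function vanishes. *)
Require Import Defs.
From mathcomp Require Import all_boot all_order all_algebra.
From mathcomp Require Import all_classical all_reals all_analysis.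
From mathcomp Require Import measurable_realfun.
From mathcomp Require Import complex.
From mathcomp Require Import ring lra zify.
Import Order.TTheory GRing.Theory Num.Theory.
Import numFieldNormedType.Exports.
Local Open Scope classical_set_scope.
Local Open Scope ring_scope.

(** The order of quantifiers shapes the statements: [tau_R] and [C] may depend on [mu], [T], [r],
    [rho] and [gamma] only, so every estimate fixes its constant before the kernel, the coefficient
    sequences and [tau] are named. The symmetric midpoint matters when gamma > 1: v(s) - m is only
    O(tau), and cancellation of its leading part, a multiple of s - tau/2, gains the missing power.
    With theta = max(gamma - 1, 0) the oscillating factors cost 2 theta <= gamma derivatives and
    leave an error tau^(2 + theta), at most tau^(1 + gamma). The weaker norm is there because for
    gamma = 0 the H^r error bound does not become small with tau, so it cannot by itself keep the
    iterates in a fixed ball. A step of the scheme is the limit of an iteration whose convergence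
    depends on the size of the current iterate; existence of the iterates is therefore proved
    together with the error bound, the bound at step n being what makes step n + 1 solvable. *)

Local Notation nc := Normc.normc.
Local Notation Re := complex.Re.
Local Notation Im := complex.Im.

(** * Complex norms and unconditional sums *)

Section ComplexNorm.
Context {R : realType}.
Implicit Types (z w : R[i]) (x y : R).

Lemma le_eq (x y : R) : x = y -> x <= y.
Proof. by move=> ->. Qed.

Lemma nc_ge0 z : 0 <= nc z.
Proof. by case: z => a b; rewrite /= sqrtr_ge0. Qed.

Lemma ncM z w : nc (z * w) = nc z * nc w.
Proof. exact: Normc.normcM. Qed.

Lemma ncD z w : nc (z + w) <= nc z + nc w.
Proof. exact: (@le_normcD R z w). Qed.

Lemma ncN z : nc (- z) = nc z.
Proof. exact: (@normcN R z). Qed.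

Lemma ncB z w : nc (z - w) <= nc z + nc w.
Proof. by rewrite -(ncN w) ncD. Qed.

Lemma nc_distC z w : nc (z - w) = nc (w - z).
Proof. by rewrite -ncN opprB. Qed.

Lemma nc0 : nc (0 : R[i]) = 0.
Proof. exact: Normc.normc0. Qed.

Lemma nc_eq0 z : nc z = 0 -> z = 0.
Proof. exact: Normc.eq0_normc. Qed.

Lemma nc_real x : nc (x%:C)%C = `|x|.
Proof. by rewrite /= expr0n /= addr0 sqrtr_sqr. Qed.

Lemma nc_i : nc ('i%C : R[i]) = 1.
Proof. by rewrite /= expr0n expr1n /= add0r sqrtr1. Qed.

Lemma nc_conj z : nc (z^*)%C = nc z.
Proof. by case: z => a b /=; rewrite sqrrN. Qed.

Lemma nc_sqr z : nc z ^+ 2 = Re z ^+ 2 + Im z ^+ 2.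
Proof. by case: z => a b /=; rewrite sqr_sqrtr// addr_ge0// sqr_ge0. Qed.

Lemma nc_Re z : `|Re z| <= nc z.
Proof.
case: z => a b /=; rewrite -sqrtr_sqr ler_wsqrtr// lerDl sqr_ge0 //.
Qed.

Lemma nc_Im z : `|Im z| <= nc z.
Proof.
case: z => a b /=; rewrite -sqrtr_sqr ler_wsqrtr// lerDr sqr_ge0 //.
Qed.

Lemma nc_le_ReIm z : nc z <= `|Re z| + `|Im z|.
Proof.
rewrite -(ler_pXn2r (n := 2)) ?nnegrE ?nc_ge0 ?addr_ge0//.
rewrite nc_sqr -[Re z ^+ 2]real_normK ?num_real// -[Im z ^+ 2]real_normK ?num_real//.
rewrite sqrrD; have := mulr_ge0 (normr_ge0 (Re z)) (normr_ge0 (Im z)); lra.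
Qed.

Lemma nc_cis x : nc (cis x) = 1.
Proof. by rewrite /= cos2Dsin2 sqrtr1. Qed.

Lemma cisD x y : cis (x + y) = cis x * cis y.
Proof.
rewrite /cis cosD sinD; apply/eqP; rewrite eq_complex /= eqxx /=.
by rewrite addrC [cos x * _ + _]addrC [cos x * _]mulrC addrC mulrC.
Qed.

Lemma cis0 : cis 0 = 1 :> R[i].
Proof. by rewrite /cis cos0 sin0. Qed.

Lemma cisN x : cis (- x) = ((cis x)^*)%C.
Proof. by rewrite /cis cosN sinN. Qed.

Lemma cisMN x : cis x * cis (- x) = 1.
Proof. by rewrite -cisD subrr cis0. Qed.

Lemma ReD z w : Re (z + w) = Re z + Re w. Proof. by case: z w => [a b] []. Qed.
Lemma ImD z w : Im (z + w) = Im z + Im w. Proof. by case: z w => [a b] []. Qed.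
Lemma ReN z : Re (- z) = - Re z. Proof. by case: z. Qed.
Lemma ImN z : Im (- z) = - Im z. Proof. by case: z. Qed.
Lemma ReM z w : Re (z * w) = Re z * Re w - Im z * Im w. Proof. by case: z w => [a b] []. Qed.
Lemma ImM z w : Im (z * w) = Re z * Im w + Im z * Re w. Proof. by case: z w => [a b] []. Qed.

Lemma Re_sum (I : Type) (J : seq I) (f : I -> R[i]) :
  Re (\sum_(i <- J) f i) = \sum_(i <- J) Re (f i).
Proof. by elim: J => [|i J IH]; rewrite ?big_nil// !big_cons ReD IH. Qed.

Lemma Im_sum (I : Type) (J : seq I) (f : I -> R[i]) :
  Im (\sum_(i <- J) f i) = \sum_(i <- J) Im (f i).
Proof. by elim: J => [|i J IH]; rewrite ?big_nil// !big_cons ImD IH. Qed.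

Lemma complexP z w : Re z = Re w -> Im z = Im w -> z = w.
Proof. by case: z w => [a b] [c d] /= -> ->. Qed.

Lemma nc_sum (I : Type) (J : seq I) (P : pred I) (f : I -> R[i]) :
  nc (\sum_(i <- J | P i) f i) <= \sum_(i <- J | P i) nc (f i).
Proof.
elim/big_rec2 : _ => [|i y1 y2 _ H]; first by rewrite nc0.
by apply: le_trans (ncD _ _) _; rewrite lerD2l.
Qed.

Lemma conjcD z w : ((z + w)^*)%C = ((z^*)%C + (w^*)%C).
Proof. by case: z w => [a b] [c d]; rewrite /= opprD. Qed.

Lemma conjcM z w : ((z * w)^*)%C = ((z^*)%C * (w^*)%C).
Proof. exact: rmorphM. Qed.

Lemma conjcN z : ((- z)^*)%C = - (z^*)%C.
Proof. by case: z. Qed.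

Lemma conjc_cis x : ((cis x)^*)%C = cis (- x).
Proof. by rewrite cisN. Qed.

Lemma nc_le_lim z (B : R) : (forall e, 0 < e -> nc z <= B + e) -> nc z <= B.
Proof. by move=> h; apply/ler_addgt0Pr. Qed.

End ComplexNorm.

(** * Unconditional sums as limits over finite sets *)

Section Summation.
Context {R : realType} {I : choiceType}.
Implicit Types (D : set I) (f g : I -> R[i]) (J : seq I).

Definition inD D J := forall i, i \in J -> D i.

(** Convergence along the net of finite subsets of [D]. [csum] is built from positive and negative
    parts through [fine], which does not commute with algebra; linearity is proved for this
    relation, whose limit is unique, and carried over to [csum] under [abs_bounded]. *)
Definition has_csum D f (s : R[i]) := forall e : R, 0 < e ->
  exists J, [/\ uniq J, inD D J & forall J', uniq J' -> inD D J' ->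
    {subset J <= J'} -> nc (\sum_(i <- J') f i - s) <= e].

Definition abs_bounded D f (B : R) := forall J, uniq J -> inD D J ->
  \sum_(i <- J) nc (f i) <= B.

Lemma sum_subseq_le (g : I -> R) J J' : (forall i, 0 <= g i) -> uniq J -> uniq J' ->
  {subset J <= J'} -> \sum_(i <- J) g i <= \sum_(i <- J') g i.
Proof.
move=> g0 uJ uJ' JJ'.
have pJ : perm_eq J ([seq i <- J' | i \in J]).
  apply: uniq_perm => //; first exact: filter_uniq.
  move=> i; rewrite mem_filter /=; case: (boolP (i \in J)) => [/JJ' ->|] //.
rewrite (perm_big _ pJ) big_filter /= [leRHS](bigID (fun i => i \in J)) /=.
by rewrite lerDl sumr_ge0.
Qed.

Lemma esum_seq D (g : I -> R) (B : R) : (forall i, 0 <= g i) ->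
  (forall J, uniq J -> inD D J -> \sum_(i <- J) g i <= B) ->
  (\esum_(i in D) (g i)%:E <= B%:E)%E.
Proof.
move=> g0 h; apply: ge_ereal_sup => _ [A [Afin AD] <-].
rewrite fsbig_finite//= sumEFin lee_fin; apply: h; first exact: finmap.fset_uniq.
by move=> i; rewrite in_fset_set// inE => /AD.
Qed.

Lemma esum_seq_ge D (g : I -> R) J : (forall i, 0 <= g i) -> uniq J -> inD D J ->
  ((\sum_(i <- J) g i)%:E <= \esum_(i in D) (g i)%:E)%E.
Proof.
move=> g0 uJ JD; rewrite -sumEFin; apply: ereal_sup_ubound; exists [set` J].
  by split; [exact: finite_seq|move=> i /JD].
by rewrite -fsbig_seq.
Qed.

(** Bounded partial sums keep the extended sum finite, so [fine] returns the true supremum and not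
    the default value 0. *)
Lemma esum_approx D (g : I -> R) (B : R) : (forall i, 0 <= g i) ->
  (forall J, uniq J -> inD D J -> \sum_(i <- J) g i <= B) ->
  (forall J, uniq J -> inD D J -> \sum_(i <- J) g i <= fine (\esum_(i in D) (g i)%:E)) /\
  (forall e, 0 < e -> exists J, [/\ uniq J, inD D J &
     fine (\esum_(i in D) (g i)%:E) - e <= \sum_(i <- J) g i]).
Proof.
move=> g0 h; have hB := esum_seq D g B g0 h.
have fn : (\esum_(i in D) (g i)%:E)%E \is a fin_num.
  rewrite ge0_fin_numE ?(le_lt_trans hB) ?ltry//.
  by apply: esum_ge0 => i _; rewrite lee_fin.
split=> [J uJ JD|e e0]; first by rewrite -lee_fin fineK// esum_seq_ge.
apply: contrapT => hn.
have : (\esum_(i in D) (g i)%:E <= (fine (\esum_(i in D) (g i)%:E) - e)%:E)%E.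
  apply: esum_seq => // J uJ JD; rewrite leNgt; apply/negP => hl.
  by apply: hn; exists J; split => //; exact: ltW.
by rewrite EFinB fineK// -(fineK fn) -EFinB lee_fin; lra.
Qed.

(** Positive and negative part are both dominated by [|f|], so each has a finite supremum; a finite
    set that nearly attains both remains nearly optimal when enlarged, by monotonicity. *)
Lemma rsum_approx D (f : I -> R) (B : R) :
  (forall J, uniq J -> inD D J -> \sum_(i <- J) `|f i| <= B) ->
  forall e, 0 < e -> exists J, [/\ uniq J, inD D J & forall J', uniq J' ->
    inD D J' -> {subset J <= J'} -> `|\sum_(i <- J') f i - rsum D f| <= e].
Proof.
move=> h e e0.
pose p i := Num.max (f i) 0; pose q i := Num.max (- f i) 0.
have p0 i : 0 <= p i by rewrite le_max lexx orbT.
have q0 i : 0 <= q i by rewrite le_max lexx orbT.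
have fpq i : f i = p i - q i by rewrite /p /q !maxEle; do 2 case: ifP; lra.
have pf i : p i <= `|f i| by rewrite ge_max ler_norm normr_ge0.
have qf i : q i <= `|f i| by rewrite ge_max -normrN ler_norm normr_ge0.
have hp J : uniq J -> inD D J -> \sum_(i <- J) p i <= B.
  by move=> uJ JD; apply: le_trans (h J uJ JD); exact: ler_sum.
have hq J : uniq J -> inD D J -> \sum_(i <- J) q i <= B.
  by move=> uJ JD; apply: le_trans (h J uJ JD); exact: ler_sum.
have [p1 p2] := esum_approx D p B p0 hp; have [q1 q2] := esum_approx D q B q0 hq.
have [Jp [uJp JpD Hp]] := p2 e e0; have [Jq [uJq JqD Hq]] := q2 e e0.
exists (undup (Jp ++ Jq)); split; first exact: undup_uniq.
  by move=> i; rewrite mem_undup mem_cat => /orP[/JpD|/JqD].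
move=> J' uJ' J'D sJ'.
have Sp : \sum_(i <- Jp) p i <= \sum_(i <- J') p i.
  by apply: sum_subseq_le => // i iJ; apply: sJ'; rewrite mem_undup mem_cat iJ.
have Sq : \sum_(i <- Jq) q i <= \sum_(i <- J') q i.
  by apply: sum_subseq_le => // i iJ; apply: sJ'; rewrite mem_undup mem_cat iJ orbT.
have Tp := p1 J' uJ' J'D; have Tq := q1 J' uJ' J'D.
rewrite (eq_bigr _ (fun i _ => fpq i)) big_split /= sumrN /rsum -/p -/q.
move: Hp Hq Sp Sq Tp Tq; rewrite /p /q ler_norml; lra.
Qed.

Lemma csum_has D f B : abs_bounded D f B -> has_csum D f (csum D f).
Proof.
move=> h e e0; have e2 : 0 < e / 2 by lra.
have hR J : uniq J -> inD D J -> \sum_(i <- J) `|Re (f i)| <= B.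
  by move=> uJ JD; apply: le_trans (h J uJ JD); apply: ler_sum => i _; exact: nc_Re.
have hI J : uniq J -> inD D J -> \sum_(i <- J) `|Im (f i)| <= B.
  by move=> uJ JD; apply: le_trans (h J uJ JD); apply: ler_sum => i _; exact: nc_Im.
have [J1 [u1 D1 H1]] := rsum_approx D _ B hR _ e2.
have [J2 [u2 D2 H2]] := rsum_approx D _ B hI _ e2.
exists (undup (J1 ++ J2)); split; first exact: undup_uniq.
  by move=> i; rewrite mem_undup mem_cat => /orP[/D1|/D2].
move=> J' uJ' J'D sJ'.
have S1 : {subset J1 <= J'} by move=> i iJ; apply: sJ'; rewrite mem_undup mem_cat iJ.
have S2 : {subset J2 <= J'}.
  by move=> i iJ; apply: sJ'; rewrite mem_undup mem_cat iJ orbT.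
apply: le_trans (nc_le_ReIm _) _; rewrite ReD ImD ReN ImN Re_sum Im_sum /=.
by have := H1 J' uJ' J'D S1; have := H2 J' uJ' J'D S2; lra.
Qed.

Lemma has_csum_join D f g s t e : has_csum D f s -> has_csum D g t -> 0 < e ->
  exists J, [/\ uniq J, inD D J & forall J', uniq J' -> inD D J' ->
    {subset J <= J'} -> nc (\sum_(i <- J') f i - s) <= e /\
                        nc (\sum_(i <- J') g i - t) <= e].
Proof.
move=> hf hg e0; have [J1 [u1 D1 H1]] := hf e e0; have [J2 [u2 D2 H2]] := hg e e0.
exists (undup (J1 ++ J2)); split; first exact: undup_uniq.
  by move=> i; rewrite mem_undup mem_cat => /orP[/D1|/D2].
move=> J' uJ' J'D sJ'; split.
  by apply: H1 => // i iJ; apply: sJ'; rewrite mem_undup mem_cat iJ.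
by apply: H2 => // i iJ; apply: sJ'; rewrite mem_undup mem_cat iJ orbT.
Qed.

Lemma nc_eq_lim (z w : R[i]) : (forall e, 0 < e -> nc (z - w) <= e) -> z = w.
Proof.
move=> h; apply/eqP; rewrite -subr_eq0; apply/eqP/nc_eq0/eqP.
rewrite eq_le nc_ge0 andbT; apply: nc_le_lim => e e0.
by rewrite add0r; exact: h.
Qed.

Lemma has_csum_unique D f s t : has_csum D f s -> has_csum D f t -> s = t.
Proof.
move=> hs ht; apply: nc_eq_lim => e e0; have e2 : 0 < e / 2 by lra.
have [J [uJ JD H]] := has_csum_join _ _ _ _ _ _ hs ht e2.
have [] := H J uJ JD (fun _ => id); set S := \sum_(i <- J) _.
have -> : s - t = (S - t) - (S - s) by ring.
by move=> h1 h2; apply: le_trans (ncB _ _) _; lra.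
Qed.

Lemma has_csumD D f g s t : has_csum D f s -> has_csum D g t ->
  has_csum D (fun i => f i + g i) (s + t).
Proof.
move=> hs ht e e0; have e2 : 0 < e / 2 by lra.
have [J [uJ JD H]] := has_csum_join _ _ _ _ _ _ hs ht e2.
exists J; split=> // J' uJ' J'D sJ'; have [h1 h2] := H J' uJ' J'D sJ'.
rewrite big_split /= opprD addrACA.
by apply: le_trans (ncD _ _) _; lra.
Qed.

Lemma has_csumZ D f s c : has_csum D f s -> has_csum D (fun i => c * f i) (c * s).
Proof.
move=> hs e e0; have e1 : 0 < e / (nc c + 1).
  by rewrite divr_gt0// ltr_wpDl// nc_ge0.
have [J [uJ JD H]] := hs _ e1.
exists J; split=> // J' uJ' J'D sJ'; have h1 := H J' uJ' J'D sJ'.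
rewrite -mulr_sumr -mulrBr ncM; apply: le_trans (_ : (nc c + 1) * (e / (nc c + 1)) <= _).
  by apply: ler_pM => //; [exact: nc_ge0|exact: nc_ge0|rewrite lerDl].
by rewrite mulrC divfK// gt_eqF// ltr_wpDl// nc_ge0.
Qed.

Lemma eq_has_csum D f g s : (forall i, D i -> f i = g i) -> has_csum D f s ->
  has_csum D g s.
Proof.
move=> fg hs e e0; have [J [uJ JD H]] := hs e e0.
exists J; split=> // J' uJ' J'D sJ'.
by rewrite (eq_big_seq f) ?H// => i /J'D /fg.
Qed.

Lemma has_csum_seq D f s e : has_csum D f s -> 0 < e -> exists J, [/\ uniq J, inD D J &
  nc s <= \sum_(i <- J) nc (f i) + e].
Proof.
move=> hs e0; have [J [uJ JD H]] := hs e e0; exists J; split=> //.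
have := H J uJ JD (fun _ => id); have := nc_sum I J xpredT f.
set S := \sum_(i <- J) f i; have := ncB S (S - s); rewrite subKr; lra.
Qed.

Lemma has_csum_norm D f s B : has_csum D f s -> abs_bounded D f B -> nc s <= B.
Proof.
move=> hs hB; apply: nc_le_lim => e e0.
have [J [uJ JD H]] := has_csum_seq _ _ _ _ hs e0.
by apply: le_trans H _; rewrite lerD2r; exact: hB.
Qed.

Lemma abs_boundedD D f g A B : abs_bounded D f A -> abs_bounded D g B ->
  abs_bounded D (fun i => f i + g i) (A + B).
Proof.
move=> hf hg J uJ JD; apply: le_trans (_ : \sum_(i <- J) (nc (f i) + nc (g i)) <= _).
  by apply: ler_sum => i _; exact: ncD.
by rewrite big_split lerD//; [exact: hf|exact: hg].
Qed.

Lemma abs_boundedZ D f c A : abs_bounded D f A ->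
  abs_bounded D (fun i => c * f i) (nc c * A).
Proof.
move=> hf J uJ JD; under eq_bigr do rewrite ncM.
by rewrite -mulr_sumr; apply: ler_wpM2l; [exact: nc_ge0|exact: hf].
Qed.

Lemma le_abs_bounded D f g A : abs_bounded D f A ->
  (forall i, D i -> nc (g i) <= nc (f i)) -> abs_bounded D g A.
Proof.
move=> hf fg J uJ JD; apply: le_trans (hf J uJ JD); rewrite big_seq [leRHS]big_seq.
by apply: ler_sum => i iJ; exact/fg/JD.
Qed.

Lemma csumD D f g A B : abs_bounded D f A -> abs_bounded D g B ->
  csum D (fun i => f i + g i) = csum D f + csum D g.
Proof.
move=> hf hg; apply: has_csum_unique (csum_has _ _ _ (abs_boundedD _ _ _ _ _ hf hg)) _.
by apply: has_csumD; [exact: csum_has hf|exact: csum_has hg].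
Qed.

Lemma csumZ D f c A : abs_bounded D f A -> csum D (fun i => c * f i) = c * csum D f.
Proof.
move=> hf; apply: has_csum_unique (csum_has _ _ _ (abs_boundedZ _ _ c _ hf)) _.
exact: has_csumZ (csum_has _ _ _ hf).
Qed.

Lemma eq_csum D f g A : abs_bounded D f A -> (forall i, D i -> f i = g i) ->
  csum D f = csum D g.
Proof.
move=> hf fg; have hg : abs_bounded D g A.
  by apply: le_abs_bounded hf _ => i /fg ->.
by apply: has_csum_unique (csum_has _ _ _ hg); exact: eq_has_csum (csum_has _ _ _ hf).
Qed.

Lemma csum_norm D f A : abs_bounded D f A -> nc (csum D f) <= A.
Proof. by move=> hf; exact: has_csum_norm (csum_has _ _ _ hf) hf. Qed.

Lemma has_csum_finite D f J : uniq J -> inD D J ->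
  (forall i, D i -> i \notin J -> f i = 0) -> has_csum D f (\sum_(i <- J) f i).
Proof.
move=> uJ JD h e e0; exists J; split=> // J' uJ' J'D sJ'.
suff -> : \sum_(i <- J') f i = \sum_(i <- J) f i by rewrite subrr nc0 ltW.
have pJ : perm_eq J [seq i <- J' | i \in J].
  apply: uniq_perm => //; first exact: filter_uniq.
  by move=> i; rewrite mem_filter /=; case: (boolP (i \in J)) => [/sJ' ->|].
rewrite (perm_big _ pJ) big_filter [LHS](bigID (fun i => i \in J)) /=.
by rewrite [X in _ + X]big1_seq ?addr0// => i /andP[iJ iJ']; apply: h => //; exact: J'D.
Qed.

End Summation.

(** * Finite l^2 inequalities *)

Section FiniteSums.
Context {R : realType} {I : eqType}.
Implicit Types (J : seq I) (x y : I -> R).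

Lemma sum_sqr_ge0 J x : 0 <= \sum_(i <- J) x i ^+ 2.
Proof. by apply: sumr_ge0 => i _; exact: sqr_ge0. Qed.

Lemma cauchy_schwarz J x y :
  (\sum_(i <- J) x i * y i) ^+ 2 <= (\sum_(i <- J) x i ^+ 2) * (\sum_(i <- J) y i ^+ 2).
Proof.
elim: J => [|i J]; first by rewrite !big_nil expr0n mul0r.
rewrite !big_cons; have := sum_sqr_ge0 J x; have := sum_sqr_ge0 J y.
set P := \sum_(_ <- J) x _ ^+ 2; set Q := \sum_(_ <- J) y _ ^+ 2.
set S := \sum_(_ <- J) _ * _; set a := x i; set b := y i => Q0 P0 SPQ.
have h0 : 0 <= P * b ^+ 2 + Q * a ^+ 2 by rewrite addr_ge0// mulr_ge0// sqr_ge0.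
have h : 2 * (S * (a * b)) <= P * b ^+ 2 + Q * a ^+ 2.
  apply: le_trans (ler_norm _) _.
  rewrite -(ler_pXn2r (n := 2)) ?nnegrE// real_normK ?num_real//.
  have -> : (2 * (S * (a * b))) ^+ 2 = 4 * S ^+ 2 * (a * b) ^+ 2 by ring.
  apply: le_trans (_ : 4 * (P * Q) * (a * b) ^+ 2 <= _).
    by rewrite ler_wpM2r ?sqr_ge0// ler_wpM2l.
  rewrite -subr_ge0; have -> : (P * b ^+ 2 + Q * a ^+ 2) ^+ 2 - 4 * (P * Q) * (a * b) ^+ 2
     = (P * b ^+ 2 - Q * a ^+ 2) ^+ 2 by ring.
  exact: sqr_ge0.
rewrite -subr_ge0; have -> : (a ^+ 2 + P) * (b ^+ 2 + Q) - (a * b + S) ^+ 2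
  = (P * Q - S ^+ 2) + (P * b ^+ 2 + Q * a ^+ 2 - 2 * (S * (a * b))) by ring.
by apply: addr_ge0; rewrite subr_ge0.
Qed.

Lemma cauchy_schwarz_le J x y X Y : 0 <= X -> 0 <= Y ->
  \sum_(i <- J) x i ^+ 2 <= X ^+ 2 -> \sum_(i <- J) y i ^+ 2 <= Y ^+ 2 ->
  \sum_(i <- J) x i * y i <= X * Y.
Proof.
move=> X0 Y0 hx hy; apply: le_trans (ler_norm _) _.
rewrite -(ler_pXn2r (n := 2)) ?nnegrE ?mulr_ge0// real_normK ?num_real//.
apply: le_trans (cauchy_schwarz _ _ _) _; rewrite exprMn.
by apply: ler_pM => //; exact: sum_sqr_ge0.
Qed.

Lemma minkowski_le J x y X Y : 0 <= X -> 0 <= Y ->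
  \sum_(i <- J) x i ^+ 2 <= X ^+ 2 -> \sum_(i <- J) y i ^+ 2 <= Y ^+ 2 ->
  \sum_(i <- J) (x i + y i) ^+ 2 <= (X + Y) ^+ 2.
Proof.
move=> X0 Y0 hx hy; have hxy := cauchy_schwarz_le J x y X Y X0 Y0 hx hy.
under eq_bigr do rewrite sqrrD -mulr_natr.
by rewrite !big_split /= -mulr_suml sqrrD -mulr_natr; lra.
Qed.

Lemma l2_dual J x B : 0 <= B ->
  (forall d : I -> R, (forall i, 0 <= d i) -> forall X, 0 <= X -> \sum_(i <- J) d i ^+ 2 <= X ^+ 2 ->
    \sum_(i <- J) d i * `|x i| <= X * B) ->
  \sum_(i <- J) x i ^+ 2 <= B ^+ 2.
Proof.
move=> B0 h; set S := \sum_(i <- J) x i ^+ 2.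
have S0 : 0 <= S by exact: sum_sqr_ge0.
have eS : \sum_(i <- J) `|x i| ^+ 2 = S.
  by apply: eq_bigr => i _; rewrite real_normK ?num_real.
have := h (fun i => `|x i|) (fun i => normr_ge0 _) (Num.sqrt S) (sqrtr_ge0 _).
rewrite eS sqr_sqrtr// => /(_ (lexx _)).
move=> H; have [->|Sn0] := eqVneq S 0; first exact: sqr_ge0.
have sS : 0 < Num.sqrt S by rewrite sqrtr_gt0 lt_neqAle eq_sym Sn0.
move: H; rewrite -{1}(sqr_sqrtr S0) expr2 ler_pM2l// => H.
by rewrite -(sqr_sqrtr S0) ler_pXn2r// nnegrE// ltW.
Qed.

End FiniteSums.

(** * Frequency weights and their summability *)

Section Weights.
Context {R : realType}.
Implicit Types (s t : R) (k : int).

Lemma powRD_gt0 (x : R) s t : 0 < x -> x `^ (s + t) = x `^ s * x `^ t.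
Proof. by move=> x0; rewrite /powR gt_eqF// -expRD -mulrDl. Qed.

Definition wt s k : R := bracket k `^ s.

Lemma bracket_ge1 k : 1 <= bracket k :> R.
Proof.
rewrite /bracket; case: eqVneq => // k0; rewrite -intr_norm -[1]/(1%:~R) ler_int.
by rewrite -gtz0_ge1 normr_gt0.
Qed.

Lemma bracket_gt0 k : 0 < bracket k :> R.
Proof. exact: lt_le_trans ltr01 (bracket_ge1 k). Qed.

Lemma norm_le_bracket k : `|k%:~R| <= bracket k :> R.
Proof. by rewrite /bracket; case: eqVneq => [->|//]; rewrite normr0. Qed.

Lemma wt_gt0 s k : 0 < wt s k.
Proof. by rewrite powR_gt0// bracket_gt0. Qed.

Lemma wt_ge0 s k : 0 <= wt s k.
Proof. exact/ltW/wt_gt0. Qed.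

Lemma wt_ge1 s k : 0 <= s -> 1 <= wt s k.
Proof. by move=> s0; rewrite /wt -(powRr0 (bracket k)) ler_powR// bracket_ge1. Qed.

Lemma wtD s t k : wt (s + t) k = wt s k * wt t k.
Proof. by rewrite /wt powRD_gt0// bracket_gt0. Qed.

Lemma wt_le s t k : s <= t -> wt s k <= wt t k.
Proof. by move=> st; rewrite ler_powR// bracket_ge1. Qed.

Lemma wt0 k : wt 0 k = 1.
Proof. by rewrite /wt powRr0. Qed.

Lemma bracket_tri k k1 k2 k3 : k + k1 = k2 + k3 ->
  bracket k <= bracket k1 + bracket k2 + bracket k3 :> R.
Proof.
move=> e; rewrite {1}/bracket; case: eqVneq => [_|_].
  have := bracket_ge1 k1; have := bracket_ge1 k2; have := bracket_ge1 k3; lra.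
have -> : k = k2 + k3 - k1 by rewrite -e addrK.
rewrite rmorphB rmorphD /=.
have := norm_le_bracket k1; have := norm_le_bracket k2; have := norm_le_bracket k3.
have := ler_normB (k2%:~R + k3%:~R : R) k1%:~R.
by have := ler_normD (k2%:~R : R) k3%:~R; lra.
Qed.

(** The largest of the three brackets is at least a third of [bracket k], so its power alone
    dominates; the sum on the right covers all three cases. *)
Lemma wt_tri s k k1 k2 k3 : 0 <= s -> k + k1 = k2 + k3 ->
  wt s k <= 3 `^ s * (wt s k1 + wt s k2 + wt s k3).
Proof.
move=> s0 e; have h := bracket_tri _ _ _ _ e.
have H j : bracket k <= 3 * bracket j :> R -> wt s k <= 3 `^ s * wt s j.
  move=> hj; rewrite /wt -powRM// ?(ltW (bracket_gt0 _))//.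
  have := bracket_gt0 j; have := bracket_gt0 k => bk bj.
  by apply: ge0_ler_powR => //; rewrite nnegrE; lra.
have p3 : 0 <= 3 `^ s :> R by exact: powR_ge0.
have [w1 [w2 w3]] := (wt_ge0 s k1, (wt_ge0 s k2, wt_ge0 s k3)).
rewrite !mulrDr; have m1 := mulr_ge0 p3 w1; have m2 := mulr_ge0 p3 w2.
have m3 := mulr_ge0 p3 w3.
case: (lerP (bracket k) (3 * bracket k1 : R)) => [/H|h1]; first lra.
case: (lerP (bracket k) (3 * bracket k2 : R)) => [/H|h2]; first lra.
case: (lerP (bracket k) (3 * bracket k3 : R)) => [/H|h3]; first lra.
by exfalso; lra.
Qed.

(** Discrete stand-in for integrating x^(-1-a). After division by (x + 1)^(-a) it reads 1 + a/(x +
    1) <= (x/(x + 1))^(-a), which follows from exp y >= 1 + y and ln(1 - z) <= -z with z = 1/(x +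
    1). *)
Lemma powR_step (a x : R) : 0 < a -> 0 < x ->
  a * (x + 1) `^ (- (1 + a)) <= x `^ (- a) - (x + 1) `^ (- a).
Proof.
move=> a0 x0; have x10 : 0 < x + 1 by lra.
have -> : - (1 + a) = - a + - 1 by ring.
rewrite powRD_gt0// (powR_inv1 (ltW x10)).
have -> : x `^ (- a) = (x + 1) `^ (- a) * (x / (x + 1)) `^ (- a).
  by rewrite -powRM ?divr_ge0 ?(ltW x0) ?(ltW x10)// mulrC divfK// gt_eqF.
have q0 : 0 < x / (x + 1) by rewrite divr_gt0.
have p0 : 0 < (x + 1) `^ (- a) by rewrite powR_gt0.
suff h : 1 + a / (x + 1) <= (x / (x + 1)) `^ (- a).
  have := ler_wpM2l (ltW p0) h; rewrite mulrDr mulr1.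
  rewrite (mulrCA _ a) => H; rewrite lerBrDr addrC; exact: H.
rewrite /powR gt_eqF//; apply: le_trans (expR_ge1Dx _).
rewrite lerD2l mulNr -mulrN ler_pM2l//.
have : ln (1 + - (x + 1)^-1) <= - (x + 1)^-1.
  by apply: le_ln1Dx; rewrite ltrNl opprK invf_lt1//; lra.
have -> : 1 + - (x + 1)^-1 = x / (x + 1) by field; rewrite gt_eqF.
by move=> h; rewrite lerNr.
Qed.

Lemma sum_powR_le (a : R) n : 0 < a ->
  \sum_(i < n) (i.+1%:R) `^ (- (1 + a)) <= 1 + a^-1 :> R.
Proof.
move=> a0; suff h : \sum_(i < n.+1) (i.+1%:R) `^ (- (1 + a)) <=
   1 + a^-1 * (1 - n.+1%:R `^ (- a)) :> R.
  apply: le_trans (_ : \sum_(i < n.+1) (i.+1%:R) `^ (- (1 + a)) <= _).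
    by rewrite big_ord_recr /= lerDl powR_ge0.
  apply: le_trans h _; rewrite lerD2l -[leRHS]mulr1 ler_pM2l ?invr_gt0//.
elim: n => [|n IH]; first by rewrite big_ord1 !powR1 subrr mulr0 addr0.
rewrite big_ord_recr /=; have := powR_step a n.+1%:R a0 (ltr0Sn _ _).
move=> h.
have {}h : n.+2%:R `^ (- (1 + a)) <= a^-1 * (n.+1%:R `^ (- a) - n.+2%:R `^ (- a)).
  by rewrite ler_pdivlMl//; move: h; rewrite natr1.
move: IH h; rewrite !mulrBr; lra.
Qed.

Lemma sum_wt_bounded s : 1 < s -> exists2 C : R, 0 <= C & forall J : seq int, uniq J ->
  \sum_(k <- J) wt (- s) k <= C.
Proof.
move=> s1; pose a := s - 1; have a0 : 0 < a by rewrite subr_gt0.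
have sa : - s = - (1 + a) by rewrite /a; ring.
have C0 : 0 <= 1 + a^-1 by rewrite addr_ge0// invr_ge0 ltW.
exists (1 + (1 + a^-1) + (1 + a^-1)); first lra.
move=> J uJ.
(* On a list of nonzero integers of one sign the absolute value is injective into the positive
   naturals, where the telescoping bound applies. The constant is 1 for the mode 0 plus 1 + 1/a for
   each sign. *)
have key (L : seq int) : uniq L -> {in L &, injective absz} -> {in L, forall k, k != 0} ->
    \sum_(k <- L) wt (- s) k <= 1 + a^-1.
  move=> uL iL nL; pose n := \max_(k <- L) `|k|%N.
  apply: le_trans (sum_powR_le a n a0).
  rewrite -(big_mkord xpredT (fun i => i.+1%:R `^ (- (1 + a)))).
  rewrite -(big_add1 _ _ 0 n.+1 xpredT (fun i => i%:R `^ (- (1 + a)))) /=.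
  have -> : \sum_(k <- L) wt (- s) k = \sum_(m <- map absz L) m%:R `^ (- (1 + a)).
    rewrite big_map; apply: eq_big_seq => k /nL k0.
    by rewrite /wt /bracket (negPf k0) -intr_norm sa.
  apply: sum_subseq_le; rewrite ?map_inj_in_uniq ?iota_uniq//.
  move=> m /mapP[k kL ->]; rewrite mem_index_iota ltnS.
  by rewrite absz_gt0 nL//=; exact: leq_bigmax_seq.
rewrite (bigID (fun k : int => k == 0)) /= -addrA; apply: lerD.
  rewrite -big_filter; have : (size [seq i <- J | i == (0 : int)] <= 1)%N.
    by rewrite size_filter (count_uniq_mem 0 uJ) leq_b1.
  have : all (fun k : int => k == 0) [seq i <- J | i == 0] by exact: filter_all.
  case: [seq i <- J | i == 0] => [|k [|//]] /=; first by rewrite big_nil.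
  by rewrite andbT big_seq1 => /eqP -> _; rewrite /wt /bracket eqxx powR1.
rewrite (bigID (fun k : int => 0 <= k)) /= -!big_filter_cond.
rewrite -!(big_filter [seq _ <- J | _]).
apply: lerD; apply: key.
- by rewrite !filter_uniq.
- by move=> x y; rewrite !mem_filter => /andP[x0 _] /andP[y0 _]; lia.
- by move=> x; rewrite !mem_filter => /andP[_ /andP[]].
- by rewrite !filter_uniq.
- by move=> x y; rewrite !mem_filter => /andP[x0 _] /andP[y0 _]; lia.
- by move=> x; rewrite !mem_filter => /andP[_ /andP[]].
Qed.

End Weights.

(** * Sobolev bounds on coefficient sequences *)

Section SobolevBounds.
Context {R : realType}.
Implicit Types (s t B : R) (a b : int -> R[i]) (k : int) (J : seq int).

(* The H^s norm of a function with Fourier coefficients [a] is at most [B]; finite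
   partial sums keep the whole convergence argument inside [R]. *)
Definition Hle s a B := 0 <= B /\ forall J, uniq J ->
  \sum_(k <- J) (wt s k * nc (a k)) ^+ 2 <= B ^+ 2.

Lemma Hle_ge0 s a B : Hle s a B -> 0 <= B.
Proof. by case. Qed.

Lemma Hle_mono s t a b A B : t <= s -> A <= B -> (forall k, nc (b k) <= nc (a k)) ->
  Hle s a A -> Hle t b B.
Proof.
move=> ts AB ba [A0 h]; split; first exact: le_trans AB.
move=> J uJ; apply: le_trans (_ : A ^+ 2 <= _); last first.
  by rewrite ler_pXn2r// nnegrE// (le_trans A0).
apply: le_trans (h J uJ); apply: ler_sum => k _; rewrite ler_pXn2r ?nnegrE ?mulr_ge0 ?wt_ge0 ?nc_ge0//.
by apply: ler_pM; rewrite ?wt_ge0 ?nc_ge0// wt_le.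
Qed.

Lemma Hle_le s a A B : A <= B -> Hle s a A -> Hle s a B.
Proof. by move=> AB; exact: Hle_mono. Qed.

Lemma Hle_wt s t a A : t <= s -> Hle s a A -> Hle t a A.
Proof. by move=> ts; exact: Hle_mono. Qed.

Lemma Hle_nc s a b A : (forall k, nc (b k) <= nc (a k)) -> Hle s a A -> Hle s b A.
Proof. by move=> ts; exact: Hle_mono. Qed.

Lemma Hle_eq s a b A : (forall k, a k = b k) -> Hle s a A -> Hle s b A.
Proof. by move=> e; apply: Hle_nc => k; rewrite e. Qed.

Lemma Hle0 s : Hle s (fun=> 0) 0.
Proof.
by split=> // J uJ; rewrite big1 ?expr0n// => k _; rewrite nc0 mulr0 expr0n.
Qed.

Lemma HleD s a b A B : Hle s a A -> Hle s b B -> Hle s (fun k => a k + b k) (A + B).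
Proof.
move=> [A0 hA] [B0 hB]; split; first exact: addr_ge0.
move=> J uJ; apply: le_trans (minkowski_le J _ _ A B A0 B0 (hA J uJ) (hB J uJ)).
apply: ler_sum => k _; rewrite -mulrDr ler_pXn2r ?nnegrE ?mulr_ge0 ?wt_ge0 ?addr_ge0 ?nc_ge0//.
by apply: ler_wpM2l; [exact: wt_ge0|exact: ncD].
Qed.

Lemma HleN s a A : Hle s a A -> Hle s (fun k => - a k) A.
Proof. by apply: Hle_nc => k; rewrite ncN. Qed.

Lemma HleB s a b A B : Hle s a A -> Hle s b B -> Hle s (fun k => a k - b k) (A + B).
Proof. by move=> hA hB; exact: HleD (HleN _ _ _ hB). Qed.

Lemma HleZ s c a A : Hle s a A -> Hle s (fun k => c * a k) (nc c * A).
Proof.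
move=> [A0 h]; split; first by rewrite mulr_ge0// nc_ge0.
move=> J uJ; rewrite exprMn; apply: le_trans (ler_wpM2l (sqr_ge0 _) (h J uJ)).
by rewrite mulr_sumr; apply: ler_sum => k _; rewrite ncM mulrCA exprMn.
Qed.

Lemma Hle_wcoef s a A k : Hle s a A -> wt s k * nc (a k) <= A.
Proof.
move=> [A0 /(_ [:: k] isT)]; rewrite big_seq1 ler_pXn2r// nnegrE//.
by rewrite mulr_ge0 ?wt_ge0 ?nc_ge0.
Qed.

Lemma Hle_coef s a A k : 0 <= s -> Hle s a A -> nc (a k) <= A.
Proof.
move=> s0 /(Hle_wcoef _ _ _ k); apply: le_trans.
by rewrite ler_peMl ?nc_ge0// wt_ge1.
Qed.

Lemma le_lin_eps (x y M : R) : 0 <= M -> (forall e, 0 < e -> x <= y + e * M) -> x <= y.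
Proof.
move=> M0 h; apply/ler_addgt0Pr => e e0.
have M1 : 0 < M + 1 by lra.
apply: le_trans (h (e / (M + 1)) _) _; first by rewrite divr_gt0.
rewrite lerD2l mulrAC ler_pdivrMr// ler_pM2l//; lra.
Qed.

Lemma sqr_le_lin_eps (x A M : R) : 0 <= A -> 0 <= M ->
  (forall e, 0 < e -> x <= (A + e * M) ^+ 2) -> x <= A ^+ 2.
Proof.
move=> A0 M0 h; apply: (le_lin_eps _ _ (2 * A * M + M ^+ 2)).
  by rewrite addr_ge0 ?sqr_ge0// !mulr_ge0.
move=> e e0; have [e1|e1] := leP e 1.
  apply: le_trans (h e e0) _.
  have -> : (A + e * M) ^+ 2 = A ^+ 2 + e * (2 * A * M) + e * e * M ^+ 2 by ring.
  rewrite mulrDr addrA lerD2l ler_wpM2r ?sqr_ge0//; nra.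
apply: le_trans (h 1 ltr01) _.
have -> : (A + 1 * M) ^+ 2 = A ^+ 2 + (2 * A * M + M ^+ 2) by ring.
rewrite lerD2l ler_peMl ?(ltW e1)//.
by rewrite addr_ge0 ?sqr_ge0// !mulr_ge0.
Qed.

(** Fatou's lemma for sequences: balls of H^s are closed under coefficientwise convergence. A
    partial sum sees only the modes in [J], so the approximant may depend on [J] and [e]. *)
Lemma Hle_lim s a A : 0 <= A -> (forall J e, 0 < e -> exists2 b,
  Hle s b (A + e) & forall k, k \in J -> nc (a k - b k) <= e) -> Hle s a A.
Proof.
move=> A0 h; split=> // J uJ.
(* [M] converts an error [e] per mode into an H^s error of at most [e * M] on [J]. *)
pose M : R := \sum_(k <- J) wt s k.
have M0 : 0 <= M by apply: sumr_ge0 => k _; exact: wt_ge0.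
apply: (sqr_le_lin_eps _ _ (1 + M)) => //; first by rewrite addr_ge0.
move=> e e0; have [b [_ hb] hab] := h J e e0.
have eM0 : 0 <= e * M by rewrite mulr_ge0// ltW.
have e1 : \sum_(k <- J) (wt s k * nc (a k - b k)) ^+ 2 <= (e * M) ^+ 2.
  have step : \sum_(k <- J) (wt s k * nc (a k - b k)) ^+ 2 <=
     \sum_(k <- J) (e * wt s k) * (e * M).
    rewrite big_seq [leRHS]big_seq; apply: ler_sum => k kJ.
    have w0 := wt_ge0 s k; have n0 := nc_ge0 (a k - b k).
    have wM : wt s k <= M.
      rewrite /M (perm_big _ (perm_to_rem kJ)) /= big_cons lerDl.
      by apply: sumr_ge0 => j _; exact: wt_ge0.
    rewrite expr2; have h1 : wt s k * nc (a k - b k) <= e * wt s k.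
      by rewrite mulrC ler_wpM2r// hab.
    apply: ler_pM => //; rewrite ?mulr_ge0//.
    by apply: le_trans h1 _; rewrite ler_wpM2l// ltW.
  by apply: le_trans step _; rewrite -mulr_suml -mulr_sumr expr2.
have Ae : 0 <= A + e by rewrite addr_ge0// ltW.
have := minkowski_le J _ _ _ _ Ae eM0 (hb J uJ) e1.
have -> : A + e + e * M = A + e * (1 + M) by ring.
apply: le_trans; apply: ler_sum => k _.
rewrite -mulrDr ler_pXn2r ?nnegrE ?mulr_ge0 ?wt_ge0 ?addr_ge0 ?nc_ge0//.
apply: ler_wpM2l; first exact: wt_ge0.
by have := ncD (b k) (a k - b k); rewrite addrC subrK.
Qed.

(** The least admissible bound is the norm itself, obtained as a supremum. It is needed where an
    estimate has the unknown norm on both sides, as in [error_step]. *)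
Lemma Hle_min s a Z : Hle s a Z ->
  exists2 N, Hle s a N & forall B, Hle s a B -> N <= B.
Proof.
move=> [Z0 hZ]; pose E := [set x | exists2 J, uniq J &
  x = Num.sqrt (\sum_(k <- J) (wt s k * nc (a k)) ^+ 2)].
have E0 : E 0 by exists [::] => //; rewrite big_nil sqrtr0.
have ub B : Hle s a B -> ubound E B.
  move=> [B0 hB] _ [J uJ ->]; rewrite -(ger0_norm B0) -sqrtr_sqr.
  by rewrite ler_wsqrtr// hB.
have hE : has_sup E by split; [exists 0|exists Z; exact: ub].
exists (sup E); last by move=> B /ub hB; apply: ge_sup => //; exists 0.
have hs := sup_upper_bound hE.
have sE0 : 0 <= sup E by exact: hs.
split=> // J uJ.
have S0 : 0 <= \sum_(k <- J) (wt s k * nc (a k)) ^+ 2 by exact: sum_sqr_ge0.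
rewrite -(sqr_sqrtr S0) ler_pXn2r ?nnegrE ?sqrtr_ge0//.
by apply: hs; exists J.
Qed.

(** Cauchy-Schwarz against the weights [wt (- s)], which are square summable because s > 1/2. This
    is the source of the condition s > 1/2 in the trilinear estimates. *)
Lemma l1_bound s : 2^-1 < s -> exists2 C, 0 <= C & forall (t : R) a A, Hle (s + t) a A ->
  forall J, uniq J -> \sum_(k <- J) wt t k * nc (a k) <= C * A.
Proof.
move=> hs; have s2 : 1 < 2 * s by lra.
have [C C0 hC] := sum_wt_bounded _ s2; exists (Num.sqrt C); first exact: sqrtr_ge0.
move=> t a A [A0 hA] J uJ.
apply: le_trans (_ : \sum_(k <- J) wt (- s) k * (wt (s + t) k * nc (a k)) <= _).
  apply: ler_sum => k _; rewrite mulrA -wtD.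
  by have -> : - s + (s + t) = t by ring.
apply: cauchy_schwarz_le; rewrite ?sqrtr_ge0 ?sqr_sqrtr//; last exact: hA.
apply: le_trans (hC J uJ); apply: ler_sum => k _.
by rewrite expr2 -wtD; have -> : - s + - s = - (2 * s) by ring.
Qed.

End SobolevBounds.

(** * Trilinear estimates *)

Section Trilinear.
Context {R : realType}.

(** Young's inequality l^1 * l^1 * l^2 -> l^2, tested against [d] in l^2. Three frequencies
    determine the summation index and the fourth is [z] of them. After enlarging to a full product,
    the sum over the first frequency is a Cauchy-Schwarz pairing, because [z] is injective in it,
    and the two l^1 sums split off. *)
Lemma young (Q : choiceType) (J : seq Q) (f g h l : Q -> int) (z : int -> int -> int -> int)
    (d A B C : int -> R) (X a b c : R) :
  uniq J -> {in J &, injective (fun q => (f q, g q, h q))} ->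
  (forall q, q \in J -> l q = z (f q) (g q) (h q)) ->
  (forall x y, injective (fun k => z k x y)) ->
  (forall k, 0 <= d k) -> (forall k, 0 <= A k) -> (forall k, 0 <= B k) ->
  (forall k, 0 <= C k) -> 0 <= X -> 0 <= c ->
  (forall K, uniq K -> \sum_(k <- K) d k ^+ 2 <= X ^+ 2) ->
  (forall K, uniq K -> \sum_(k <- K) A k <= a) ->
  (forall K, uniq K -> \sum_(k <- K) B k <= b) ->
  (forall K, uniq K -> \sum_(k <- K) C k ^+ 2 <= c ^+ 2) ->
  \sum_(q <- J) d (f q) * (A (g q) * B (h q) * C (l q)) <= X * (a * b * c).
Proof.
move=> uJ inj lz zinj d0 A0 B0 C0 X0 c0 hd hA hB hC.
pose F (p : int * int * int) := d p.1.1 * (A p.1.2 * B p.2 * C (z p.1.1 p.1.2 p.2)).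
have F0 p : 0 <= F p by rewrite !mulr_ge0.
pose Kf := undup (map f J); pose Kg := undup (map g J); pose Kh := undup (map h J).
have -> : \sum_(q <- J) d (f q) * (A (g q) * B (h q) * C (l q)) =
    \sum_(p <- map (fun q => (f q, g q, h q)) J) F p.
  by rewrite big_map; apply: eq_big_seq => q /lz ->.
pose P := [seq (p, y) | p <- [seq (k, x) | k <- Kf, x <- Kg], y <- Kh].
apply: le_trans (_ : \sum_(p <- P) F p <= _).
  apply: sum_subseq_le => //; first by rewrite map_inj_in_uniq.
    rewrite !allpairs_uniq ?undup_uniq//; by move=> [x y] [x' y'] _ _ [-> ->].
  move=> p /mapP[q qJ ->]; apply: allpairs_f; last by rewrite mem_undup map_f.
  by apply: allpairs_f; rewrite mem_undup map_f.
rewrite !big_allpairs /= /F /= exchange_big /=.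
have -> : X * (a * b * c) = a * (b * (X * c)) by ring.
apply: le_trans (_ : \sum_(x <- Kg) A x * (b * (X * c)) <= _); last first.
  have b0 : 0 <= b by have := hB [::] isT; rewrite big_nil.
  by rewrite -mulr_suml ler_wpM2r ?mulr_ge0// hA// undup_uniq.
apply: ler_sum => x _; rewrite exchange_big /=.
apply: le_trans (_ : A x * \sum_(y <- Kh) B y * (X * c) <= _); last first.
  apply: ler_wpM2l => //.
  by rewrite -mulr_suml ler_wpM2r ?mulr_ge0// hB// undup_uniq.
rewrite mulr_sumr; apply: ler_sum => y _.
have -> : \sum_(k <- Kf) d k * (A x * B y * C (z k x y)) =
   A x * (B y * \sum_(k <- Kf) d k * C (z k x y)).
  by rewrite mulrA mulr_sumr; apply: eq_bigr => k _; rewrite mulrCA.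
apply: ler_wpM2l => //; apply: ler_wpM2l => //.
apply: cauchy_schwarz_le => //; first by apply: hd; exact: undup_uniq.
have := hC (map (fun k => z k x y) Kf); rewrite big_map; apply.
by rewrite map_inj_uniq ?undup_uniq.
Qed.

Definition quad (k : int) : set (int * int * int) :=
  [set p | k + p.1.1 = p.1.2 + p.2].

Definition tri_term (K : int -> int * int * int -> R[i]) (a b c : int -> R[i]) k
    (p : int * int * int) : R[i] :=
  K k p * ((a p.1.1)^*%C * b p.1.2 * c p.2).

Definition tri K a b c (k : int) : R[i] := csum (quad k) (tri_term K a b c k).

Lemma nc_tri_term K a b c k p :
  nc (tri_term K a b c k p) = nc (K k p) * (nc (a p.1.1) * nc (b p.1.2) * nc (c p.2)).
Proof. by rewrite /tri_term !ncM nc_conj. Qed.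

(** The growth allowed for a kernel: [t] derivatives on each of the four frequencies. *)
Definition wt4 (t : R) k (p : int * int * int) : R :=
  wt t k * (wt t p.1.1 * wt t p.1.2 * wt t p.2).

(** A kernel of size [wt4 t] puts a weight [t] on every frequency. The one on [k] joins [wt s k],
    and [wt_tri] moves s + t onto one input, which then carries s + 2t in l^2; the other two carry
    [t] and are summed in l^1 through s' > 1/2. Hence the tame form: in each product one factor is
    measured with [s] and two with [s']. *)
Lemma tri_finite (s s' t : R) : 0 <= s -> 2^-1 < s' -> 0 <= t ->
  exists2 C : R, 0 <= C & forall (K : int -> int * int * int -> R[i]) (kap : R) a b c
    (A1 A0 B1 B0 C1 C0 : R), 0 <= kap ->
    (forall k p, quad k p -> nc (K k p) <= kap * wt4 t k p) ->
    Hle (s + 2 * t) a A1 -> Hle (s + 2 * t) b B1 -> Hle (s + 2 * t) c C1 ->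
    Hle (s' + 2 * t) a A0 -> Hle (s' + 2 * t) b B0 -> Hle (s' + 2 * t) c C0 ->
    forall (d : int -> R) X (J : seq (int * (int * int * int))),
      (forall k, 0 <= d k) -> 0 <= X ->
      (forall L, uniq L -> \sum_(k <- L) d k ^+ 2 <= X ^+ 2) ->
      uniq J -> (forall q, q \in J -> quad q.1 q.2) ->
      \sum_(q <- J) d q.1 * (wt s q.1 * nc (tri_term K a b c q.1 q.2)) <=
      X * (C * kap * (A1 * B0 * C0 + A0 * B1 * C0 + A0 * B0 * C1)).
Proof.
move=> s0 hs' t0; have [C1' C1'0 hl1] := l1_bound _ hs'.
have p30 : 0 <= 3 `^ (s + t) :> R by exact: powR_ge0.
exists (3 `^ (s + t) * (C1' * C1')); first by rewrite !mulr_ge0.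
move=> K kap a b c A1 A0 B1 B0 C1 C0 kap0 hK ha1 hb1 hc1 ha0 hb0 hc0 d X J d0 X0 hd uJ JD.
pose u (x : int -> R[i]) k := wt t k * nc (x k).
pose v (x : int -> R[i]) k := wt (s + 2 * t) k * nc (x k).
have u0 x k : 0 <= u x k by rewrite mulr_ge0 ?wt_ge0 ?nc_ge0.
have v0 x k : 0 <= v x k by rewrite mulr_ge0 ?wt_ge0 ?nc_ge0.
have hu x Y : Hle (s' + 2 * t) x Y -> forall L, uniq L -> \sum_(k <- L) u x k <= C1' * Y.
  by move=> hx; apply: hl1; apply: Hle_wt hx; lra.
have hv x Y : Hle (s + 2 * t) x Y -> forall L, uniq L -> \sum_(k <- L) v x k ^+ 2 <= Y ^+ 2.
  by case.
apply: le_trans (_ : \sum_(q <- J) (3 `^ (s + t) * kap) * (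
   d q.1 * (u b q.2.1.2 * u c q.2.2 * v a q.2.1.1) +
   d q.1 * (u a q.2.1.1 * u c q.2.2 * v b q.2.1.2) +
   d q.1 * (u a q.2.1.1 * u b q.2.1.2 * v c q.2.2)) <= _).
  rewrite big_seq [leRHS]big_seq; apply: ler_sum => -[k [[k1 k2] k3]] /JD /= qk.
  rewrite -!mulrDr [leRHS]mulrCA; apply: ler_wpM2l; first exact: d0.
  rewrite nc_tri_term /=.
  have n0 : 0 <= nc (a k1) * nc (b k2) * nc (c k3) by rewrite !mulr_ge0 ?nc_ge0.
  apply: le_trans (_ : wt s k * (kap * wt4 t k (k1, k2, k3) * (nc (a k1) * nc (b k2) * nc (c k3))) <= _).
    by rewrite ler_wpM2l ?wt_ge0// ler_wpM2r//; exact: hK.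
  pose M := kap * (wt t k1 * wt t k2 * wt t k3) * (nc (a k1) * nc (b k2) * nc (c k3)).
  have M0 : 0 <= M by rewrite !mulr_ge0 ?wt_ge0 ?nc_ge0.
  have := ler_wpM2r M0 (wt_tri (s + t) k k1 k2 k3 (addr_ge0 s0 t0) qk).
  rewrite /u /v; have -> : s + 2 * t = s + t + t by ring.
  rewrite /wt4 /= !(wtD (s + t) t) (wtD s t k) /M => H.
  by apply: le_trans (le_trans _ H) _; apply: le_eq; ring.
rewrite -mulr_sumr !big_split /=.
have -> : X * (3 `^ (s + t) * (C1' * C1') * kap * (A1 * B0 * C0 + A0 * B1 * C0 + A0 * B0 * C1)) =
  (3 `^ (s + t) * kap) * (X * (C1' * B0 * (C1' * C0) * A1) + X * (C1' * A0 * (C1' * C0) * B1) +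
    X * (C1' * A0 * (C1' * B0) * C1)) by ring.
apply: ler_wpM2l; first exact: mulr_ge0.
have inj k k1 k2 k3 k' k1' k2' k3' : (k, (k1, k2, k3)) \in J -> (k', (k1', k2', k3')) \in J ->
  k + k1 = k2 + k3 /\ k' + k1' = k2' + k3' by move=> /JD h1 /JD h2.
apply: lerD; first apply: lerD.
- apply: (young _ J (fun q => q.1) (fun q => q.2.1.2) (fun q => q.2.2) (fun q => q.2.1.1)
    (fun k x y => x + y - k) d (u b) (u c) (v a)) => //; rewrite ?(Hle_ge0 _ _ _ ha1)//.
  + move=> [k [[k1 k2] k3]] [k' [[k1' k2'] k3']] h1 h2 /= [e1 e2 e3].
    have [e4 e5] := inj _ _ _ _ _ _ _ _ h1 h2; subst k' k2' k3'.
    by rewrite -e4 in e5; move/addrI: e5 => ->.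
  + move=> [k [[k1 k2] k3]] /JD /= <-; by rewrite addrC addKr.
  + by move=> x y k k' /addrI /oppr_inj.
  + exact: hu hb0.
  + exact: hu hc0.
  + exact: hv ha1.
- apply: (young _ J (fun q => q.1) (fun q => q.2.1.1) (fun q => q.2.2) (fun q => q.2.1.2)
    (fun k x y => k + x - y) d (u a) (u c) (v b)) => //; rewrite ?(Hle_ge0 _ _ _ hb1)//.
  + move=> [k [[k1 k2] k3]] [k' [[k1' k2'] k3']] h1 h2 /= [e1 e2 e3].
    have [e4 e5] := inj _ _ _ _ _ _ _ _ h1 h2; subst k' k1' k3'.
    by rewrite e4 in e5; move/addIr: e5 => ->.
  + move=> [k [[k1 k2] k3]] /JD /= ->; by rewrite addrK.
  + by move=> x y k k' /addIr /addIr.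
  + exact: hu ha0.
  + exact: hu hc0.
  + exact: hv hb1.
- apply: (young _ J (fun q => q.1) (fun q => q.2.1.1) (fun q => q.2.1.2) (fun q => q.2.2)
    (fun k x y => k + x - y) d (u a) (u b) (v c)) => //; rewrite ?(Hle_ge0 _ _ _ hc1)//.
  + move=> [k [[k1 k2] k3]] [k' [[k1' k2'] k3']] h1 h2 /= [e1 e2 e3].
    have [e4 e5] := inj _ _ _ _ _ _ _ _ h1 h2; subst k' k1' k2'.
    by rewrite e4 in e5; move/addrI: e5 => ->.
  + move=> [k [[k1 k2] k3]] /JD /= ->; by rewrite addrC addKr.
  + by move=> x y k k' /addIr /addIr.
  + exact: hu ha0.
  + exact: hu hb0.
  + exact: hv hc1.
Qed.

(** Passage from finite sums to [csum] by duality, the infinite inner sums being replaced by finite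
    ones up to [e]. *)
Lemma tri_bound (s s' t : R) : 0 <= s -> 2^-1 < s' -> 0 <= t ->
  exists2 C : R, 0 <= C & forall (K : int -> int * int * int -> R[i]) (kap : R) a b c
    (A1 A0 B1 B0 C1 C0 : R), 0 <= kap ->
    (forall k p, quad k p -> nc (K k p) <= kap * wt4 t k p) ->
    Hle (s + 2 * t) a A1 -> Hle (s + 2 * t) b B1 -> Hle (s + 2 * t) c C1 ->
    Hle (s' + 2 * t) a A0 -> Hle (s' + 2 * t) b B0 -> Hle (s' + 2 * t) c C0 ->
    let N := C * kap * (A1 * B0 * C0 + A0 * B1 * C0 + A0 * B0 * C1) in
    (forall k, abs_bounded (quad k) (tri_term K a b c k) N) /\ Hle s (tri K a b c) N.
Proof.
move=> s0 hs' t0; have [C C0 hC] := tri_finite s s' t s0 hs' t0; exists C => //.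
move=> K kap a b c A1 A0 B1 B0 C1' C0' kap0 hK ha1 hb1 hc1 ha0 hb0 hc0 N.
have {}hC := hC K kap a b c A1 A0 B1 B0 C1' C0' kap0 hK ha1 hb1 hc1 ha0 hb0 hc0.
have N0 : 0 <= N.
  have := (Hle_ge0 _ _ _ ha1, Hle_ge0 _ _ _ hb1, Hle_ge0 _ _ _ hc1,
           Hle_ge0 _ _ _ ha0, Hle_ge0 _ _ _ hb0, Hle_ge0 _ _ _ hc0).
  by move=> [[[[[h1 h2] h3] h4] h5] h6]; rewrite !mulr_ge0// !addr_ge0// !mulr_ge0.
have hb k : abs_bounded (quad k) (tri_term K a b c k) N.
  move=> J uJ JD.
  (* Testing with the indicator of the mode [k] isolates one inner sum; its weight is at least 1 and
     is dropped. *)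
  have := hC (fun j => if j == k then 1 else 0) 1 (map (fun p => (k, p)) J).
  rewrite big_map /= mul1r => H.
  apply: le_trans (H _ _ _ _ _).
  - rewrite eqxx; apply: ler_sum => p _; rewrite mul1r ler_peMl ?nc_ge0// wt_ge1//.
  - by move=> j; case: ifP.
  - by [].
  - move=> L uL; rewrite (eq_bigr (fun j => if j == k then 1 else 0)); last first.
      by move=> j _; case: ifP => _; rewrite ?expr1n ?expr0n.
    rewrite -big_mkcond /= -big_filter; have -> : 1 ^+ 2 = 1 :> R by rewrite expr1n.
    have : (size [seq i <- L | i == k] <= 1)%N.
      by rewrite size_filter (count_uniq_mem k uL) leq_b1.
    by case: [seq i <- L | i == k] => [|x [|//]] _; rewrite ?big_nil ?big_seq1.
  - by rewrite map_inj_uniq// => x y [].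
  - by move=> q /mapP[p pJ ->] /=; exact: JD.
split=> //; split=> // Ks uKs.
apply: l2_dual => // d d0 X X0 hdX.
under eq_bigr do rewrite ger0_norm ?mulr_ge0 ?wt_ge0 ?nc_ge0//.
pose M : R := \sum_(k <- Ks) d k * wt s k.
have M0 : 0 <= M by apply: sumr_ge0 => k _; rewrite mulr_ge0 ?wt_ge0.
apply: (le_lin_eps _ _ M) => // e e0.
(* Finite sets that capture each inner sum up to [e]. The total loss is [e * M], which [le_lin_eps]
   removes. *)
have /choice[Jk hJk] : forall k, exists J, [/\ uniq J, inD (quad k) J &
    nc (tri K a b c k) <= \sum_(p <- J) nc (tri_term K a b c k p) + e].
  by move=> k; apply: has_csum_seq => //; exact: csum_has (hb k).
pose J := [seq (k, p) | k <- Ks, p <- Jk k].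
have uJ : uniq J.
  apply: allpairs_uniq_dep => // [k _|]; first by have [] := hJk k.
  by move=> [k p] [k' p'] _ _ /= [-> ->].
have JD q : q \in J -> quad q.1 q.2.
  by move=> /allpairsPdep[k [p [kK pJ ->]]] /=; have [_ h _] := hJk k; exact: h.
(* [hC] asks for control of the test sequence on all modes, whereas [d] is controlled on [Ks]
   only. *)
pose d' k := if k \in Ks then d k else 0.
have := hC d' X J _ X0 _ uJ JD.
rewrite big_allpairs_dep /= => H.
apply: le_trans (_ : \sum_(k <- Ks) \sum_(p <- Jk k) d' k * (wt s k * nc (tri_term K a b c k p)) + e * M <= _).
  rewrite /M mulr_sumr -big_split /= big_seq [leRHS]big_seq; apply: ler_sum => k kK.
  rewrite /d' kK -!mulr_sumr; have [_ _ h] := hJk k.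
  rewrite (mulrC e) -mulrA -mulrDr; apply: ler_wpM2l; first exact: d0.
  by rewrite -mulrDr; apply: ler_wpM2l; rewrite ?wt_ge0.
rewrite lerD2r; apply: H; first by move=> k; rewrite /d'; case: ifP.
move=> L uL; apply: le_trans hdX; rewrite (bigID (fun k => k \in Ks)) /=.
rewrite [X in _ + X]big1 ?addr0; last by move=> k /negPf kK; rewrite /d' kK expr0n.
rewrite -big_filter; apply: le_trans (_ : \sum_(k <- [seq i <- L | i \in Ks]) d k ^+ 2 <= _).
  rewrite !big_filter; apply: ler_sum => k kK; by rewrite /d' kK.
apply: sum_subseq_le => //; first by move=> k; exact: sqr_ge0.
  exact: filter_uniq.
by move=> k; rewrite mem_filter => /andP[].
Qed.

End Trilinear.

(** * Uniform tails of summable families *)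

Section TailSums.
Context {R : realType} {I : choiceType}.
Implicit Types (D : set I) (f g : I -> R[i]) (J : seq I).

(** One finite set works for all families dominated by [f] at once, since what lies outside it is
    bounded by the tail of the moduli of [f]. This uniformity permits the same truncation for
    oscillating kernels at all times. *)
Lemma csum_tail_ge D f B : abs_bounded D f B -> forall e, 0 < e ->
  exists J0, [/\ uniq J0, inD D J0 & forall J, uniq J -> inD D J -> {subset J0 <= J} ->
    forall g, (forall i, D i -> nc (g i) <= nc (f i)) ->
    nc (csum D g - \sum_(i <- J) g i) <= e].
Proof.
move=> hf e e0.
have hB J : uniq J -> inD D J -> \sum_(i <- J) nc (f i) <= B by exact: hf.
have [u1 u2] := esum_approx D (fun i => nc (f i)) B (fun i => nc_ge0 _) hB.
have [J0 [uJ0 J0D hJ0]] := u2 e e0; exists J0; split=> // J uJ JD J0J g gf.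
have hJ : fine (\esum_(i in D) (nc (f i))%:E) - e <= \sum_(i <- J) nc (f i).
  by apply: le_trans hJ0 _; apply: sum_subseq_le => // i; exact: nc_ge0.
have hg : abs_bounded D g B by exact: le_abs_bounded hf gf.
apply: nc_le_lim => e' e'0.
have [J' [uJ' J'D hJ']] := csum_has _ _ _ hg e' e'0.
pose L := undup (J' ++ J).
have uL : uniq L by exact: undup_uniq.
have LD : inD D L by move=> i; rewrite mem_undup mem_cat => /orP[/J'D|/JD].
have sJ'L : {subset J' <= L} by move=> i iJ; rewrite mem_undup mem_cat iJ.
have sJL : {subset J <= L} by move=> i iJ; rewrite mem_undup mem_cat iJ orbT.
have pJ : perm_eq J [seq i <- L | i \in J].
  apply: uniq_perm => //; first exact: filter_uniq.
  by move=> i; rewrite mem_filter /=; case: (boolP (i \in J)) => [/sJL ->|].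
have h1 := hJ' L uL LD sJ'L.
have split_sum (V : zmodType) (u : I -> V) : \sum_(i <- L) u i =
    \sum_(i <- J) u i + \sum_(i <- L | i \notin J) u i.
  by rewrite (bigID (fun i => i \in J)) /= [in RHS](perm_big _ pJ) big_filter.
have h2 : \sum_(i <- L | i \notin J) nc (f i) <= e.
  have := u1 L uL LD; rewrite split_sum; move: hJ; lra.
have h3 : nc (\sum_(i <- L | i \notin J) g i) <= e.
  apply: le_trans (nc_sum _ _ _ _) _; apply: le_trans h2.
  rewrite big_seq_cond [leRHS]big_seq_cond; apply: ler_sum => i /andP[iL _].
  exact/gf/LD.
move: h1; rewrite split_sum; set s := csum D g; set x := \sum_(i <- J) _.
set y := \sum_(i <- L | _) _ in h3 *.
have -> : s - x = y - (x + y - s) by ring.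
move=> h1; apply: le_trans (ncB _ _) _; lra.
Qed.

Lemma csum_tail D f B : abs_bounded D f B -> forall e, 0 < e ->
  exists J, [/\ uniq J, inD D J & forall g, (forall i, D i -> nc (g i) <= nc (f i)) ->
    nc (csum D g - \sum_(i <- J) g i) <= e].
Proof.
move=> hf e e0; have [J [uJ JD hJ]] := csum_tail_ge _ _ _ hf e e0.
by exists J; split=> // g; exact: hJ.
Qed.

End TailSums.

(** * Mean value inequalities for coefficient sequences *)

Section MeanValue.
Context {R : realType}.

Lemma is_derive_lincomb (I : Type) (J : seq I) (p q : I -> R) (D : R -> I -> R[i]) (t : R)
    (h : I -> R[i]) : (forall k, is_cderive (D^~ k) t (h k)) ->
  is_derive t 1 (fun s => \sum_(k <- J) (p k * Re (D s k) + q k * Im (D s k)))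
    (\sum_(k <- J) (p k * Re (h k) + q k * Im (h k))).
Proof.
move=> hD; elim: J => [|k J IH].
  rewrite big_nil; rewrite (_ : (fun s => _) = cst 0); first exact: is_derive_cst.
  by apply/funext => s; rewrite big_nil.
rewrite big_cons (_ : (fun s => _) = (fun s => (p k * Re (D s k) + q k * Im (D s k))) +
   (fun s => \sum_(k <- J) (p k * Re (D s k) + q k * Im (D s k)))); last first.
  by apply/funext => s; rewrite big_cons.
apply: is_deriveD; have [h1 h2] := hD k.
by apply: is_deriveD; apply: is_deriveZ.
Qed.

Lemma within_continuousM' (A : set R) (f g : R -> R) : {within A, continuous f} ->
  {within A, continuous g} -> {within A, continuous (fun s => f s * g s)}.
Proof. by move=> hf hg x; exact: (@continuousM _ _ _ _ x (hf x) (hg x)). Qed.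

Definition ccont (a b : R) (f : R -> R[i]) :=
  {within `[a, b], continuous (fun s => Re (f s))} /\
  {within `[a, b], continuous (fun s => Im (f s))}.

Lemma continuous_lincomb (I : Type) (J : seq I) (p q : I -> R) (D : R -> I -> R[i]) (a b : R) :
  (forall k, ccont a b (D^~ k)) ->
  {within `[a, b], continuous (fun s => \sum_(k <- J) (p k * Re (D s k) + q k * Im (D s k)))}.
Proof.
move=> hD; elim: J => [|k J IH].
  rewrite (_ : (fun s => _) = cst 0); last by apply/funext => s; rewrite big_nil.
  by move=> x; exact: cst_continuous.
rewrite (_ : (fun s => _) = (fun s => (p k * Re (D s k) + q k * Im (D s k)) +
   (\sum_(k <- J) (p k * Re (D s k) + q k * Im (D s k))))); last first.
  by apply/funext => s; rewrite big_cons.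
have [h1 h2] := hD k.
have h0 c : {within `[a, b], continuous (cst c : R -> R)} by move=> x; exact: cst_continuous.
apply: within_continuousD; last exact: IH.
by apply: within_continuousD; apply: within_continuousM'; rewrite ?h1 ?h2//; exact: h0.
Qed.

(** The mean value theorem holds for scalars only, so it is applied to the weighted inner product
    [phi] of D s with the increment d = D b - D a. Then phi b - phi a is the squared norm [X], while
    Cauchy-Schwarz bounds the derivative of [phi] by sqrt X * B; one factor sqrt X cancels. *)
Lemma mvt_finite (I : eqType) (J : seq I) (w : I -> R) (D h : R -> I -> R[i]) (a b B : R) :
  a < b -> 0 <= B -> (forall k, ccont a b (D^~ k)) ->
  (forall t, a < t < b -> forall k, is_cderive (D^~ k) t (h t k)) ->
  (forall t, a < t < b -> \sum_(k <- J) (w k * nc (h t k)) ^+ 2 <= B ^+ 2) ->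
  \sum_(k <- J) (w k * nc (D b k - D a k)) ^+ 2 <= ((b - a) * B) ^+ 2.
Proof.
move=> ab B0 cD dD hB; pose d k := D b k - D a k.
pose p k := w k ^+ 2 * Re (d k); pose q k := w k ^+ 2 * Im (d k).
pose phi s := \sum_(k <- J) (p k * Re (D s k) + q k * Im (D s k)).
have [c cab] : exists2 c, c \in `]a, b[ & phi b - phi a =
     (\sum_(k <- J) (p k * Re (h c k) + q k * Im (h c k))) * (b - a).
  apply: (@MVT R phi (fun t => \sum_(k <- J) (p k * Re (h t k) + q k * Im (h t k)))) => //.
    by move=> t; rewrite in_itv /= => tab; apply: is_derive_lincomb; exact: dD.
  exact: continuous_lincomb.
move=> eX; set X := \sum_(k <- J) _ ^+ 2; have X0 : 0 <= X by exact: sum_sqr_ge0.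
have {}eX : X = (\sum_(k <- J) (p k * Re (h c k) + q k * Im (h c k))) * (b - a).
  rewrite -eX.
  rewrite /phi -sumrB; apply: eq_bigr => k _; rewrite exprMn nc_sqr /p /q /d !ReD !ImD !ReN !ImN.
  by ring.
have cab' : a < c < b by move: cab; rewrite in_itv.
have hX : X <= Num.sqrt X * B * (b - a).
  rewrite {1}eX; apply: ler_wpM2r; first by rewrite subr_ge0 ltW.
  apply: le_trans (_ : \sum_(k <- J) (w k * nc (d k)) * (w k * nc (h c k)) <= _).
    apply: ler_sum => k _; rewrite /p /q.
    have -> : w k ^+ 2 * Re (d k) * Re (h c k) + w k ^+ 2 * Im (d k) * Im (h c k) =
       w k ^+ 2 * Re (d k * (h c k)^*%C).
      by rewrite ReM; case: (h c k) => u v /=; ring.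
    rewrite mulrACA -expr2 ler_wpM2l ?sqr_ge0// -(nc_conj (h c k)) -ncM.
    exact: le_trans (ler_norm _) (nc_Re _).
  by apply: cauchy_schwarz_le => //; rewrite ?sqrtr_ge0 ?sqr_sqrtr//; exact: hB.
have [->|Xn0] := eqVneq X 0; first exact: sqr_ge0.
have sX : 0 < Num.sqrt X by rewrite sqrtr_gt0 lt_neqAle eq_sym Xn0.
move: hX; rewrite -{1}(sqr_sqrtr X0) expr2 -mulrA ler_pM2l// => hX.
have BA : 0 <= (b - a) * B by rewrite mulr_ge0// subr_ge0 ltW.
rewrite -(sqr_sqrtr X0) ler_pXn2r ?nnegrE ?sqrtr_ge0//.
by rewrite mulrC.
Qed.

Lemma nc_mvt (f h : R -> R[i]) (a b B : R) : a < b -> 0 <= B -> ccont a b f ->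
  (forall t, a < t < b -> is_cderive f t (h t)) ->
  (forall t, a < t < b -> nc (h t) <= B) -> nc (f b - f a) <= (b - a) * B.
Proof.
move=> ab B0 cf df hB.
have := @mvt_finite unit [:: tt] (fun=> 1) (fun t _ => f t) (fun t _ => h t) a b B ab B0.
rewrite big_seq1 mul1r => H; have {}H : nc (f b - f a) ^+ 2 <= ((b - a) * B) ^+ 2.
  apply: H => [_|t tab _|t tab]; [exact: cf|exact: df|].
  rewrite big_seq1 mul1r.
  by rewrite ler_pXn2r ?nnegrE ?nc_ge0//; exact: hB.
by move: H; rewrite ler_pXn2r ?nnegrE ?nc_ge0// mulr_ge0// subr_ge0 ltW.
Qed.

Lemma Hle_mvt s (D h : R -> int -> R[i]) (a b B : R) : a < b ->  0 <= B ->
  (forall k, ccont a b (D^~ k)) ->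
  (forall t, a < t < b -> forall k, is_cderive (D^~ k) t (h t k)) ->
  (forall t, a < t < b -> Hle s (h t) B) ->
  Hle s (fun k => D b k - D a k) ((b - a) * B).
Proof.
move=> ab B0 cD dD hB; split; first by rewrite mulr_ge0// subr_ge0 ltW.
move=> J uJ; apply: (@mvt_finite _ J (wt s) D h) => //.
by move=> t tab; have [_] := hB t tab; exact.
Qed.

Lemma Hle_finite s (J : seq int) (a : int -> R[i]) e : 0 <= e ->
  (forall k, k \notin J -> a k = 0) -> (forall k, nc (a k) <= e) ->
  Hle s a (e * \sum_(k <- J) wt s k).
Proof.
move=> e0 aJ ae; have M0 : 0 <= \sum_(k <- J) wt s k.
  by apply: sumr_ge0 => k _; exact: wt_ge0.
split=> [|L uL]; first exact: mulr_ge0.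
have wM k : k \in J -> wt s k <= \sum_(k <- J) wt s k.
  move=> kJ; rewrite (perm_big _ (perm_to_rem kJ)) /= big_cons lerDl.
  by apply: sumr_ge0 => j _; exact: wt_ge0.
set M := \sum_(k <- J) _ in M0 wM *.
apply: le_trans (_ : \sum_(k <- [seq k <- L | k \in J]) (e * wt s k) * (e * M) <= _).
  rewrite big_filter (bigID (fun k => k \in J)) /= [X in _ + X]big1 ?addr0; last first.
    by move=> k kJ; rewrite aJ// nc0 mulr0 expr0n.
  apply: ler_sum => k kJ; rewrite expr2.
  have h1 : wt s k * nc (a k) <= e * wt s k by rewrite mulrC ler_wpM2r// wt_ge0.
  apply: ler_pM => //; rewrite ?mulr_ge0 ?wt_ge0 ?nc_ge0//.
  by apply: le_trans h1 _; rewrite ler_wpM2l// wM.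
rewrite -mulr_suml -mulr_sumr expr2 ler_wpM2r ?mulr_ge0// ler_wpM2l//.
rewrite /M; apply: le_trans (_ : \sum_(k <- undup J) wt s k <= _).
  apply: sum_subseq_le; rewrite ?undup_uniq ?filter_uniq//; first by move=> k; exact: wt_ge0.
  by move=> k; rewrite mem_filter mem_undup => /andP[].
elim: {wM M M0 aJ} J => [|j J IH] /=; first by rewrite !big_nil.
case: ifP => _; rewrite ?big_cons; first by rewrite ler_wpDl// wt_ge0.
by rewrite lerD2l.
Qed.

Lemma is_cderive_cst (c : R[i]) t : is_cderive (fun=> c) t 0.
Proof. by split; exact: is_derive_cst. Qed.

Lemma is_cderiveD (f g : R -> R[i]) t df dg : is_cderive f t df -> is_cderive g t dg ->
  is_cderive (fun s => f s + g s) t (df + dg).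
Proof.
move=> [f1 f2] [g1 g2]; rewrite /is_cderive ReD ImD; split.
  rewrite (_ : (fun s => _) = (fun s => Re (f s)) + (fun s => Re (g s))).
    exact: is_deriveD.
  by apply/funext => s; rewrite ReD.
rewrite (_ : (fun s => _) = (fun s => Im (f s)) + (fun s => Im (g s))).
  exact: is_deriveD.
by apply/funext => s; rewrite ImD.
Qed.

Lemma is_cderiveN (f : R -> R[i]) t df : is_cderive f t df ->
  is_cderive (fun s => - f s) t (- df).
Proof.
move=> [f1 f2]; rewrite /is_cderive ReN ImN; split.
  rewrite (_ : (fun s => _) = - (fun s => Re (f s))); first exact: is_deriveN.
  by apply/funext => s; rewrite ReN.
rewrite (_ : (fun s => _) = - (fun s => Im (f s))); first exact: is_deriveN.
by apply/funext => s; rewrite ImN.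
Qed.

Lemma is_deriveM' (f g : R -> R) (t df dg : R) : is_derive t (1 : R) f df ->
  is_derive t (1 : R) g dg -> is_derive t (1 : R) (fun s => f s * g s) (df * g t + f t * dg).
Proof.
move=> hf hg; apply: (is_derive_eq (is_deriveM hf hg)).
by rewrite /GRing.scale /=; ring.
Qed.

Lemma is_deriveD' (f g : R -> R) (t df dg : R) : is_derive t (1 : R) f df ->
  is_derive t (1 : R) g dg -> is_derive t (1 : R) (fun s => f s + g s) (df + dg).
Proof. by move=> hf hg; exact: is_deriveD hf hg. Qed.

Lemma is_deriveB' (f g : R -> R) (t df dg : R) : is_derive t (1 : R) f df ->
  is_derive t (1 : R) g dg -> is_derive t (1 : R) (fun s => f s - g s) (df - dg).
Proof. by move=> hf hg; exact: is_deriveB hf hg. Qed.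

Lemma is_cderiveM (f g : R -> R[i]) t df dg : is_cderive f t df -> is_cderive g t dg ->
  is_cderive (fun s => f s * g s) t (df * g t + f t * dg).
Proof.
move=> [f1 f2] [g1 g2]; rewrite /is_cderive ReD ImD !ReM !ImM; split.
  rewrite (_ : (fun s => _) = (fun s => Re (f s) * Re (g s) - Im (f s) * Im (g s))).
    apply: (is_derive_eq (is_deriveB' _ _ _ _ _ (is_deriveM' _ _ _ _ _ f1 g1) (is_deriveM' _ _ _ _ _ f2 g2))).
    by ring.
  by apply/funext => s; rewrite ReM.
rewrite (_ : (fun s => _) = (fun s => Re (f s) * Im (g s) + Im (f s) * Re (g s))).
  apply: (is_derive_eq (is_deriveD' _ _ _ _ _ (is_deriveM' _ _ _ _ _ f1 g2) (is_deriveM' _ _ _ _ _ f2 g1))).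
  by ring.
by apply/funext => s; rewrite ImM.
Qed.

Lemma is_cderiveZ (f : R -> R[i]) c t df : is_cderive f t df ->
  is_cderive (fun s => c * f s) t (c * df).
Proof.
move=> hf; have := is_cderiveM _ _ _ _ _ (is_cderive_cst c t) hf.
by rewrite mul0r add0r.
Qed.

Lemma is_cderive_sum (I : Type) (J : seq I) (f : I -> R -> R[i]) t df :
  (forall i, is_cderive (f i) t (df i)) ->
  is_cderive (fun s => \sum_(i <- J) f i s) t (\sum_(i <- J) df i).
Proof.
move=> hf; elim: J => [|i J IH].
  rewrite big_nil (_ : (fun s => _) = (fun=> 0)); first exact: is_cderive_cst.
  by apply/funext => s; rewrite big_nil.
rewrite big_cons (_ : (fun s => _) = (fun s => f i s + \sum_(i <- J) f i s)).
  exact: is_cderiveD.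
by apply/funext => s; rewrite big_cons.
Qed.

Lemma is_cderive_real (f : R -> R) (t df : R) : is_derive t (1 : R) f df ->
  is_cderive (fun s => (f s)%:C%C) t (df%:C)%C.
Proof. by move=> hf; split => //=; exact: is_derive_cst. Qed.

Lemma is_cderive_cis (w t : R) :
  is_cderive (fun s => cis (w * s)) t ('i%C * w%:C%C * cis (w * t)).
Proof.
have hl : is_derive t 1 (fun s : R => w * s) w.
  have := is_deriveM' _ _ _ _ _ (is_derive_cst w t 1) (is_derive_id t 1).
  by rewrite mul0r add0r mulr1.
have -> : 'i%C * w%:C%C * cis (w * t) = (- (w * sin (w * t)) +i* (w * cos (w * t)))%C :> R[i].
  by apply: complexP => /=; ring.
split => /=.
  apply: (is_derive_eq (is_derive1_comp (is_derive_cos (w * t)) hl)).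
  by rewrite mulrC mulrN.
apply: (is_derive_eq (is_derive1_comp (is_derive_sin (w * t)) hl)).
by rewrite mulrC.
Qed.

Lemma ccont_derive a b (f h : R -> R[i]) : (forall t, is_cderive f t (h t)) -> ccont a b f.
Proof.
move=> hf; split; apply: continuous_subspaceT => t.
  have [h1 _] := hf t; apply: differentiable_continuous; apply/derivable1_diffP.
  exact: ex_derive.
have [_ h1] := hf t; apply: differentiable_continuous; apply/derivable1_diffP.
exact: ex_derive.
Qed.

Lemma ccontD a b (f g : R -> R[i]) : ccont a b f -> ccont a b g ->
  ccont a b (fun s => f s + g s).
Proof.
move=> [f1 f2] [g1 g2]; split=> x.
  rewrite (_ : (fun s => _) = (fun s => Re (f s) + Re (g s))).
    by apply: continuousD; [exact: f1|exact: g1].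
  by apply/funext => s; rewrite ReD.
rewrite (_ : (fun s => _) = (fun s => Im (f s) + Im (g s))).
  by apply: continuousD; [exact: f2|exact: g2].
by apply/funext => s; rewrite ImD.
Qed.

Lemma ccontM a b (f g : R -> R[i]) : ccont a b f -> ccont a b g ->
  ccont a b (fun s => f s * g s).
Proof.
move=> [f1 f2] [g1 g2]; split=> x.
  rewrite (_ : (fun s => _) = (fun s => Re (f s) * Re (g s) - Im (f s) * Im (g s))).
    exact: (within_continuousB (within_continuousM' _ _ _ f1 g1) (within_continuousM' _ _ _ f2 g2)).
  by apply/funext => s; rewrite ReM.
rewrite (_ : (fun s => _) = (fun s => Re (f s) * Im (g s) + Im (f s) * Re (g s))).
  exact: (within_continuousD (within_continuousM' _ _ _ f1 g2) (within_continuousM' _ _ _ f2 g1)).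
by apply/funext => s; rewrite ImM.
Qed.

Lemma ccont_cst a b (c : R[i]) : ccont a b (fun=> c).
Proof. by split=> x; exact: cst_continuous. Qed.

End MeanValue.

(** * Resonance kernels and trilinear forms *)

Section Kernels.
Context {R : realType}.
Implicit Types (w x s t tau : R) (k : int) (p : int * int * int).

Lemma is_derive_continuous (f : R -> R) (df : R -> R) :
  (forall t, is_derive t (1 : R) f (df t)) -> continuous f.
Proof.
move=> h t; apply: differentiable_continuous; apply/derivable1_diffP.
by have := h t => ht; exact: ex_derive.
Qed.

Lemma Rintegral_FTC (f g F : R -> R) (a b : R) : a < b ->
  (forall t, is_derive t (1 : R) F (f t)) -> (forall t, is_derive t (1 : R) f (g t)) ->
  \int[lebesgue_measure]_(x in `[a, b]) f x = F b - F a.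
Proof.
move=> ab dF df; rewrite /Rintegral (@continuous_FTC2 _ f F a b) //.
- exact: continuous_subspaceT (is_derive_continuous _ _ df).
- have cF := is_derive_continuous _ _ dF; split.
  + by move=> x _; have := dF x => h; exact: ex_derive.
  + by apply: cvg_at_right_filter; exact: cF.
  + by apply: cvg_at_left_filter; exact: cF.
- by move=> x _; rewrite derive1E; have := dF x => h; exact: derive_val.
Qed.

Lemma cintegral_FTC (f g F : R -> R[i]) (a b : R) : a < b ->
  (forall t, is_cderive F t (f t)) -> (forall t, is_cderive f t (g t)) ->
  cintegral a b f = F b - F a.
Proof.
move=> ab dF df; rewrite /cintegral; apply: complexP; rewrite /= ?ReD ?ImD ?ReN ?ImN.
  by apply: (Rintegral_FTC _ (fun t => Re (g t)) (fun t => Re (F t))) => // t;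
    [have [] := dF t|have [] := df t].
by apply: (Rintegral_FTC _ (fun t => Im (g t)) (fun t => Im (F t))) => // t;
  [have [] := dF t|have [] := df t].
Qed.

(** The antiderivative (e^{iws} - 1)/(iw) of e^{iws}, written in real and imaginary parts; the
    resonant case w = 0 takes its limit s. *)
Definition cis_primitive w s : R[i] :=
  if w == 0 then (s%:C)%C else ((sin (w * s) / w) +i* ((1 - cos (w * s)) / w))%C.

Lemma is_cderive_primitive w t : is_cderive (cis_primitive w) t (cis (w * t)).
Proof.
rewrite /cis_primitive; case: eqVneq => [->|w0].
  rewrite mul0r cis0; exact: (is_cderive_real id t 1 (is_derive_id t 1)).
have -> : (fun s => (sin (w * s) / w +i* ((1 - cos (w * s)) / w))%C) =
   (fun s => (- 'i%C / (w%:C)%C) * (cis (w * s) + (- 1))).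
  apply/funext => s; have wC : (w%:C)%C != 0 :> R[i] by rewrite eq_complex /= (negPf w0).
  apply: (mulIf wC); rewrite mulrAC divfK//.
  apply: complexP => /=; rewrite ?mulr0 ?subr0 ?addr0 ?mul0r ?add0r ?mul1r ?sub0r ?divfK//; ring.
have -> : cis (w * t) = - 'i%C / (w%:C)%C * ('i%C * (w%:C)%C * cis (w * t) + 0).
  have wC : (w%:C)%C != 0 :> R[i] by rewrite eq_complex /= (negPf w0).
  rewrite addr0; have -> : - 'i%C / w%:C%C * ('i%C * w%:C%C * cis (w * t)) =
    - ('i%C * 'i%C) * (w%:C%C / w%:C%C) * cis (w * t) by ring.
  rewrite divff// mulr1; have -> : 'i%C * 'i%C = -1 :> R[i].
    by apply: complexP => /=; ring.
  by rewrite opprK mul1r.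
by apply: is_cderiveZ; apply: is_cderiveD; [exact: is_cderive_cis|exact: is_cderive_cst].
Qed.

Lemma cis_primitive0 w : cis_primitive w 0 = 0.
Proof.
rewrite /cis_primitive; case: eqVneq => // _.
by rewrite mulr0 sin0 cos0 subrr !mul0r.
Qed.

Lemma nc_primitive w s : 0 < s -> nc (cis_primitive w s) <= s.
Proof.
move=> s0; have := nc_mvt (cis_primitive w) (fun t => cis (w * t)) 0 s 1 s0 ler01.
rewrite cis_primitive0 !subr0 mulr1; apply.
- exact: ccont_derive (is_cderive_primitive w).
- by move=> t _; exact: is_cderive_primitive.
- by move=> t _; rewrite nc_cis.
Qed.

Lemma nc_cisB1 x : nc (cis x - 1) <= `|x|.
Proof.
wlog x0 : x / 0 <= x => [H|].
  case: (lerP 0 x) => x0; first exact: H.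
  have := H (- x); rewrite normrN cisN -(nc_conj (cis x - 1)) conjcD conjcN conjc1.
  by apply; rewrite oppr_ge0 ltW.
move: x0; rewrite le_eqVlt => /orP[/eqP <-|x0].
  by rewrite cis0 subrr nc0.
rewrite ger0_norm ?(ltW x0)//.
have dc t : is_cderive (fun s : R => cis (1 * s)) t ('i%C * (1%:C)%C * cis (1 * t)).
  exact: is_cderive_cis.
have := nc_mvt (fun s => cis (1 * s)) _ 0 x 1 x0 ler01 (ccont_derive _ _ _ _ dc) (fun t _ => dc t).
rewrite mulr0 cis0 mul1r subr0 mulr1; apply=> t _.
by rewrite !ncM nc_cis nc_i nc_real normr1 !mulr1.
Qed.

Lemma nc_cisB1_2 x : nc (cis x - 1) <= 2.
Proof.
apply: le_trans (ncB _ _) _.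
by rewrite nc_cis Normc.normc1; lra.
Qed.

(** Interpolates between the bound |x|, used for |x| <= 1, and the trivial bound 2 beyond. *)
Lemma nc_cisB1_pow x t : 0 <= t <= 1 -> nc (cis x - 1) <= 2 * `|x| `^ t.
Proof.
move=> /andP[t0 t1]; have [x1|x1] := lerP `|x| 1.
  have [->|x0] := eqVneq x 0.
    by rewrite cis0 subrr nc0 mulr_ge0// powR_ge0.
  apply: le_trans (nc_cisB1 x) _.
  have := ger1_powR (a := `|x|) (r := t); rewrite x1 normr_gt0 x0 => /(_ isT t1).
  have := powR_ge0 `|x| t; lra.
apply: le_trans (nc_cisB1_2 x) _.
have : 1 <= `|x| `^ t by rewrite -(powRr0 `|x|) ler_powR// ltW.
lra.
Qed.

Definition phaseA k p : R := - (2 * k%:~R * p.1.1%:~R).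
Definition phaseB p : R := 2 * p.1.2%:~R * p.2%:~R.
Definition phase k p : R := phaseA k p + phaseB p.

(** On the resonance set the product form of the phase, which the scheme splits, agrees with the
    combination of squares that the free flow produces. *)
Lemma phaseE k p : quad k p ->
  phase k p = k%:~R ^+ 2 + p.1.1%:~R ^+ 2 - p.1.2%:~R ^+ 2 - p.2%:~R ^+ 2.
Proof.
case: p => [[k1 k2] k3]; rewrite /quad /phase /phaseA /phaseB /= => e.
have -> : k1 = k2 + k3 - k by rewrite -e addrC addKr.
by rewrite rmorphB rmorphD /=; ring.
Qed.

Lemma norm_phaseA k p : `|phaseA k p| <= 2 * (bracket k * bracket p.1.1).
Proof.
rewrite /phaseA normrN -mulrA normrM ger0_norm// normrM ler_wpM2l//.
by apply: ler_pM => //; exact: norm_le_bracket.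
Qed.

Lemma norm_phaseB p : `|phaseB p| <= 2 * (bracket p.1.2 * bracket p.2).
Proof.
rewrite /phaseB -mulrA normrM ger0_norm// normrM ler_wpM2l//.
by apply: ler_pM => //; exact: norm_le_bracket.
Qed.

Lemma wt4E t k p : wt4 t k p = (wt t k * wt t p.1.1) * (wt t p.1.2 * wt t p.2) :> R.
Proof. by rewrite /wt4; ring. Qed.

Lemma nc_cis_phase s x (a b : int) t : 0 <= s -> 0 <= t <= 1 ->
  `|x| <= 2 * (bracket a * bracket b) ->
  nc (cis (x * s) - 1) <= 4 * s `^ t * (wt t a * wt t b).
Proof.
move=> s0 t01 hx; have /andP[t0 t1] := t01.
apply: le_trans (nc_cisB1_pow _ _ t01) _.
have ba := bracket_gt0 (R := R) a; have bb := bracket_gt0 (R := R) b.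
have -> : 4 * s `^ t * (wt t a * wt t b) = 2 * (2 * (s `^ t * (wt t a * wt t b))) by ring.
apply: ler_wpM2l => //.
apply: le_trans (_ : (s * (2 * (bracket a * bracket b))) `^ t <= _).
  apply: ge0_ler_powR => //; rewrite ?nnegrE ?mulr_ge0 ?(ltW ba) ?(ltW bb)//.
  by rewrite normrM mulrC (ger0_norm s0) ler_wpM2l.
rewrite powRM// ?mulr_ge0 ?(ltW ba) ?(ltW bb)//.
rewrite powRM// ?mulr_ge0 ?(ltW ba) ?(ltW bb)//.
rewrite powRM// ?(ltW ba) ?(ltW bb)// -/(wt t a) -/(wt t b) mulrCA.
apply: ler_wpM2r; first by rewrite !mulr_ge0 ?powR_ge0 ?wt_ge0.
by rewrite -[leRHS]powRr1// ler_powR// ler1n.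
Qed.

(** From e^{iA} e^{iB} - 1 = e^{iA} (e^{iB} - 1) + (e^{iA} - 1). Each difference costs the weights
    of two frequencies; those of the other two are at least 1. *)
Lemma nc_phaseB1 s k p t : 0 <= s -> 0 <= t <= 1 ->
  nc (cis (phase k p * s) - 1) <= 8 * s `^ t * wt4 t k p.
Proof.
move=> s0 t01; have /andP[t0 t1] := t01.
have hA := nc_cis_phase s _ _ _ t s0 t01 (norm_phaseA k p).
have hB := nc_cis_phase s _ _ _ t s0 t01 (norm_phaseB p).
have -> : cis (phase k p * s) - 1 = cis (phaseA k p * s) * (cis (phaseB p * s) - 1) +
   (cis (phaseA k p * s) - 1) by rewrite /phase mulrDl cisD; ring.
apply: le_trans (ncD _ _) _; rewrite ncM nc_cis mul1r wt4E.
have gA : 1 <= wt t k * wt t p.1.1 by rewrite -[leLHS]mulr1 ler_pM// wt_ge1.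
have gB : 1 <= wt t p.1.2 * wt t p.2 by rewrite -[leLHS]mulr1 ler_pM// wt_ge1.
have s4 : 0 <= 4 * s `^ t by rewrite mulr_ge0// powR_ge0.
apply: le_trans (lerD hB hA) _; set x := wt t k * _ in gA *; set y := wt t p.1.2 * _ in gB *.
have -> : 8 * s `^ t * (x * y) = 4 * s `^ t * (x * y) + 4 * s `^ t * (x * y) by ring.
apply: lerD; apply: ler_wpM2l => //.
  by rewrite ler_peMl// (le_trans ler01).
by rewrite ler_peMr// (le_trans ler01).
Qed.

Lemma nc_phaseAB s k p t : 0 <= s -> 0 <= t <= 1 ->
  nc ((cis (phaseA k p * s) - 1) * (cis (phaseB p * s) - 1)) <=
    16 * s `^ (2 * t) * wt4 t k p.
Proof.
move=> s0 t01; rewrite ncM.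
have hA := nc_cis_phase s _ _ _ t s0 t01 (norm_phaseA k p).
have hB := nc_cis_phase s _ _ _ t s0 t01 (norm_phaseB p).
apply: le_trans (ler_pM (nc_ge0 _) (nc_ge0 _) hA hB) _.
(* The law for adding exponents requires a positive base; at s = 0 the case t = 0 is separate
   because 0^0 = 1. *)
have -> : s `^ (2 * t) = s `^ t * s `^ t.
  have [->|sn0] := eqVneq s 0.
    have [->|t0] := eqVneq t 0; first by rewrite mulr0 powRr0 mulr1.
    by rewrite !powR0 ?mulr0// mulf_neq0.
  by rewrite mulrDl mul1r powRD_gt0// lt_neqAle eq_sym sn0.
by rewrite wt4E; apply: le_eq; ring.
Qed.

Definition kernel tau k p : R[i] := res_kernel tau k p.1.1 p.1.2 p.2.

Lemma kernelE tau k p : 0 < tau ->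
  (tau%:C)%C * kernel tau k p =
  cis_primitive (phaseA k p) tau + cis_primitive (phaseB p) tau - (tau%:C)%C.
Proof.
move=> t0; have tC : (tau%:C)%C != 0 :> R[i] by rewrite eq_complex /= gt_eqF.
rewrite /kernel /res_kernel mulrA -rmorphM /= divff ?gt_eqF// mul1r.
have dF t : is_cderive (fun s => cis_primitive (phaseA k p) s + cis_primitive (phaseB p) s + - (s%:C)%C)
    t (cis (phaseA k p * t) + cis (phaseB p * t) + - 1).
  apply: is_cderiveD; first by apply: is_cderiveD; exact: is_cderive_primitive.
  by apply: is_cderiveN; exact: (is_cderive_real id t 1 (is_derive_id t 1)).
have df t : is_cderive (fun s => cis (phaseA k p * s) + cis (phaseB p * s) + - 1)
    t ('i%C * ((phaseA k p)%:C)%C * cis (phaseA k p * t) +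
       'i%C * ((phaseB p)%:C)%C * cis (phaseB p * t) + 0).
  by apply: is_cderiveD; [apply: is_cderiveD; exact: is_cderive_cis|exact: is_cderive_cst].
rewrite (_ : (fun s => _) = (fun s => cis (phaseA k p * s) + cis (phaseB p * s) + - 1)); last first.
  apply/funext => s; rewrite /phaseA /phaseB; congr (cis _ + cis _ - 1); ring.
by rewrite (cintegral_FTC _ _ _ _ _ t0 dF df) !cis_primitive0 oppr0 !addr0 subr0.
Qed.

Lemma nc_kernel tau k p : 0 < tau -> nc (kernel tau k p) <= 3.
Proof.
move=> t0; have := congr1 (@Normc.normc R) (kernelE tau k p t0).
rewrite ncM nc_real gtr0_norm// => H; rewrite -(ler_pM2l t0) H.
have := nc_primitive (phaseA k p) tau t0; have := nc_primitive (phaseB p) tau t0.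
have := ncB (cis_primitive (phaseA k p) tau + cis_primitive (phaseB p) tau) (tau%:C)%C.
have := ncD (cis_primitive (phaseA k p) tau) (cis_primitive (phaseB p) tau).
by rewrite nc_real gtr0_norm//; lra.
Qed.

(** As a function of the upper limit the difference vanishes at 0 and has derivative (e^{isA} -
    1)(e^{isB} - 1), bounded by [nc_phaseAB]; the mean value inequality supplies the factor
    [tau]. *)
Lemma nc_kernel_error tau k p t : 0 < tau -> 0 <= t <= 1 ->
  nc (cis_primitive (phase k p) tau - (tau%:C)%C * kernel tau k p) <=
    tau * (16 * tau `^ (2 * t) * wt4 t k p).
Proof.
move=> t0 t01; have /andP[tt0 _] := t01; rewrite kernelE//.
have dF s : is_cderive (fun s => cis_primitive (phase k p) s + - (cis_primitive (phaseA k p) s + cis_primitive (phaseB p) s + - (s%:C)%C))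
    s (cis (phase k p * s) + - (cis (phaseA k p * s) + cis (phaseB p * s) + - 1)).
  apply: is_cderiveD; first exact: is_cderive_primitive.
  apply: is_cderiveN; apply: is_cderiveD.
    by apply: is_cderiveD; exact: is_cderive_primitive.
  by apply: is_cderiveN; exact: (is_cderive_real id s 1 (is_derive_id s 1)).
have B0 : 0 <= 16 * tau `^ (2 * t) * wt4 t k p.
  by rewrite !mulr_ge0 ?powR_ge0 ?wt_ge0.
have := nc_mvt _ _ 0 tau _ t0 B0 (ccont_derive _ _ _ _ dF) (fun s _ => dF s).
have e0 : cis_primitive (phase k p) 0 + - (cis_primitive (phaseA k p) 0 +
    cis_primitive (phaseB p) 0 + - (0%:C)%C) = 0 :> R[i].
  by rewrite !cis_primitive0 !add0r !oppr0.
cbv beta; rewrite e0 !subr0; apply=> s /andP[s0 st].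
have -> : cis (phase k p * s) - (cis (phaseA k p * s) + cis (phaseB p * s) - 1) =
   (cis (phaseA k p * s) - 1) * (cis (phaseB p * s) - 1).
  by rewrite /phase mulrDl cisD; ring.
apply: le_trans (nc_phaseAB s k p t (ltW s0) t01) _.
apply: ler_wpM2r; first by rewrite !mulr_ge0 ?wt_ge0.
apply: ler_wpM2l => //; apply: ge0_ler_powR; rewrite ?nnegrE ?mulr_ge0 ?(ltW s0) ?(ltW t0) ?(ltW st)//.
Qed.

End Kernels.

(** * Multilinearity of the trilinear form *)

Section TrilinearAlgebra.
Context {R : realType}.
Context (s : R) (hs : 2^-1 < s).
Implicit Types (K : int -> int * int * int -> R[i]) (a b c : int -> R[i]).

Definition in_Hs a := exists M, Hle s a M.
Definition bounded_kernel K := exists2 kap : R, 0 <= kap & forall k p, nc (K k p) <= kap.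

Lemma in_HsD a b : in_Hs a -> in_Hs b -> in_Hs (fun k => a k + b k).
Proof. by move=> [M hM] [N hN]; exists (M + N); exact: HleD. Qed.

Lemma in_HsB a b : in_Hs a -> in_Hs b -> in_Hs (fun k => a k - b k).
Proof. by move=> [M hM] [N hN]; exists (M + N); exact: HleB. Qed.

Lemma in_HsZ z a : in_Hs a -> in_Hs (fun k => z * a k).
Proof. by move=> [M hM]; exists (nc z * M); exact: HleZ. Qed.

Lemma wt4_0 k p : wt4 0 k p = 1 :> R.
Proof. by rewrite /wt4 !wt0 !mulr1. Qed.

Lemma tri_summable K a b c : bounded_kernel K -> in_Hs a -> in_Hs b -> in_Hs c ->
  exists N, forall k, abs_bounded (quad k) (tri_term K a b c k) N.
Proof.
move=> [kap kap0 hK] [A hA] [B hB] [C hC].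
have s0 : 0 <= s by move: hs; lra.
have [D D0 hD] := tri_bound s s 0 s0 hs (lexx 0).
have e : s + 2 * 0 = s by rewrite mulr0 addr0.
rewrite e in hD.
have [h _] := hD K kap a b c A A B B C C kap0 (fun k p _ => eq_ind_r (fun x => nc (K k p) <= kap * x)
   (eq_ind_r (fun x => nc (K k p) <= x) (hK k p) (mulr1 kap)) (wt4_0 k p)) hA hB hC hA hB hC.
by eexists; exact: h.
Qed.

(** Additivity in any slot, or in the kernel, reduces to an identity between terms. All arguments
    are left free, so each case only has to supply that identity. *)
Lemma tri_add K K1 K2 a b c a1 b1 c1 a2 b2 c2 k :
  bounded_kernel K1 -> in_Hs a1 -> in_Hs b1 -> in_Hs c1 ->
  bounded_kernel K2 -> in_Hs a2 -> in_Hs b2 -> in_Hs c2 ->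
  (forall p, tri_term K a b c k p = tri_term K1 a1 b1 c1 k p + tri_term K2 a2 b2 c2 k p) ->
  tri K a b c k = tri K1 a1 b1 c1 k + tri K2 a2 b2 c2 k.
Proof.
move=> hK1 ha1 hb1 hc1 hK2 ha2 hb2 hc2 e.
have [N1 h1] := tri_summable _ _ _ _ hK1 ha1 hb1 hc1.
have [N2 h2] := tri_summable _ _ _ _ hK2 ha2 hb2 hc2.
rewrite /tri -(csumD _ _ _ _ _ (h1 k) (h2 k)).
by congr csum; apply/funext => p; exact: e.
Qed.

Lemma triB1 K a a' b c k : bounded_kernel K -> in_Hs a -> in_Hs a' -> in_Hs b -> in_Hs c ->
  tri K (fun j => a j - a' j) b c k = tri K a b c k - tri K a' b c k.
Proof.
move=> hK ha ha' hb hc; apply/eqP; rewrite eq_sym subr_eq; apply/eqP.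
apply: tri_add => //; first exact: in_HsB.
by move=> p; rewrite /tri_term conjcD conjcN; ring.
Qed.

Lemma triB2 K a b b' c k : bounded_kernel K -> in_Hs a -> in_Hs b -> in_Hs b' -> in_Hs c ->
  tri K a (fun j => b j - b' j) c k = tri K a b c k - tri K a b' c k.
Proof.
move=> hK ha hb hb' hc; apply/eqP; rewrite eq_sym subr_eq; apply/eqP.
apply: tri_add => //; first exact: in_HsB.
by move=> p; rewrite /tri_term; ring.
Qed.

Lemma triB3 K a b c c' k : bounded_kernel K -> in_Hs a -> in_Hs b -> in_Hs c -> in_Hs c' ->
  tri K a b (fun j => c j - c' j) k = tri K a b c k - tri K a b c' k.
Proof.
move=> hK ha hb hc hc'; apply/eqP; rewrite eq_sym subr_eq; apply/eqP.
apply: tri_add => //; first exact: in_HsB.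
by move=> p; rewrite /tri_term; ring.
Qed.

Lemma triBK K K' a b c k : bounded_kernel K -> bounded_kernel K' ->
  in_Hs a -> in_Hs b -> in_Hs c ->
  tri (fun j p => K j p - K' j p) a b c k = tri K a b c k - tri K' a b c k.
Proof.
move=> hK hK' ha hb hc; apply/eqP; rewrite eq_sym subr_eq; apply/eqP.
apply: tri_add => //.
  move: hK hK' => [x x0 hx] [y y0 hy]; exists (x + y); first exact: addr_ge0.
  by move=> j p; apply: le_trans (ncB _ _) _; exact: lerD.
by move=> p; rewrite /tri_term; ring.
Qed.

Lemma triZ K K' a b c a' b' c' z k : bounded_kernel K -> in_Hs a -> in_Hs b -> in_Hs c ->
  (forall p, tri_term K' a' b' c' k p = z * tri_term K a b c k p) ->
  tri K' a' b' c' k = z * tri K a b c k.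
Proof.
move=> hK ha hb hc e; have [N h] := tri_summable _ _ _ _ hK ha hb hc.
by rewrite /tri -(csumZ _ _ _ _ (h k)); congr csum; apply/funext => p; exact: e.
Qed.

Lemma tri_telescope K x y k : bounded_kernel K -> in_Hs x -> in_Hs y ->
  tri K x x x k - tri K y y y k =
  tri K (fun j => x j - y j) x x k + tri K y (fun j => x j - y j) x k +
  tri K y y (fun j => x j - y j) k.
Proof. by move=> hK hx hy; rewrite triB1// triB2// triB3//; ring. Qed.

End TrilinearAlgebra.

(** * Cubic estimates and integration in time *)

Section TrilinearBounds.
Context {R : realType}.

Definition Hle_add3 (s : R) a b c A B C (ha : Hle s a A) (hb : Hle s b B) (hc : Hle s c C) :=
  HleD _ _ _ _ _ (HleD _ _ _ _ _ ha hb) hc.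

(** [tri_bound] with s' = s, the factor 3 collecting its three equal products; the Lipschitz part
    then comes from [tri_telescope]. *)
Lemma cubic_bounds (s t : R) : 2^-1 < s -> 0 <= t ->
  exists2 C : R, 0 <= C &
    (forall (K : int -> int * int * int -> R[i]) (kap : R) a b c (A B D : R), 0 <= kap ->
      (forall k p, quad k p -> nc (K k p) <= kap * wt4 t k p) ->
      Hle (s + 2 * t) a A -> Hle (s + 2 * t) b B -> Hle (s + 2 * t) c D ->
      Hle s (tri K a b c) (C * kap * (A * B * D))) /\
    (forall (K : int -> int * int * int -> R[i]) (kap : R) x y (X d : R), 0 <= kap ->
      bounded_kernel K -> (forall k p, quad k p -> nc (K k p) <= kap * wt4 t k p) ->
      Hle (s + 2 * t) x X -> Hle (s + 2 * t) y X ->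
      Hle (s + 2 * t) (fun k => x k - y k) d ->
      Hle s (fun k => tri K x x x k - tri K y y y k) (C * kap * (3 * X ^+ 2 * d))).
Proof.
move=> hs t0; have s0 : 0 <= s by lra.
have [C C0 hC] := tri_bound s s t s0 hs t0; exists (C * 3); first by rewrite mulr_ge0.
have H1 : (forall (K : int -> int * int * int -> R[i]) (kap : R) a b c (A B D : R), 0 <= kap ->
      (forall k p, quad k p -> nc (K k p) <= kap * wt4 t k p) ->
      Hle (s + 2 * t) a A -> Hle (s + 2 * t) b B -> Hle (s + 2 * t) c D ->
      Hle s (tri K a b c) (C * 3 * kap * (A * B * D))).
  move=> K kap a b c A B D kap0 hK ha hb hc.
  have [_] := hC K kap a b c A A B B D D kap0 hK ha hb hc ha hb hc.
  by apply: Hle_le; apply: le_eq; ring.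
split=> // K kap x y X d kap0 bK hK hx hy hd.
have st : s <= s + 2 * t by rewrite lerDl mulr_ge0.
have ix : in_Hs s x by exists X; exact: Hle_wt hx.
have iy : in_Hs s y by exists X; exact: Hle_wt hy.
have h1 := H1 K kap _ _ _ _ _ _ kap0 hK hd hx hx.
have h2 := H1 K kap _ _ _ _ _ _ kap0 hK hy hd hx.
have h3 := H1 K kap _ _ _ _ _ _ kap0 hK hy hy hd.
have := Hle_add3 _ _ _ _ _ _ _ h1 h2 h3.
move=> /(Hle_le _ _ _ (C * 3 * kap * (3 * X ^+ 2 * d))) H.
apply: Hle_eq (H _) => [k|]; first by rewrite (tri_telescope s).
by apply: le_eq; ring.
Qed.

(** Taylor expansion of the cubic form T at [m]. With D = v - m, the terms beyond the linear one are
    T(D,D,v) + T(D,m,D) + T(m,D,D); replacing D by q y in the linear part costs [e]. The scalar [q]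
    is real, so it passes the conjugation in the first slot. *)
Lemma tri_second_order (s : R) : 2^-1 < s -> exists2 C : R, 0 <= C &
  forall (K : int -> int * int * int -> R[i]) v m y (q M d e : R),
    (forall k p, nc (K k p) <= 1) -> Hle s v M -> Hle s m M ->
    Hle s (fun k => v k - m k) d -> in_Hs s y ->
    Hle s (fun k => v k - m k - (q%:C)%C * y k) e ->
    Hle s (fun k => tri K v v v k - tri K m m m k -
      (q%:C)%C * (tri K y m m k + tri K m y m k + tri K m m y k))
      (C * (3 * M * d ^+ 2 + 3 * M ^+ 2 * e)).
Proof.
move=> hs; have [C C0 [hC _]] := cubic_bounds s 0 hs (lexx 0).
rewrite mulr0 addr0 in hC; exists C => // K v m y q M d e hK hv hm hd iy he.
have bK : bounded_kernel K by exists 1.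
have hK' k p : quad k p -> nc (K k p) <= 1 * wt4 0 k p.
  by move=> _; rewrite wt4_0 mulr1.
have iv : in_Hs s v by exists M.
have im : in_Hs s m by exists M.
pose D k := v k - m k; pose E k := v k - m k - (q%:C)%C * y k.
have iD : in_Hs s D by exists d.
have iqy : in_Hs s (fun k => (q%:C)%C * y k) by exact: in_HsZ.
have T a b c A B D' := hC K 1 a b c A B D' ler01 hK'.
have h1 := T _ _ _ _ _ _ hd hd hv.
have h2 := T _ _ _ _ _ _ hd hm hd.
have h3 := T _ _ _ _ _ _ hm hd hd.
have h4 := T _ _ _ _ _ _ he hm hm.
have h5 := T _ _ _ _ _ _ hm he hm.
have h6 := T _ _ _ _ _ _ hm hm he.
have := HleD _ _ _ _ _ (Hle_add3 _ _ _ _ _ _ _ h1 h2 h3) (Hle_add3 _ _ _ _ _ _ _ h4 h5 h6).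
move=> /(Hle_le _ _ _ (C * (3 * M * d ^+ 2 + 3 * M ^+ 2 * e))) H.
apply: Hle_eq (H _) => [k|]; last first.
  by apply: le_eq; ring.
rewrite (triB1 s hs _ D (fun k => (q%:C)%C * y k) m m) // -/D.
rewrite (triB2 s hs _ m D (fun k => (q%:C)%C * y k) m) // -/D.
rewrite (triB3 s hs _ m m D (fun k => (q%:C)%C * y k)) // -/D.
rewrite (triZ s hs K K y m m (fun k => (q%:C)%C * y k) m m (q%:C)%C) //; last first.
  by move=> p; rewrite /tri_term conjcM conjc_real; ring.
rewrite (triZ s hs K K m y m m (fun k => (q%:C)%C * y k) m (q%:C)%C) //; last by move=> p; rewrite /tri_term; ring.
rewrite (triZ s hs K K m m y m m (fun k => (q%:C)%C * y k) (q%:C)%C) //; last by move=> p; rewrite /tri_term; ring.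
rewrite {1}/D (triB2 s hs _ D v m v)// (triB3 s hs _ D m v m)// (triB3 s hs _ m D v m)//.
rewrite !(triB1 s hs _ v m)// !(triB2 s hs _ m v m)// (triB3 s hs _ m m v m)//.
by ring.
Qed.

Lemma Hle_mvt_le (s : R) (D h : R -> int -> R[i]) (a b B : R) : a <= b ->  0 <= B ->
  (forall k, ccont a b (D^~ k)) ->
  (forall t, a < t < b -> forall k, is_cderive (D^~ k) t (h t k)) ->
  (forall t, a < t < b -> Hle s (h t) B) ->
  Hle s (fun k => D b k - D a k) ((b - a) * B).
Proof.
rewrite le_eqVlt => /orP[/eqP <- B0 _ _ _|]; last exact: Hle_mvt.
rewrite subrr mul0r; apply: Hle_eq (Hle0 s) => k; by rewrite subrr.
Qed.

Lemma ccont_sub (a b a' b' : R) f : a <= a' -> b' <= b -> ccont a b f -> ccont a' b' f.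
Proof.
move=> aa bb [h1 h2]; split.
  by apply: continuous_subspaceW h1 => x /=; rewrite !in_itv /= => /andP[? ?]; apply/andP; split; lra.
by apply: continuous_subspaceW h2 => x /=; rewrite !in_itv /= => /andP[? ?]; apply/andP; split; lra.
Qed.

Definition osc (s : R) k p : R[i] := cis (phase k p * s).
Definition osc_primitive (s : R) k p : R[i] := cis_primitive (phase k p) s.

Lemma nc_osc s k p : nc (osc s k p) <= 1.
Proof. by rewrite nc_cis. Qed.

(** Integrates the bound on u' in time without ever differentiating an infinite sum: modes are cut
    to [J] and inner sums to finite sets [P k], the mean value inequality is applied to the finite
    expressions, and [Hle_lim] removes the cut-off. *)
Lemma Hle_mvt_tri (r tau B : R) (c : R[i]) (m : int -> R[i]) (u u' : R -> int -> R[i]) :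
  2^-1 < r -> 0 < tau <= 1 -> in_Hs r m -> 0 <= B ->
  (forall k, ccont 0 tau (u^~ k)) ->
  (forall t, 0 < t < tau -> forall k, is_cderive (u^~ k) t (u' t k)) ->
  (forall t, 0 < t < tau -> Hle r (fun k => u' t k - c * tri (osc t) m m m k) B) ->
  Hle r (fun k => u tau k - u 0 k - c * tri (osc_primitive tau) m m m k) (tau * B).
Proof.
move=> hr /andP[tau0 tau1] im B0 cu du hB.
have tB0 : 0 <= tau * B by rewrite mulr_ge0// ltW.
apply: Hle_lim => // J e e0.
have b1 : bounded_kernel (fun _ _ => 1 : R[i]).
  by exists 1 => // k p; rewrite Normc.normc1.
have [N hN] := tri_summable r hr _ _ _ _ b1 im im im.
pose M : R := \sum_(k <- J) wt r k.
have M0 : 0 <= M by apply: sumr_ge0 => k _; exact: wt_ge0.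
(* With this tolerance the truncation error is at most [e] both in each mode ([ce]) and in H^r over
   all of [J] ([ceM]). *)
pose e1 := e / ((nc c + 1) * (1 + M)).
have nc1 : 0 < nc c + 1 by rewrite ltr_wpDl// nc_ge0.
have M1 : 0 < 1 + M by lra.
have e10 : 0 < e1 by rewrite divr_gt0// mulr_gt0.
have eE : (nc c + 1) * e1 * (1 + M) = e.
  by rewrite /e1 mulrAC mulrC divfK// gt_eqF// mulr_gt0.
have ce1 : nc c * e1 <= (nc c + 1) * e1 by rewrite ler_wpM2r ?ltW// ltrDl.
have ce0 : 0 <= nc c * e1 by rewrite mulr_ge0 ?nc_ge0// ltW.
have ce : nc c * e1 <= e.
  have e1c : 0 <= (nc c + 1) * e1 by exact: mulr_ge0 (ltW nc1) (ltW e10).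
  by apply: le_trans ce1 _; rewrite -eE ler_peMr// lerDl.
have ceM : nc c * e1 * M <= e.
  rewrite -eE; apply: ler_pM => //; lra.
have /choice[P hP] : forall k, exists P, [/\ uniq P, inD (quad k) P &
   forall g, (forall p, quad k p -> nc (g p) <= nc (tri_term (fun _ _ => 1) m m m k p)) ->
    nc (csum (quad k) g - \sum_(p <- P) g p) <= e1].
  by move=> k; exact: csum_tail (hN k) _ e10.
(* Oscillating kernels and, since tau <= 1, their primitives have modulus at most 1, so the sets
   chosen for the constant kernel serve for all of them. *)
have dom K k p : nc (K k p) <= 1 ->
    nc (tri_term K m m m k p) <= nc (tri_term (fun _ _ => 1) m m m k p).
  move=> hK; rewrite !nc_tri_term Normc.normc1 mul1r.
  by apply: ler_piMl => //; rewrite !mulr_ge0 ?nc_ge0.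
pose D s k : R[i] := if k \in J then u s k + (- c) * \sum_(p <- P k) tri_term (osc_primitive s) m m m k p else 0.
pose D' s k : R[i] := if k \in J then u' s k + (- c) * \sum_(p <- P k) tri_term (osc s) m m m k p else 0.
have dterm k p t : is_cderive (fun s => tri_term (osc_primitive s) m m m k p) t (tri_term (osc t) m m m k p).
  rewrite /tri_term; set z := _ * _ * _.
  rewrite (_ : (fun s => _) = (fun s => z * osc_primitive s k p)); last first.
    by apply/funext => x; rewrite mulrC.
  by rewrite mulrC; apply: is_cderiveZ; exact: is_cderive_primitive.
exists (fun k => D tau k - D 0 k).
  have := Hle_mvt r D D' 0 tau (B + nc c * e1 * M) tau0 (addr_ge0 B0 (mulr_ge0 ce0 M0)).
  rewrite subr0 => H; apply: Hle_le (H _ _ _).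
  - rewrite mulrDr lerD2l; apply: le_trans ceM.
    by rewrite ler_piMl// mulr_ge0.
  - move=> k; rewrite /D; case: (k \in J); last exact: ccont_cst.
    apply: ccontD; first exact: cu.
    apply: ccont_derive => t; apply: is_cderiveZ; apply: is_cderive_sum => p; exact: dterm.
  - move=> t ht k; rewrite /D /D'; case: (k \in J); last exact: is_cderive_cst.
    apply: is_cderiveD; first exact: du.
    by apply: is_cderiveZ; apply: is_cderive_sum => p; exact: dterm.
  - move=> t ht.
    pose h1 k : R[i] := if k \in J then u' t k - c * tri (osc t) m m m k else 0.
    pose h2 k : R[i] := if k \in J then c * (tri (osc t) m m m k - \sum_(p <- P k) tri_term (osc t) m m m k p) else 0.
    apply: Hle_eq (HleD _ h1 h2 _ _ _ _).
    + by move=> k; rewrite /h1 /h2 /D'; case: ifP => _; rewrite ?addr0//; ring.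
    + by apply: Hle_nc (hB t ht) => k; rewrite /h1; case: ifP => _ //; rewrite nc0 nc_ge0.
    + apply: Hle_finite => // k; first by rewrite /h2 => /negPf ->.
      rewrite /h2; case: ifP => _; last by rewrite nc0.
      rewrite ncM ler_wpM2l ?nc_ge0//; have [_ _] := hP k; apply=> p _.
      exact: dom (nc_osc _ _ _).
move=> k kJ; rewrite /D kJ.
have -> : \sum_(p <- P k) tri_term (osc_primitive 0) m m m k p = 0.
  by rewrite big1// => p _; rewrite /tri_term /osc_primitive cis_primitive0 mul0r.
rewrite mulr0 addr0; set S := \sum_(p <- P k) _.
have -> : u tau k - u 0 k - c * tri (osc_primitive tau) m m m k - (u tau k + - c * S - u 0 k) =
  - (c * (tri (osc_primitive tau) m m m k - S)) by ring.
rewrite ncN ncM; apply: le_trans ce; rewrite ler_wpM2l ?nc_ge0//.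
have [_ _] := hP k; apply=> p _; apply: dom.
by apply: le_trans (nc_primitive _ _ tau0) _.
Qed.

End TrilinearBounds.

(** * Local error and convergence in coefficient space *)

Section LocalError.
Context {R : realType}.

Lemma itv_oo (a b t u : R) : 0 <= a -> b <= u -> a < t -> t < b -> 0 < t < u.
Proof. by move=> a0 bu at' tb; rewrite (le_lt_trans a0 at') (lt_le_trans tb bu). Qed.

Lemma itv_cc (a b t u : R) : 0 <= a -> b <= u -> a < t -> t < b -> 0 <= t <= u.
Proof. by move=> a0 bu at' tb; have /andP[/ltW -> /ltW ->] := itv_oo a b t u a0 bu at' tb. Qed.

Lemma powR_ge_id (x t : R) : 0 < x <= 1 -> t <= 1 -> x <= x `^ t.
Proof. by move=> x01 t1; exact: ger1_powR. Qed.

Lemma local_error (r gamma M : R) (c : R[i]) : 2^-1 < r -> 0 <= gamma <= 2 -> 0 <= M ->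
  exists2 C : R, 0 <= C & forall (tau : R) (v : R -> int -> R[i]), 0 < tau <= 1 ->
    (forall s, 0 <= s <= tau -> Hle (r + gamma) (v s) M) ->
    (forall k, ccont 0 tau (v^~ k)) ->
    (forall s, 0 < s < tau -> forall k,
       is_cderive (v^~ k) s (c * tri (osc s) (v s) (v s) (v s) k)) ->
    let m k := (2^-1)%:C%C * (v 0 k + v tau k) in
    Hle r (fun k => v tau k - v 0 k - tau%:C%C * (c * tri (kernel tau) m m m k))
      (C * tau `^ (1 + gamma)).
Proof.
move=> hr /andP[g0 g2] M0.
(* The exponent spent on e^{is Phi} - 1. It costs 2 th derivatives, at most gamma because 0 <= gamma
   <= 2, and it yields the power 2 + th, at least 1 + gamma. *)
pose th := Num.max (gamma - 1) 0.
have th0 : 0 <= th by rewrite le_max lexx orbT.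
have th1 : th <= 1 by rewrite ge_max; lra.
have thg : 2 * th <= gamma by rewrite /th maxEle; case: ifP; lra.
have gth : 1 + gamma <= 2 + th.
  have : gamma - 1 <= th by rewrite le_max lexx.
  lra.
have hrg : 2^-1 < r + gamma by lra.
have [C1 C10 [tri1 _]] := cubic_bounds (r + gamma) 0 hrg (lexx 0).
have [C2 C20 [tri2 dif2]] := cubic_bounds r th hr th0.
have [C3 C30 [tri3 dif3]] := cubic_bounds r 0 hr (lexx 0).
have g20 : 0 <= gamma / 2 by lra.
have g21 : gamma / 2 <= 1 by lra.
have [C4 C40 [tri4 _]] := cubic_bounds r (gamma / 2) hr g20.
have [C5 C50 tri5] := tri_second_order r hr.
have tg2 : 2 * (gamma / 2) = gamma by field.
rewrite tg2 in tri4.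
rewrite mulr0 addr0 in tri1; rewrite mulr0 addr0 in tri3 dif3.
set N := nc c; have N0 : 0 <= N by exact: nc_ge0.
(* Up to powers of [tau]: [B1] is for v', [B2] for the cubic sum minus its frozen value [y0], [B3]
   for the second-order remainder of v - m, [B4] for the integrand without its odd term, [B5] for
   the change of kernel. *)
pose B1 := N * (C1 * M ^+ 3).
pose B2 := C2 * 8 * M ^+ 3 + C3 * (3 * M ^+ 2 * B1).
pose B3 := 2 * (N * B2).
pose B4 := N * (C2 * 8 * (3 * M ^+ 2 * B1) + C5 * (3 * M * B1 ^+ 2 + 3 * M ^+ 2 * B3)).
have M20 : 0 <= M ^+ 2 by exact: sqr_ge0.
have M30 : 0 <= M ^+ 3 by exact: exprn_ge0.
have B10 : 0 <= B1 by rewrite !mulr_ge0.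
have B20 : 0 <= B2 by rewrite addr_ge0// !mulr_ge0.
have B30 : 0 <= B3 by rewrite !mulr_ge0.
have B40 : 0 <= B4 by rewrite mulr_ge0// addr_ge0// !mulr_ge0// addr_ge0// !mulr_ge0// sqr_ge0.
pose B5 := N * (C4 * 16 * M ^+ 3).
have B50 : 0 <= B5 by rewrite !mulr_ge0.
exists (B4 + B5); first exact: addr_ge0.
move=> tau v /andP[t0 t1] hv cv dv m.
have t01 : 0 < tau <= 1 by rewrite t0.
have st : r <= r + gamma by lra.
have tth : tau <= tau `^ th by exact: powR_ge_id.
have p0 : 0 <= tau `^ th by exact: powR_ge0.
have v0M : Hle (r + gamma) (v 0) M by apply: hv; rewrite lexx ltW.
have vtM : Hle (r + gamma) (v tau) M by apply: hv; rewrite lexx ltW.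
have hm : Hle (r + gamma) m M.
  apply: Hle_le (HleZ _ _ _ _ (HleD _ _ _ _ _ v0M vtM)).
  by rewrite nc_real ger0_norm ?invr_ge0//; lra.
have im : in_Hs r m by exists M; exact: Hle_wt hm.
have in_v s : 0 <= s <= tau -> in_Hs r (v s) by move=> hs; exists M; apply: Hle_wt (hv s hs).
have bosc s : bounded_kernel (osc (R := R) s) by exists 1 => // k p; exact: nc_osc.
have b1 : bounded_kernel (fun _ _ => 1 : R[i]).
  by exists 1 => // k p; rewrite Normc.normc1.
have k14 k p : quad k p -> nc (1 : R[i]) <= 1 * wt4 0 k p by rewrite wt4_0 mulr1 Normc.normc1.
have kosc s k p : quad k p -> nc (osc (R := R) s k p) <= 1 * wt4 0 k p.
  by rewrite wt4_0 mulr1 nc_osc.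
have wth a A : Hle (r + gamma) a A -> Hle (r + 2 * th) a A by apply: Hle_wt; lra.
have wr a A : Hle (r + gamma) a A -> Hle r a A by apply: Hle_wt; lra.
pose v' s k := c * tri (osc s) (v s) (v s) (v s) k.
have hv' s : 0 <= s <= tau -> Hle (r + gamma) (v' s) B1.
  move=> hs; have := tri1 _ 1 _ _ _ _ _ _ ler01 (kosc s) (hv s hs) (hv s hs) (hv s hs).
  move=> /(HleZ _ c); apply: Hle_le; rewrite -/N /B1; apply: le_eq; ring.
have dif a b : 0 <= a -> a <= b -> b <= tau -> Hle (r + gamma) (fun k => v b k - v a k) (tau * B1).
  move=> a0 ab bt; apply: Hle_le (Hle_mvt_le _ v v' a b B1 ab B10 _ _ _).
  - by rewrite ler_wpM2r//; lra.
  - by move=> k; apply: ccont_sub (cv k).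
  - by move=> t /andP[ta tb] k; apply: dv; exact: itv_oo a0 bt ta tb.
  - by move=> t /andP[ta tb]; apply: hv'; exact: itv_cc a0 bt ta tb.
pose y0 k := tri (fun _ _ => 1) (v 0) (v 0) (v 0) k.
have iv0 : in_Hs r (v 0) by apply: in_v; rewrite lexx ltW.
pose O s k p : R[i] := osc s k p - 1.
have bO s : bounded_kernel (O s).
  exists 2 => // k p; exact: nc_cisB1_2.
have kO s : 0 <= s <= tau -> forall k p, quad k p -> nc (O s k p) <= 8 * tau `^ th * wt4 th k p.
  move=> /andP[s0 s1] k p _; apply: le_trans (nc_phaseB1 s k p th s0 _) _; first by rewrite th0.
  apply: ler_wpM2r; first by rewrite !mulr_ge0 ?wt_ge0.
  by apply: ler_wpM2l => //; apply: ge0_ler_powR; rewrite ?nnegrE// ltW.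
have p80 : 0 <= 8 * tau `^ th by rewrite mulr_ge0.
(* First the oscillation is dropped, at a cost of tau^th; then v s is moved to v 0, at a cost of tau
   <= tau^th. *)
have L2 s : 0 <= s <= tau -> Hle r (fun k => tri (osc s) (v s) (v s) (v s) k - y0 k) (B2 * tau `^ th).
  move=> hs; have /andP[s0 s1] := hs; have vsM := hv s hs.
  have h1 := tri2 _ _ _ _ _ _ _ _ p80 (kO s hs) (wth _ _ vsM) (wth _ _ vsM) (wth _ _ vsM).
  have h2 := dif3 _ _ _ _ _ _ ler01 b1 k14 (wr _ _ vsM) (wr _ _ v0M) (wr _ _ (dif 0 s (lexx 0) s0 s1)).
  have := HleD _ _ _ _ _ h1 h2.
  move=> /(Hle_le _ _ _ (B2 * tau `^ th)) H; apply: Hle_eq (H _).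
    move=> k; rewrite (triBK r hr) //; [|exact: in_v..].
    by rewrite /y0; ring.
  have -> : B2 * tau `^ th = C2 * (8 * tau `^ th) * (M * M * M) + C3 * (3 * M ^+ 2 * B1) * tau `^ th.
    by rewrite /B2; ring.
  rewrite lerD2l; have -> : C3 * 1 * (3 * M ^+ 2 * (tau * B1)) = C3 * (3 * M ^+ 2 * B1) * tau by ring.
  by rewrite ler_wpM2l// !mulr_ge0.
pose y k := c * y0 k.
have iy0 : in_Hs r y0.
  eexists; exact: (tri3 _ _ _ _ _ _ _ _ ler01 k14 (wr _ _ v0M) (wr _ _ v0M) (wr _ _ v0M)).
have iy : in_Hs r y by exact: in_HsZ.
have is_cderive_lin (z : R[i]) t : is_cderive (fun s => - (s%:C%C * z)) t (- z).
  apply: is_cderiveN; have := is_cderiveM _ _ _ _ _ (is_cderive_real id t 1 (is_derive_id t 1)) (is_cderive_cst z t).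
  by rewrite mulr0 addr0 mul1r.
have L3 s : 0 <= s <= tau ->
    Hle r (fun k => v s k - v 0 k - s%:C%C * y k) (tau * (N * (B2 * tau `^ th))).
  move=> /andP[s0 s1].
  have := Hle_mvt_le r (fun s k => v s k + - (s%:C%C * y k)) (fun s k => v' s k + - y k) 0 s
     (N * (B2 * tau `^ th)) s0 _ _ _ _.
  rewrite subr0 => H; have NB0 : 0 <= N * (B2 * tau `^ th) by rewrite !mulr_ge0.
  have {}H := H NB0; apply: (Hle_mono r r (fun k => v s k + - (s%:C%C * y k) - (v 0 k + - (0%:C%C * y k))) _ (s * (N * (B2 * tau `^ th)))) => //.
  - by rewrite ler_wpM2r.
  - by move=> k; rewrite mul0r oppr0 addr0; apply: le_eq; congr nc; ring.
  - apply: H.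
    + move=> k; apply: ccontD; first exact: ccont_sub (cv k).
      exact: ccont_derive (is_cderive_lin _).
    + move=> t /andP[ta tb] k; apply: is_cderiveD; last exact: is_cderive_lin.
      by apply: dv; exact: itv_oo (lexx 0) s1 ta tb.
    + move=> t /andP[ta tb]; have ht : 0 <= t <= tau by exact: itv_cc (lexx 0) s1 ta tb.
      apply: Hle_eq (HleZ _ c _ _ (L2 t ht)) => k.
      by rewrite /v' /y; ring.
pose q s : R := s - tau / 2.
(* The expansion [L3] at [s] minus half of the one at [tau]; the linear terms combine to the factor
   s - tau/2. *)
have L3' s : 0 <= s <= tau ->
    Hle r (fun k => v s k - m k - (q s)%:C%C * y k) (tau * tau `^ th * B3).
  move=> hs; have tt : 0 <= tau <= tau by rewrite lexx ltW.
  have h := HleB _ _ _ _ _ (L3 s hs) (HleZ _ ((2^-1)%:C%C) _ _ (L3 tau tt)).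
  apply: Hle_mono h => //.
    rewrite nc_real ger0_norm ?invr_ge0// /B3.
    have -> : tau * tau `^ th * (2 * (N * B2)) = 2 * (tau * (N * (B2 * tau `^ th))) by ring.
    have : 0 <= tau * (N * (B2 * tau `^ th)) by rewrite !mulr_ge0// ltW.
    lra.
  move=> k; apply: le_eq; congr nc; rewrite /m /q.
  have -> : (s - tau / 2)%:C%C = s%:C%C - (2^-1)%:C%C * tau%:C%C :> R[i].
    by rewrite rmorphB /= mulrC rmorphM.
  have e2 : 1 = (2^-1)%:C%C + (2^-1)%:C%C :> R[i] by rewrite -rmorphD /=; congr (_%:C)%C; field.
  have -> : v 0 k = (2^-1)%:C%C * v 0 k + (2^-1)%:C%C * v 0 k by rewrite -mulrDl -e2 mul1r.
  have h2 := e2; move: e2; set z := (2^-1)%:C%C => e2.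
  have -> : v s k - z * (z * v 0 k + z * v 0 k + v tau k) = v s k - z * (v 0 k + v tau k).
    by rewrite -mulrDl -e2 mul1r.
  have -> : v tau k - (z * v 0 k + z * v 0 k) - tau%:C%C * y k = v tau k - v 0 k - tau%:C%C * y k.
    by rewrite -mulrDl -e2 mul1r.
  ring.
(* v s - m is half of (v s - v 0) - (v tau - v s). *)
have Hd s : 0 <= s <= tau -> Hle (r + gamma) (fun k => v s k - m k) (tau * B1).
  move=> /andP[s0 s1].
  have h := HleD _ _ _ _ _ (HleZ _ ((2^-1)%:C%C) _ _ (dif 0 s (lexx 0) s0 s1))
     (HleZ _ (- (2^-1)%:C%C) _ _ (dif s tau s0 s1 (lexx _))).
  apply: Hle_mono h => //.
    by rewrite ncN nc_real ger0_norm ?invr_ge0//; lra.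
  move=> k; apply: le_eq; congr nc; rewrite /m.
  have e2 : 1 = (2^-1)%:C%C + (2^-1)%:C%C :> R[i] by rewrite -rmorphD /=; congr (_%:C)%C; field.
  have -> : v s k = (2^-1)%:C%C * v s k + (2^-1)%:C%C * v s k by rewrite -mulrDl -e2 mul1r.
  move: e2; set z := (2^-1)%:C%C => e2.
  have -> : z * (z * v s k + z * v s k - v 0 k) + - z * (v tau k - (z * v s k + z * v s k)) =
    z * (v s k - v 0 k) + - z * (v tau k - v s k).
    by rewrite -mulrDl -e2 mul1r.
  ring.
(* Linearized at the midpoint, the cubic term differs from its value at [m] by
   [q s * W] up to higher order, and [q] has mean zero on [0, tau]. *)
pose W k := tri (fun _ _ => 1) y m m k + tri (fun _ _ => 1) m y m k + tri (fun _ _ => 1) m m y k.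
have L4 s : 0 < s < tau -> Hle r (fun k => (v' s k - (q s)%:C%C * (c * W k)) - c * tri (osc s) m m m k)
     (B4 * (tau * tau `^ th)).
  move=> /andP[s0 s1]; have hs : 0 <= s <= tau by rewrite !ltW.
  have vsM := hv s hs.
  have h1 := dif2 _ _ _ _ _ _ p80 (bO s) (kO s hs) (wth _ _ vsM) (wth _ _ hm) (wth _ _ (Hd s hs)).
  have h2 := tri5 _ (v s) m y (q s) M (tau * B1) (tau * tau `^ th * B3) (fun _ _ => le_eq _ _ (Normc.normc1 R)) (wr _ _ vsM) (wr _ _ hm) (wr _ _ (Hd s hs)) iy (L3' s hs).
  have := HleZ _ c _ _ (HleD _ _ _ _ _ h1 h2).
  move=> /(Hle_le _ _ _ (B4 * (tau * tau `^ th))) H; apply: Hle_eq (H _).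
    move=> k; rewrite !(triBK r hr) //; [|exact: in_v..].
    by rewrite /v' /W; ring.
  rewrite -/N /B4 -[leRHS]mulrA; apply: ler_wpM2l => //.
  have -> : (C2 * 8 * (3 * M ^+ 2 * B1) + C5 * (3 * M * B1 ^+ 2 + 3 * M ^+ 2 * B3)) * (tau * tau `^ th) =
    C2 * (8 * tau `^ th) * (3 * M ^+ 2 * (tau * B1)) +
    C5 * (3 * M * B1 ^+ 2 * (tau * tau `^ th) + 3 * M ^+ 2 * (tau * tau `^ th * B3)) by ring.
  rewrite lerD2l; apply: ler_wpM2l => //; rewrite lerD2r.
  have -> : 3 * M * (tau * B1) ^+ 2 = 3 * M * B1 ^+ 2 * (tau * tau) by ring.
  by apply: ler_wpM2l; [rewrite !mulr_ge0// sqr_ge0|rewrite ler_wpM2l// ltW].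
(* The antiderivative of [q] that vanishes at 0 and at [tau]: subtracting [Q s] times a constant
   sequence removes the odd term from the derivative and leaves both endpoint values unchanged. *)
pose Q s : R := 2^-1 * (s * s) - tau / 2 * s.
have dQ t : is_derive t (1 : R) Q (q t).
  have hid : is_derive t (1 : R) (id : R -> R) 1 by exact: is_derive_id.
  have h1 := is_deriveM' _ _ _ _ _ (is_derive_cst (2^-1 : R) t 1) (is_deriveM' _ _ _ _ _ hid hid).
  have h2 := is_deriveM' _ _ _ _ _ (is_derive_cst (tau / 2 : R) t 1) hid.
  apply: (is_derive_eq (is_deriveB' _ _ _ _ _ h1 h2)); rewrite /q /cst /=.
  by field.
have dQW (z : R[i]) t : is_cderive (fun s => - ((Q s)%:C%C * z)) t (- ((q t)%:C%C * z)).
  apply: is_cderiveN; have := is_cderiveM _ _ _ _ _ (is_cderive_real Q t (q t) (dQ t)) (is_cderive_cst z t).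
  by rewrite mulr0 addr0.
have BB0 : 0 <= B4 * (tau * tau `^ th) by exact: mulr_ge0 B40 (mulr_ge0 (ltW t0) p0).
have main := Hle_mvt_tri r tau (B4 * (tau * tau `^ th)) c m
   (fun s k => v s k + - ((Q s)%:C%C * (c * W k))) (fun s k => v' s k + - ((q s)%:C%C * (c * W k)))
   hr t01 im BB0.
have {}main := main (fun k => ccontD _ _ _ _ (cv k) (ccont_derive _ _ _ _ (dQW (c * W k))))
  (fun t ht k => is_cderiveD _ _ _ _ _ (dv t ht k) (dQW (c * W k) t)) L4.
have Q0 : Q 0 = 0 by rewrite /Q !mulr0 subrr.
have Qt : Q tau = 0 by rewrite /Q; field.
(* The exponent gamma / 2 gives the power tau^gamma and, as the cubic estimate loses twice the
   exponent, costs exactly the gamma derivatives at hand. *)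
have kE k p : quad k p -> nc (osc_primitive tau k p - tau%:C%C * kernel tau k p) <=
    16 * tau `^ (1 + gamma) * wt4 (gamma / 2) k p.
  move=> _; apply: le_trans (nc_kernel_error tau k p (gamma / 2) t0 _) _.
    by rewrite g20.
  rewrite tg2 powRD_gt0// powRr1 ?(ltW t0)//; apply: le_eq; ring.
have bprim : bounded_kernel (osc_primitive tau).
  by exists tau; [exact: ltW|move=> k p; exact: nc_primitive].
have bker : bounded_kernel (fun k p => tau%:C%C * kernel tau k p).
  exists (tau * 3); first by rewrite mulr_ge0// ltW.
  by move=> k p; rewrite ncM nc_real gtr0_norm// ler_pM2l// nc_kernel.
have bker' : bounded_kernel (kernel tau) by exists 3 => // k p; exact: nc_kernel.
have pg0 : 0 <= 16 * tau `^ (1 + gamma) by rewrite mulr_ge0// powR_ge0.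
have h5 := HleZ _ c _ _ (tri4 _ _ _ _ _ _ _ _ pg0 kE hm hm hm).
have := HleD _ _ _ _ _ main h5.
move=> /(Hle_le _ _ _ ((B4 + B5) * tau `^ (1 + gamma))) H; apply: Hle_eq (H _).
  move=> k; cbv beta; rewrite Q0 Qt !mul0r !oppr0 !addr0 (triBK r hr)//.
  rewrite (triZ r hr (kernel tau) (fun k p => tau%:C%C * kernel tau k p) m m m m m m tau%:C%C)//.
    by ring.
  by move=> p; rewrite /tri_term; ring.
rewrite [leRHS]mulrDl; apply: lerD; last by rewrite -/N /B5; apply: le_eq; ring.
rewrite mulrCA ler_wpM2l// mulrA.
have -> : tau * tau * tau `^ th = tau `^ (2 + th).
  rewrite powRD_gt0//; congr (_ * _).
  by rewrite -[2]/(2%:R) powR_mulrn ?expr2// ltW.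
exact: ger_powR.
Qed.

End LocalError.

(** * One step of the scheme in coefficient space *)

Section Scheme.
Context {R : realType}.

Definition midpoint (a b : int -> R[i]) k : R[i] := (2^-1)%:C%C * (a k + b k).

(** [rbm_map] after the substitution w = e^{i tau d_x^2} W: the free flow drops out of the iteration
    and survives only as a factor [free tau] between steps. *)
Definition seq_map (tau : R) (c : R[i]) (a W : int -> R[i]) k : R[i] :=
  a k + tau%:C%C * (c * tri (kernel tau) (midpoint a W) (midpoint a W) (midpoint a W) k).

Definition seq_iter tau c a j := iter j (seq_map tau c a) a.

Lemma nc_half (z : R) : nc ((2^-1)%:C%C : R[i]) * z = z / 2.
Proof. by rewrite nc_real ger0_norm ?invr_ge0// mulrC. Qed.

Lemma Hle_midpoint s (a b : int -> R[i]) A B X : Hle s a A -> Hle s b B -> A + B <= 2 * X ->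
  Hle s (midpoint a b) X.
Proof.
move=> ha hb hX; apply: Hle_le (HleZ _ _ _ _ (HleD _ _ _ _ _ ha hb)).
by rewrite nc_half; lra.
Qed.

(** The intervals [lo j, hi j] are nested, and the supremum of their left ends is the limit, with
    the rate built into their width. *)
Lemma geometric_limit_real (x : nat -> R) (D : R) : 0 <= D ->
  (forall j, `|x j.+1 - x j| <= D / 2 ^+ j) ->
  exists l, forall j, `|x j - l| <= 2 * D / 2 ^+ j.
Proof.
move=> D0 h; pose lo j := x j - 2 * D / 2 ^+ j; pose hi j := x j + 2 * D / 2 ^+ j.
have half j : 2 * D / 2 ^+ j.+1 = D / 2 ^+ j :> R.
  by rewrite exprS; field; rewrite expf_neq0.
have Dj0 j : 0 <= D / 2 ^+ j by rewrite divr_ge0// exprn_ge0.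
have loS j : lo j <= lo j.+1.
  rewrite /lo half; have := h j; have := Dj0 j; rewrite ler_norml => ? /andP[? ?].
  have -> : 2 * D / 2 ^+ j = 2 * (D / 2 ^+ j) by rewrite mulrA.
  lra.
have hiS j : hi j.+1 <= hi j.
  rewrite /hi half; have := h j; have := Dj0 j; rewrite ler_norml => ? /andP[? ?].
  have -> : 2 * D / 2 ^+ j = 2 * (D / 2 ^+ j) by rewrite mulrA.
  lra.
have lom i d : lo i <= lo (i + d)%N.
  elim: d => [|d IH]; first by rewrite addn0.
  by rewrite addnS; apply: le_trans IH (loS _).
have him i d : hi (i + d)%N <= hi i.
  elim: d => [|d IH]; first by rewrite addn0.
  by rewrite addnS; apply: le_trans (hiS _) IH.
have lohi i j : lo i <= hi j.
  apply: le_trans (lom i j) _; apply: le_trans (_ : hi (i + j)%N <= _).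
    rewrite /lo /hi; have : 0 <= 2 * D / 2 ^+ (i + j) by rewrite -mulrA mulr_ge0.
    lra.
  by rewrite addnC; exact: him.
have hs : has_sup (range lo).
  by split; [exists (lo 0), 0|exists (hi 0) => _ [i _ <-]].
exists (sup (range lo)) => j.
have h1 : lo j <= sup (range lo) by apply: sup_upper_bound => //; exists j.
have h2 : sup (range lo) <= hi j.
  by apply: ge_sup; [exists (lo 0), 0|move=> _ [i _ <-]].
by move: h1 h2; rewrite /lo /hi ler_norml; lra.
Qed.

Lemma geometric_limit (x : nat -> R[i]) (D : R) : 0 <= D ->
  (forall j, nc (x j.+1 - x j) <= D / 2 ^+ j) ->
  exists l, forall j, nc (x j - l) <= 4 * D / 2 ^+ j.
Proof.
move=> D0 h.
have [l1 h1] := geometric_limit_real (fun j => Re (x j)) D D0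
  (fun j => le_trans (eq_ind _ (fun z => `|z| <= nc (x j.+1 - x j)) (nc_Re _) _ (etrans (ReD _ _) (congr1 _ (ReN _)))) (h j)).
have [l2 h2] := geometric_limit_real (fun j => Im (x j)) D D0
  (fun j => le_trans (eq_ind _ (fun z => `|z| <= nc (x j.+1 - x j)) (nc_Im _) _ (etrans (ImD _ _) (congr1 _ (ImN _)))) (h j)).
exists (l1 +i* l2)%C => j; apply: le_trans (nc_le_ReIm _) _.
rewrite ReD ImD ReN ImN /=; have := h1 j; have := h2 j.
have -> : 4 * D / 2 ^+ j = 2 * D / 2 ^+ j + 2 * D / 2 ^+ j by ring.
lra.
Qed.

Lemma half_pow_small (D e : R) : 0 <= D -> 0 < e -> exists j0, forall j, (j0 <= j)%N -> D / 2 ^+ j <= e.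
Proof.
move=> D0 e0; exists (Num.truncn (D / e)).+1 => j hj.
rewrite ler_pdivrMr ?exprn_gt0// mulrC -ler_pdivrMr//.
have De0 : 0 <= D / e by rewrite divr_ge0// ltW.
apply: le_trans (_ : j%:R <= _).
  apply: ltW; apply: lt_le_trans (truncnS_gt _) _.
  by rewrite ler_nat.
by rewrite -natrX ler_nat; apply/ltnW/ltn_expl.
Qed.

Lemma scheme_bounds (s s' : R) (c : R[i]) : 2^-1 < s' -> s' <= s ->
  exists2 L : R, 0 <= L & forall tau : R, 0 < tau ->
   [/\ forall w W1 W0, Hle s w W1 -> Hle s' w W0 ->
         Hle s (fun k => tau%:C%C * (c * tri (kernel tau) w w w k)) (tau * L * W1 * W0 ^+ 2),
       forall w W0, Hle s' w W0 ->
         Hle s' (fun k => tau%:C%C * (c * tri (kernel tau) w w w k)) (tau * L * W0 * W0 ^+ 2) &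
       forall w w' X d, Hle s w X -> Hle s w' X -> Hle s (fun k => w k - w' k) d ->
         Hle s (fun k => tau%:C%C * (c * tri (kernel tau) w w w k) -
           tau%:C%C * (c * tri (kernel tau) w' w' w' k)) (tau * L * X ^+ 2 * d)].
Proof.
move=> hs' ss; have hs : 2^-1 < s by lra.
have s0 : 0 <= s by lra.
have [C1 C10 h1] := tri_bound s s' 0 s0 hs' (lexx 0).
have [C2 C20 [h2 _]] := cubic_bounds s' 0 hs' (lexx 0).
have [C3 C30 [_ h3]] := cubic_bounds s 0 hs (lexx 0).
rewrite !mulr0 !addr0 in h1; rewrite mulr0 addr0 in h2; rewrite mulr0 addr0 in h3.
have N0 := nc_ge0 c.
exists (nc c * (9 * C1 + 3 * C2 + 9 * C3)).
  by rewrite mulr_ge0// !addr_ge0// mulr_ge0.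
move=> tau t0; have t0' := ltW t0.
have tn (z : R) : nc (tau%:C%C : R[i]) * z = tau * z by rewrite nc_real gtr0_norm.
have kk k p : quad k p -> nc (kernel tau k p) <= 3 * wt4 0 k p.
  by move=> _; rewrite wt4_0 mulr1; exact: nc_kernel.
have bk : bounded_kernel (kernel tau) by exists 3 => // k p; exact: nc_kernel.
split.
- move=> w W1 W0 hw1 hw0; have := h1 (kernel tau) 3 w w w W1 W0 W1 W0 W1 W0 (ler0n _ 3) kk hw1 hw1 hw1 hw0 hw0 hw0.
  move=> [_ H]; apply: Hle_le (HleZ _ _ _ _ (HleZ _ c _ _ H)); rewrite tn.
  have [W10 W00] := (Hle_ge0 _ _ _ hw1, Hle_ge0 _ _ _ hw0).
  have -> : tau * (nc c * (9 * C1 + 3 * C2 + 9 * C3)) * W1 * W0 ^+ 2 =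
    tau * (nc c * (C1 * 3 * (W1 * W0 * W0 + W0 * W1 * W0 + W0 * W0 * W1))) +
    tau * nc c * (3 * C2 + 9 * C3) * W1 * W0 ^+ 2 by ring.
  by rewrite lerDl !mulr_ge0// ?sqr_ge0// addr_ge0// mulr_ge0.
- move=> w W0 hw; have H := h2 (kernel tau) 3 w w w W0 W0 W0 (ler0n _ 3) kk hw hw hw.
  apply: Hle_le (HleZ _ _ _ _ (HleZ _ c _ _ H)); rewrite tn.
  have W00 := Hle_ge0 _ _ _ hw.
  have -> : tau * (nc c * (9 * C1 + 3 * C2 + 9 * C3)) * W0 * W0 ^+ 2 =
    tau * (nc c * (C2 * 3 * (W0 * W0 * W0))) +
    tau * nc c * (9 * C1 + 9 * C3) * W0 * W0 ^+ 2 by ring.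
  by rewrite lerDl !mulr_ge0// ?sqr_ge0// addr_ge0// mulr_ge0.
- move=> w w' X d hw hw' hd.
  have H := h3 (kernel tau) 3 w w' X d (ler0n _ 3) bk kk hw hw' hd.
  have := HleZ _ tau%:C%C _ _ (HleZ _ c _ _ H); rewrite tn => {}H.
  apply: Hle_mono H => //; last by move=> k; apply: le_eq; congr nc; ring.
  have d0 := Hle_ge0 _ _ _ hd; have X0 := Hle_ge0 _ _ _ hw.
  have -> : tau * (nc c * (9 * C1 + 3 * C2 + 9 * C3)) * X ^+ 2 * d =
    tau * (nc c * (C3 * 3 * (3 * X ^+ 2 * d))) +
    tau * nc c * (9 * C1 + 3 * C2) * X ^+ 2 * d by ring.
  by rewrite lerDl !mulr_ge0// ?sqr_ge0// addr_ge0// mulr_ge0.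
Qed.

(** The iteration stays in balls of twice the initial radii: 8 comes from 2 * 2^2 in the cubic
    bounds, 4 from 2^2 in the Lipschitz bound. The growth factor of the H^s bound involves only the
    weak radius [A0], so over many steps the growth is geometric; [A1] enters through the
    restriction on [tau]. *)
Lemma scheme_solution (s s' : R) (c : R[i]) : 2^-1 < s' -> s' <= s ->
  exists2 L : R, 0 <= L & forall (tau A0 A1 : R) a, 0 < tau ->
    Hle s' a A0 -> Hle s a A1 -> tau * (8 * L * A0 ^+ 2) <= 1 -> tau * (4 * L * A1 ^+ 2) <= 1 ->
    exists V, [/\ Hle s' V (2 * A0), Hle s V (2 * A1), Hle s V (A1 * (1 + tau * (8 * L * A0 ^+ 2))),
      forall k, V k = seq_map tau c a V k &
      forall j, Hle s (fun k => seq_iter tau c a j k - V k) (6 * A1 / 2 ^+ j)].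
Proof.
move=> hs' ss; have [L L0 hL] := scheme_bounds s s' c hs' ss; exists L => //.
move=> tau A0 A1 a t0 ha0 ha1 c0 c1; have [h1 h2 h3] := hL tau t0.
have t0' := ltW t0.
have [A00 A10] := (Hle_ge0 _ _ _ ha0, Hle_ge0 _ _ _ ha1).
have mid0 W : Hle s' W (2 * A0) -> Hle s' (midpoint a W) (2 * A0).
  by move=> hW; apply: Hle_midpoint ha0 hW _; lra.
have mid1 W : Hle s W (2 * A1) -> Hle s (midpoint a W) (2 * A1).
  by move=> hW; apply: Hle_midpoint ha1 hW _; lra.
have map0 W : Hle s' W (2 * A0) -> Hle s' (seq_map tau c a W) (2 * A0).
  move=> hW; apply: Hle_le (HleD _ _ _ _ _ ha0 (h2 _ _ (mid0 W hW))).
  have -> : A0 + tau * L * (2 * A0) * (2 * A0) ^+ 2 = A0 + A0 * (tau * (8 * L * A0 ^+ 2)) by ring.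
  have := ler_wpM2l A00 c0; lra.
have map1' W : Hle s' W (2 * A0) -> Hle s W (2 * A1) ->
    Hle s (seq_map tau c a W) (A1 * (1 + tau * (8 * L * A0 ^+ 2))).
  move=> hW hW1; apply: Hle_le (HleD _ _ _ _ _ ha1 (h1 _ _ _ (mid1 W hW1) (mid0 W hW))).
  by apply: le_eq; ring.
have map1 W : Hle s' W (2 * A0) -> Hle s W (2 * A1) -> Hle s (seq_map tau c a W) (2 * A1).
  move=> hW hW1; apply: Hle_le (map1' W hW hW1).
  have := ler_wpM2l A10 c0; rewrite mulrDr; lra.
(* The factor 1/2 is due to the averaging in the midpoint; the condition on [A1] has only to make
   the cubic term 1-Lipschitz. *)
have mapd W W' d : Hle s W (2 * A1) -> Hle s W' (2 * A1) -> Hle s (fun k => W k - W' k) d ->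
    Hle s (fun k => seq_map tau c a W k - seq_map tau c a W' k) (d / 2).
  move=> hW hW' hd.
  have hm : Hle s (fun k => midpoint a W k - midpoint a W' k) (d / 2).
    have := HleZ _ (2^-1)%:C%C _ _ hd; rewrite nc_half; apply: Hle_eq => k.
    by rewrite /midpoint; ring.
  have := h3 _ _ _ _ (mid1 W hW) (mid1 W' hW') hm.
  move=> /(Hle_mono s s _ (fun k => seq_map tau c a W k - seq_map tau c a W' k) _ (d / 2) (lexx _)).
  apply; last by move=> k; rewrite /seq_map; apply: le_eq; congr nc; ring.
  have d0 := Hle_ge0 _ _ _ hd.
  have -> : tau * L * (2 * A1) ^+ 2 * (d / 2) = (tau * (4 * L * A1 ^+ 2)) * (d / 2) by ring.
  by rewrite ler_piMl//; lra.
pose W := seq_iter tau c a.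
have WS j : W j.+1 = seq_map tau c a (W j) by [].
have hW0 j : Hle s' (W j) (2 * A0).
  by elim: j => [|j IH]; [apply: Hle_le ha0; lra|rewrite WS; exact: map0].
have hW1 j : Hle s (W j) (2 * A1).
  by elim: j => [|j IH]; [apply: Hle_le ha1; lra|rewrite WS; exact: map1].
(* The first increment is at most 3 A1, from the radii 2 A1 and A1, and each later one is halved. *)
have hWd j : Hle s (fun k => W j.+1 k - W j k) (3 * A1 / 2 ^+ j).
  elim: j => [|j IH].
    rewrite expr0 divr1; apply: Hle_le (HleB _ _ _ _ _ (hW1 1%N) ha1); lra.
  have := mapd _ _ _ (hW1 j.+1) (hW1 j) IH; rewrite -!WS; apply: Hle_le.
  rewrite exprS invfM; apply: le_eq; ring.
have s0 : 0 <= s by lra.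
have A30 : 0 <= 3 * A1 by lra.
have /choice[V hV] : forall k, exists l, forall j, nc (W j k - l) <= 4 * (3 * A1) / 2 ^+ j.
  by move=> k; apply: geometric_limit => // j; exact: Hle_coef s0 (hWd j).
have Vsmall e : 0 < e -> exists j0, forall j, (j0 <= j)%N -> forall k, nc (W j k - V k) <= e.
  move=> e0; have D0 : 0 <= 4 * (3 * A1) by lra.
  have [j0 hj0] := half_pow_small _ _ D0 e0; exists j0 => j /hj0 h k.
  exact: le_trans (hV k j) h.
(* The bound is the exact partial sum of the geometric series, so that the induction on [d]
   closes. *)
have WW j d : Hle s (fun k => W j k - W (j + d)%N k) (6 * A1 / 2 ^+ j - 6 * A1 / 2 ^+ (j + d)).
  elim: d => [|d IH].
    rewrite addn0 subrr; apply: Hle_eq (Hle0 s) => k; by rewrite subrr.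
  have := HleB _ _ _ _ _ IH (hWd (j + d)%N).
  rewrite addnS => /(Hle_mono s s _ (fun k => W j k - W (j + d).+1 k) _ (6 * A1 / 2 ^+ j - 6 * A1 / 2 ^+ (j + d).+1) (lexx _)).
  apply; last by move=> k; apply: le_eq; congr nc; ring.
  rewrite [2 ^+ (j + d).+1]exprS invfM; have -> : 6 * A1 * (2^-1 * (2 ^+ (j + d))^-1) = 3 * A1 / 2 ^+ (j + d).
    by rewrite mulrA; congr (_ / _); field.
  have -> : 6 * A1 / 2 ^+ (j + d) = 2 * (3 * A1 / 2 ^+ (j + d)) by ring.
  lra.
have hWV j : Hle s (fun k => W j k - V k) (6 * A1 / 2 ^+ j).
  have B0 : 0 <= 6 * A1 / 2 ^+ j by rewrite divr_ge0 ?exprn_ge0//; lra.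
  apply: Hle_lim => // J e e0; have [j0 hj0] := Vsmall e e0.
  exists (fun k => W j k - W (j + j0)%N k).
    apply: Hle_le (WW j j0); have : 0 <= 6 * A1 / 2 ^+ (j + j0).
      by rewrite divr_ge0 ?exprn_ge0//; lra.
    lra.
  move=> k _; have -> : W j k - V k - (W j k - W (j + j0)%N k) = W (j + j0)%N k - V k by ring.
  by apply: hj0; rewrite leq_addl.
have hlim (t B : R) : 0 <= B -> (forall j, Hle t (W j) B) -> Hle t V B.
  move=> B0 h; apply: Hle_lim => // J e e0; have [j0 hj0] := Vsmall e e0.
  exists (W j0); first by apply: Hle_le (h j0); lra.
  by move=> k _; rewrite nc_distC; exact: hj0.
have hV0 : Hle s' V (2 * A0) by apply: hlim => //; lra.
have hV1 : Hle s V (2 * A1) by apply: hlim => //; lra.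
have fix_V k : V k = seq_map tau c a V k.
  apply: nc_eq_lim => e e0; have e2 : 0 < e / 2 by lra.
  have D0 : 0 <= 6 * A1 by lra.
  have [j0 hj0] := half_pow_small _ _ D0 e2.
  have h4 := Hle_coef _ _ _ k s0 (hWV j0.+1).
  have h5 := Hle_coef _ _ _ k s0 (mapd _ _ _ (hW1 j0) hV1 (hWV j0)).
  have -> : V k - seq_map tau c a V k = (seq_map tau c a (W j0) k - seq_map tau c a V k) - (W j0.+1 k - V k).
    by rewrite WS; ring.
  apply: le_trans (ncB _ _) _.
  have := hj0 _ (leqnn j0); have := hj0 _ (leqnSn j0).
  have : 0 <= 6 * A1 / 2 ^+ j0 by rewrite divr_ge0 ?exprn_ge0//.
  move: h4 h5; lra.
exists V; split=> //.
have := map1' V hV0 hV1; apply: Hle_eq => k; by rewrite -fix_V.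
Qed.

(** Since the scheme is implicit, the new error N occurs on both sides: N <= E + dl + x (E + N) with
    x = tau L X^2 / 2 <= 1/2. Absorbing x N requires N to be the least bound, whose existence [Z]
    ensures; division by 1 - x then gives at most (1 + 4x) E + 2 dl. *)
Lemma error_step (s : R) (c : R[i]) : 2^-1 < s ->
  exists2 L : R, 0 <= L & forall (tau X E dl Z : R) a V b b', 0 < tau ->
    (forall k, V k = seq_map tau c a V k) ->
    Hle s (fun k => b' k - b k - tau%:C%C * (c * tri (kernel tau) (midpoint b b') (midpoint b b') (midpoint b b') k)) dl ->
    Hle s (fun k => b k - a k) E -> Hle s (midpoint b b') X -> Hle s (midpoint a V) X ->
    Hle s (fun k => b' k - V k) Z -> tau * (L * X ^+ 2) <= 1 ->
    Hle s (fun k => b' k - V k) ((1 + tau * (2 * L * X ^+ 2)) * E + 2 * dl).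
Proof.
move=> hs; have [L L0 hL] := scheme_bounds s s c hs (lexx s); exists L => //.
move=> tau X E dl Z a V b b' t0 fix_V hdl hE hX hX' hZ hx.
have [_ _ h3] := hL tau t0.
have [N hN Nmin] := Hle_min _ _ _ hZ.
have [N0 E0] := (Hle_ge0 _ _ _ hN, Hle_ge0 _ _ _ hE); have dl0 := Hle_ge0 _ _ _ hdl.
have hm : Hle s (fun k => midpoint b b' k - midpoint a V k) ((E + N) / 2).
  have := HleZ _ (2^-1)%:C%C _ _ (HleD _ _ _ _ _ hE hN); rewrite nc_half; apply: Hle_eq => k.
  by rewrite /midpoint; ring.
have h := HleD _ _ _ _ _ (HleD _ _ _ _ _ hE hdl) (h3 _ _ _ _ hX hX' hm).
have {}h : Hle s (fun k => b' k - V k) (E + dl + tau * L * X ^+ 2 * ((E + N) / 2)).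
  apply: Hle_eq h => k; rewrite [V k]fix_V /seq_map.
  by rewrite -/(midpoint a V); ring.
apply: Hle_le hN; have := Nmin _ h.
pose x := tau * L * X ^+ 2 / 2.
have X20 : 0 <= X ^+ 2 by exact: sqr_ge0.
have x0 : 0 <= x by exact: divr_ge0 (mulr_ge0 (mulr_ge0 (ltW t0) L0) X20) (ler0n _ 2).
have x2 : x <= 2^-1 by move: hx; rewrite /x mulrA; lra.
have -> : E + dl + tau * L * X ^+ 2 * ((E + N) / 2) = E + dl + x * (E + N) by rewrite /x; field.
have -> : (1 + tau * (2 * L * X ^+ 2)) * E + 2 * dl = (1 + 4 * x) * E + 2 * dl by rewrite /x; field.
move: x0 x2; clearbody x => x0 x2 hNle.
have h1 : (1 - x) * N <= (1 - x) * ((1 + 4 * x) * E + 2 * dl).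
  apply: le_trans (_ : (1 + x) * E + dl <= _); first lra.
  have e3 : 0 <= 2 - 4 * x by lra.
  have e4 : 0 <= 1 - 2 * x by lra.
  have e1 := mulr_ge0 (mulr_ge0 x0 e3) E0.
  have e2 := mulr_ge0 e4 dl0.
  have -> : (1 - x) * ((1 + 4 * x) * E + 2 * dl) = (1 + x) * E + dl + x * (2 - 4 * x) * E + (1 - 2 * x) * dl by ring.
  lra.
by move: h1; rewrite ler_pM2l//; lra.
Qed.

End Scheme.

(** * Global convergence in coefficient space *)

Section SequenceConvergence.
Context {R : realType}.

Definition free (t : R) k : R[i] := cis (- (t * k%:~R ^+ 2)).

Definition one_kernel : int -> int * int * int -> R[i] := fun _ _ => 1.

(** What the convergence argument takes from a solution, mode by mode: continuity up to the ends of
    [0, T] and the differential equation inside. Sobolev bounds are supplied separately. *)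
Record nls_coeffs (mu T : R) (w : R -> int -> R[i]) : Prop := NlsCoeffs {
  nls_coeffs_cont : forall k t, 0 <= t <= T -> forall e, 0 < e -> exists2 d, 0 < d &
    forall s, 0 <= s <= T -> `|s - t| < d -> nc (w s k - w t k) <= e ;
  nls_coeffs_derive : forall k t, 0 < t < T -> is_cderive (w^~ k) t
    (- 'i%C * ((k%:~R ^+ 2)%:C%C * w t k + mu%:C%C * tri one_kernel (w t) (w t) (w t) k)) }.

(** [rbm_step] read on coefficients. The iteration runs in the twisted variable, so [free tau] is
    applied before the comparison with the new value. *)
Definition seq_step r tau c (a a' : int -> R[i]) := forall e, 0 < e ->
  exists j0, forall j, (j0 <= j)%N ->
    Hle r (fun k => free tau k * seq_iter tau c a j k - a' k) e.

Lemma nc_free t k : nc (free t k) = 1.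
Proof. exact: nc_cis. Qed.

Lemma freeNK t k : free t k * cis (t * k%:~R ^+ 2) = 1.
Proof. by rewrite /free mulrC cisMN. Qed.

Lemma ccont_eps (a b : R) (f : R -> R[i]) : (forall t, a <= t <= b -> forall e, 0 < e ->
    exists2 d, 0 < d & forall s, a <= s <= b -> `|s - t| < d -> nc (f s - f t) <= e) ->
  ccont a b f.
Proof.
move=> h; have H (g : R[i] -> R) : (forall z w, `|g z - g w| <= nc (z - w)) ->
    {within `[a, b], continuous (fun s => g (f s))}.
  move=> hg; apply/subspace_continuousP => t; rewrite /= in_itv /= => tab.
  apply/cvgrPdist_le => e e0; have [d d0 hd] := h t tab e e0.
  rewrite near_withinE; near=> s.
  move=> sab; rewrite distrC; apply: le_trans (hg _ _) _.
  apply: hd; first by move: sab; rewrite /= in_itv.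
  rewrite distrC; near: s; by apply/nbhs_ballP; exists d.
split; apply: H => z w.
  by rewrite -ReN -ReD nc_Re.
by rewrite -ImN -ImD nc_Im.
Unshelve. all: by end_near.
Qed.

Lemma is_cderive_shift (f : R -> R[i]) (t0 s : R) df : is_cderive f (t0 + s) df ->
  is_cderive (fun x => f (t0 + x)) s df.
Proof.
move=> [h1 h2].
have hg : is_derive s (1 : R) (fun x : R => t0 + x) 1.
  have := is_deriveD' _ _ _ _ _ (is_derive_cst t0 s 1) (is_derive_id s 1).
  by rewrite add0r.
split.
  apply: (is_derive_eq (@is_derive1_comp _ (fun x => Re (f x)) (fun x => t0 + x) _ _ _ h1 hg)).
  by rewrite mulr1.
apply: (is_derive_eq (@is_derive1_comp _ (fun x => Im (f x)) (fun x => t0 + x) _ _ _ h2 hg)).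
by rewrite mulr1.
Qed.

(** The interaction picture restarted at time [t0]: coefficients of e^{-is d_x^2} u(t0 + s). *)
Definition twist (t0 : R) (w : R -> int -> R[i]) (s : R) k : R[i] :=
  cis (k%:~R ^+ 2 * s) * w (t0 + s) k.

Lemma nc_twist t0 w s k : nc (twist t0 w s k) = nc (w (t0 + s) k).
Proof. by rewrite ncM nc_cis mul1r. Qed.

(** Twisting multiplies a term by e^{is(k2^2 + k3^2 - k1^2)}; by [phaseE] the kernel [osc] turns
    this into e^{is k^2}, which does not depend on the inner frequencies and leaves the sum. *)
Lemma tri_twist (r t0 s : R) w k : 2^-1 < r -> in_Hs r (w (t0 + s)) ->
  tri (osc s) (twist t0 w s) (twist t0 w s) (twist t0 w s) k =
  cis (k%:~R ^+ 2 * s) * tri one_kernel (w (t0 + s)) (w (t0 + s)) (w (t0 + s)) k.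
Proof.
move=> hr iw; have b1 : bounded_kernel one_kernel.
  by exists 1 => // j p; rewrite Normc.normc1.
have [N hN] := tri_summable r hr _ _ _ _ b1 iw iw iw.
rewrite /tri -(csumZ _ _ _ _ (hN k)); apply/esym.
apply: eq_csum (abs_boundedZ _ _ _ _ (hN k)) _ => -[[k1 k2] k3] qk.
rewrite /tri_term /twist /osc /one_kernel /= (phaseE _ _ qk) /= mul1r conjcM conjc_cis.
have -> : (k%:~R ^+ 2 + k1%:~R ^+ 2 - k2%:~R ^+ 2 - k3%:~R ^+ 2) * s =
   k%:~R ^+ 2 * s + k1%:~R ^+ 2 * s + - (k2%:~R ^+ 2 * s) + - (k3%:~R ^+ 2 * s) :> R by ring.
rewrite !cisD.
set x := cis (k%:~R ^+ 2 * s); set z1 := cis (k1%:~R ^+ 2 * s).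
set u1 := (w _ k1)^*%C; set u2 := w _ k2; set u3 := w _ k3.
have e1 := cisMN (k1%:~R ^+ 2 * s); have e2 := cisMN (k2%:~R ^+ 2 * s).
have e3 := cisMN (k3%:~R ^+ 2 * s); move: e1 e2 e3; rewrite -/z1.
set y1 := cis (- _); set z2 := cis _; set y2 := cis (- _); set z3 := cis _; set y3 := cis (- _).
move=> e1 e2 e3.
have -> : x * z1 * y2 * y3 * (y1 * u1 * (z2 * u2) * (z3 * u3)) =
  x * (z1 * y1) * (z2 * y2) * (z3 * y3) * (u1 * u2 * u3) by ring.
by rewrite e1 e2 e3 !mulr1.
Qed.

Lemma twist_solution (mu T r t0 tau : R) w : 2^-1 < r -> nls_coeffs mu T w ->
  0 <= t0 -> 0 < tau -> t0 + tau <= T ->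
  (forall t, 0 <= t <= T -> in_Hs r (w t)) ->
  (forall k, ccont 0 tau ((twist t0 w)^~ k)) /\
  (forall s, 0 < s < tau -> forall k, is_cderive ((twist t0 w)^~ k) s
     (- ('i%C * mu%:C%C) * tri (osc s) (twist t0 w s) (twist t0 w s) (twist t0 w s) k)).
Proof.
move=> hr [wc wd] t00 tau0 tT iw; split=> [k|s /andP[s0 s1] k].
  apply: ccontM; first exact: ccont_derive (is_cderive_cis _).
  apply: ccont_eps => t /andP[ta tb] e e0.
  have t0T : 0 <= t0 + t <= T by apply/andP; split; lra.
  have [d d0 hd] := wc k (t0 + t) t0T e e0; exists d => // s /andP[sa sb] std.
  apply: hd; first by apply/andP; split; lra.
  by have -> : t0 + s - (t0 + t) = s - t by ring.
have sT : 0 < t0 + s < T by apply/andP; split; lra.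
have h1 := is_cderive_shift _ _ _ _ (wd k _ sT).
have := is_cderiveM _ _ _ _ _ (is_cderive_cis (k%:~R ^+ 2) s) h1.
rewrite (tri_twist r)//; last by apply: iw; apply/andP; split; lra.
congr (is_cderive _ _ _); ring.
Qed.

Lemma seq_step_unique r tau c a b b' : 2^-1 < r -> seq_step r tau c a b ->
  seq_step r tau c a b' -> forall k, b k = b' k.
Proof.
move=> hr h1 h2 k; apply: nc_eq_lim => e e0; have e2 : 0 < e / 2 by lra.
have [j1 hj1] := h1 _ e2; have [j2 hj2] := h2 _ e2.
have r0 : 0 <= r by lra.
have x1 := Hle_coef _ _ _ k r0 (hj1 _ (leq_maxl j1 j2)).
have x2 := Hle_coef _ _ _ k r0 (hj2 _ (leq_maxr j1 j2)).
have -> : b k - b' k = (free tau k * seq_iter tau c a (maxn j1 j2) k - b' k) -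
   (free tau k * seq_iter tau c a (maxn j1 j2) k - b k) by ring.
apply: le_trans (ncB _ _) _; move: x1 x2; lra.
Qed.

Lemma itv_shift (t0 s tau T : R) : 0 <= t0 -> t0 + tau <= T -> 0 <= s <= tau -> 0 <= t0 + s <= T.
Proof. by move=> ? ? /andP[? ?]; apply/andP; split; lra. Qed.

Lemma growth_bound (y T tau : R) n : 0 <= y -> 0 < tau -> n%:R * tau <= T ->
  (1 + tau * y) ^+ n <= expR (y * T).
Proof.
move=> y0 t0 nT; apply: le_trans (_ : expR (tau * y) ^+ n <= _).
  apply: lerXn2r; rewrite ?nnegrE ?expR_ge0 ?expR_ge1Dx//.
  by rewrite addr_ge0// mulr_ge0// ltW.
rewrite -expRM_natl ler_expR mulrA -mulrA [leRHS]mulrC mulrA -/(n%:R * tau * y).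
by rewrite ler_wpM2r.
Qed.

(** n D (1 + x)^n is a supersolution of the recursion e_{n+1} = (1 + x) e_n + D, e_0 = 0, simpler
    than the exact geometric sum. *)
Lemma gronwall_step (D x : R) n : 0 <= D -> 0 <= x ->
  (1 + x) * (n%:R * D * (1 + x) ^+ n) + D <= n.+1%:R * D * (1 + x) ^+ n.+1.
Proof.
move=> D0 x0; rewrite exprS -natr1.
have h : 1 <= (1 + x) * (1 + x) ^+ n by rewrite -exprS exprn_ege1// lerDl.
have -> : (n%:R + 1) * D * ((1 + x) * (1 + x) ^+ n) =
  (1 + x) * (n%:R * D * (1 + x) ^+ n) + D * ((1 + x) * (1 + x) ^+ n) by ring.
by rewrite lerD2l ler_peMr.
Qed.

(** The second conclusion, solvability of the next step, lets the iterates be constructed one after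
    another. *)
Lemma seq_convergence (mu T r rho gamma : R) : 0 < T -> 2^-1 < r -> 0 < rho ->
  0 <= gamma <= 2 -> exists tau_R C : R, [/\ 0 < tau_R, 0 < C &
  forall tau, 0 < tau < tau_R -> forall w, nls_coeffs mu T w ->
    (forall t, 0 <= t <= T -> Hle (r + gamma) (w t) (rho / 2)) ->
  forall alpha : nat -> int -> R[i], alpha 0 = w 0 -> forall n, n%:R * tau <= T ->
    (forall i, (i < n)%N -> seq_step r tau (- ('i%C * mu%:C%C)) (alpha i) (alpha i.+1)) ->
    Hle r (fun k => w (n%:R * tau) k - alpha n k) (C * tau `^ gamma) /\
    exists2 b, in_Hs r b & seq_step r tau (- ('i%C * mu%:C%C)) (alpha n) b].
Proof.
move=> T0 hr rho0 hg; have /andP[g0 g2] := hg.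
set c := - ('i%C * mu%:C%C).
(* [r'] lies halfway between 1/2 and [r]; the spare regularity r - r', capped at 1, is the rate of
   convergence in order [r']. *)
pose r' := (r + 2^-1) / 2; pose g' := Num.min (r - r') 1.
have hr' : 2^-1 < r' by rewrite /r'; lra.
have rr' : r' < r by rewrite /r'; lra.
have g'0 : 0 < g' by rewrite lt_min; apply/andP; split; lra.
have g'1 : g' <= 1 by rewrite ge_min lexx orbT.
have g'r : r' + g' <= r by have : g' <= r - r' by [rewrite ge_min lexx]; lra.
have hg' : 0 <= g' <= 2 by rewrite (ltW g'0) /=; lra.
have rho20 : 0 <= rho / 2 by lra.
have hr1 : r <= r + gamma by lra.
have hr2 : r' <= r + gamma by lra.
have hr3 : r' + g' <= r + gamma by lra.
have hr0 : rho / 2 <= rho by lra.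
have [Cl Cl0 locl] := local_error r' g' (rho / 2) c hr' hg' rho20.
have [Ch Ch0 loch] := local_error r gamma (rho / 2) c hr hg rho20.
have [Ls Ls0 hsol] := scheme_solution r r' c hr' (ltW rr').
have [Ll Ll0 hel] := error_step r' c hr'.
have [Lh Lh0 heh] := error_step r c hr.
(* 1 + tau z is the growth factor of the H^r bound in one step while the H^r' norm is at most [rho],
   so [A1] bounds the iterates up to time [T]. The rates [yl] and [yh] govern the errors in the weak
   and the strong norm. *)
pose z := 8 * Ls * rho ^+ 2; pose A1 := rho * expR (z * T).
pose yl := 2 * Ll * (2 * rho) ^+ 2; pose yh := 2 * Lh * (2 * A1) ^+ 2.
have sq (x : R) : 0 <= x ^+ 2 by exact: sqr_ge0.
have z0 : 0 <= z by exact: mulr_ge0 (mulr_ge0 (ler0n _ 8) Ls0) (sq _).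
have yl0 : 0 <= yl by rewrite /yl mulr_ge0// mulr_ge0.
have m1' : rho / 2 + rho / 2 <= 2 * (2 * rho) by lra.
have m2' : rho + 2 * rho <= 2 * (2 * rho) by lra.
have yh0 : 0 <= yh by rewrite /yh mulr_ge0// mulr_ge0.
have rhoA1 : rho <= A1 by rewrite /A1 ler_peMr ?(ltW rho0)// -expR0 ler_expR mulr_ge0// ltW.
have m3' : rho / 2 + rho / 2 <= 2 * (2 * A1) by lra.
have m4' : A1 + 2 * A1 <= 2 * (2 * A1) by lra.
pose Dl := T * (2 * Cl) * expR (yl * T); pose Dh := T * (2 * Ch) * expR (yh * T).
have Dl0 : 0 <= Dl by rewrite !mulr_ge0 ?expR_ge0// ltW.
have Dh0 : 0 <= Dh by rewrite !mulr_ge0 ?expR_ge0// ltW.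
(* The condition tau K <= 1 gathers all restrictions on the step. The further condition through
   [small] makes the weak error Dl tau^g' at most rho/2; with rho/2 for the solution, the iterates
   stay within [rho]. *)
pose K := 1 + z + 4 * Ls * A1 ^+ 2 + yl + yh.
have K1 : 0 <= 4 * Ls * A1 ^+ 2 by exact: mulr_ge0 (mulr_ge0 (ler0n _ 4) Ls0) (sq _).
have K0 : 1 <= K by rewrite /K; lra.
have Kp : 0 < K by lra.
pose small := rho / (2 * (Dl + 1)).
have small0 : 0 < small by rewrite divr_gt0// mulr_gt0//; lra.
pose tR := Num.min K^-1 (small `^ (g'^-1)).
have tR0 : 0 < tR by rewrite lt_min invr_gt0 Kp powR_gt0.
exists tR, (Dh + 1); split=> //; first lra.
move=> tau /andP[t0 ttR] w hw hwM alpha alpha0.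
have tK : tau * K <= 1.
  rewrite -ler_pdivlMr// mul1r; apply: le_trans (ltW ttR) _; by rewrite ge_min lexx.
have tS : Dl * tau `^ g' <= rho / 2.
  have h1 : tau `^ g' <= small.
    have h2 : tau <= small `^ (g'^-1) by apply: le_trans (ltW ttR) _; rewrite ge_min lexx orbT.
    have h3 : tau `^ g' <= (small `^ (g'^-1)) `^ g'.
      by apply: ge0_ler_powR; rewrite ?nnegrE ?powR_ge0// ltW.
    by apply: le_trans h3 _; rewrite -powRrM mulVf ?gt_eqF// powRr1 ?(ltW small0).
  apply: le_trans (_ : (Dl + 1) * small <= _).
    apply: ler_pM => //; first exact: powR_ge0.
    by rewrite lerDl.
  by rewrite /small; apply: le_eq; field; rewrite gt_eqF//; lra.
have tau1 : tau <= 1.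
  by apply: le_trans tK; rewrite ler_peMr// ltW.
have tc x : 0 <= x -> x <= K -> tau * x <= 1.
  by move=> x0 xK; apply: le_trans tK; rewrite ler_pM2l.
have tz : tau * z <= 1 by apply: tc => //; rewrite /K; lra.
have tA : tau * (4 * Ls * A1 ^+ 2) <= 1 by apply: tc => //; rewrite /K; lra.
have tyl : tau * (Ll * (2 * rho) ^+ 2) <= 1.
  apply: tc; first by rewrite mulr_ge0.
  have : 0 <= Ll * (2 * rho) ^+ 2 by rewrite mulr_ge0.
  have e : yl = 2 * (Ll * (2 * rho) ^+ 2) by rewrite /yl mulrA.
  rewrite /K; move: e z0 yh0 K1; clearbody yl yh z; lra.
have tyh : tau * (Lh * (2 * A1) ^+ 2) <= 1.
  apply: tc; first by rewrite mulr_ge0.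
  have : 0 <= Lh * (2 * A1) ^+ 2 by rewrite mulr_ge0.
  have e : yh = 2 * (Lh * (2 * A1) ^+ 2) by rewrite /yh mulrA.
  rewrite /K; move: e z0 yl0 K1; clearbody yl yh z; lra.
have iw t : 0 <= t <= T -> in_Hs r (w t).
  by move=> ht; exists (rho / 2); exact: Hle_wt hr1 (hwM t ht).
pose El n := n%:R * (2 * (Cl * tau `^ (1 + g'))) * (1 + tau * yl) ^+ n.
pose Eh n := n%:R * (2 * (Ch * tau `^ (1 + gamma))) * (1 + tau * yh) ^+ n.
have Ebound (Cx g y : R) n : 0 <= Cx -> 0 <= y -> n%:R * tau <= T ->
    n%:R * (2 * (Cx * tau `^ (1 + g))) * (1 + tau * y) ^+ n <= T * (2 * Cx) * expR (y * T) * tau `^ g.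
  move=> Cx0 y0 nT; rewrite powRD_gt0// powRr1 ?(ltW t0)//.
  have -> : n%:R * (2 * (Cx * (tau * tau `^ g))) * (1 + tau * y) ^+ n =
     (n%:R * tau) * (2 * Cx) * (1 + tau * y) ^+ n * tau `^ g by ring.
  have p0 : 0 <= 1 + tau * y by rewrite addr_ge0// mulr_ge0// ltW.
  apply: ler_wpM2r; first exact: powR_ge0.
  apply: ler_pM; rewrite ?mulr_ge0 ?exprn_ge0 ?(ltW t0)//.
    by apply: ler_wpM2r => //; rewrite mulr_ge0.
  exact: growth_bound.
have Abound n : n%:R * tau <= T -> rho * (1 + tau * z) ^+ n <= A1.
  by move=> nT; rewrite /A1 ler_pM2l//; exact: growth_bound.
(* The weak error bound puts [a] in the ball of radius [rho], as [scheme_solution] requires; that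
   gives existence of the next value, its growth and its fixed-point equation. *)
have solve n a : n%:R * tau <= T -> Hle r' (fun k => w (n%:R * tau) k - a k) (El n) ->
    Hle r a (rho * (1 + tau * z) ^+ n) ->
    Hle r' a rho /\ exists V, [/\ Hle r' V (2 * rho), Hle r V (2 * A1),
       Hle r V (rho * (1 + tau * z) ^+ n.+1), forall k, V k = seq_map tau c a V k &
       seq_step r tau c a (fun k => free tau k * V k)].
  move=> nT hE hA; have nT0 : 0 <= n%:R * tau <= T by rewrite nT mulr_ge0// ltW.
  have ha0 : Hle r' a rho.
    have hw0 : Hle r' (w (n%:R * tau)) (rho / 2) by exact: Hle_wt hr2 (hwM _ nT0).
    have := HleB _ _ _ _ _ hw0 hE.
    move=> /(Hle_mono r' r' _ a _ rho (lexx _)); apply; last first.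
      by move=> k; apply: le_eq; congr nc; ring.
    have := Ebound Cl g' yl n Cl0 yl0 nT; rewrite -/(El n) -/Dl => h.
    by have := le_trans h tS; lra.
  have AA := Abound n nT.
  have An0 := Hle_ge0 _ _ _ hA.
  have tA' : tau * (4 * Ls * (rho * (1 + tau * z) ^+ n) ^+ 2) <= 1.
    apply: le_trans tA; rewrite ler_pM2l//; apply: ler_wpM2l; first by rewrite mulr_ge0.
    by rewrite ler_pXn2r// nnegrE// (le_trans An0).
  have [V [h1 h2 h3 h4 h5]] := hsol tau rho _ a t0 ha0 hA tz tA'.
  split=> //; exists V; split=> //.
  - by apply: Hle_le h2; rewrite ler_pM2l.
  - by apply: Hle_le h3; rewrite [_ ^+ n.+1]exprSr; apply: le_eq; rewrite /z; ring.
  - move=> e e0; have D0 : 0 <= 6 * (rho * (1 + tau * z) ^+ n) by rewrite mulr_ge0.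
    have [j0 hj0] := half_pow_small _ _ D0 e0; exists j0 => j /hj0 hj.
    apply: Hle_mono (h5 j) => // k.
    by rewrite -mulrBr ncM nc_free mul1r.
(* The error bound in the weaker norm r' < r has a positive rate even for gamma = 0, so
   it keeps the iterates bounded by rho there; the scheme being tame, their H^r norms then
   grow at most exponentially, which is what the H^r error estimate needs. *)
have P n : n%:R * tau <= T -> (forall i, (i < n)%N -> seq_step r tau c (alpha i) (alpha i.+1)) ->
    [/\ Hle r' (fun k => w (n%:R * tau) k - alpha n k) (El n),
        Hle r (alpha n) (rho * (1 + tau * z) ^+ n) &
        Hle r (fun k => w (n%:R * tau) k - alpha n k) (Eh n)].
  elim: n => [|n IH] nT hstep.
    have h0 t : Hle t (fun k => w (0%:R * tau) k - alpha 0 k) 0.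
      by apply: Hle_eq (Hle0 t) => k; rewrite mul0r alpha0 subrr.
    have El0 : El 0 = 0 by rewrite /El !mul0r.
    have Eh0 : Eh 0 = 0 by rewrite /Eh !mul0r.
    rewrite El0 Eh0; split; [exact: h0| |exact: h0].
    rewrite expr0 mulr1 alpha0; have hT0 : 0 <= (0 : R) <= T by rewrite lexx ltW.
    by exact: Hle_mono (hwM 0 hT0).
  have nS : n.+1%:R * tau = n%:R * tau + tau by rewrite -natr1 mulrDl mul1r.
  have nT' : n%:R * tau <= T by move: nT; rewrite nS; lra.
  have [] := IH nT' (fun i hi => hstep i (ltnW hi)).
  set t_n := n%:R * tau in nS nT' *; set a := alpha n => hl ha hh.
  have tn0 : 0 <= t_n by rewrite mulr_ge0// ltW.
  have [ha0 [V [V1 V2 V3 V4 V5]]] := solve n a nT' hl ha.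
  (* The given iterate is the constructed one, because limits are unique. *)
  have eV k : alpha n.+1 k = free tau k * V k by exact: seq_step_unique _ _ _ _ _ _ hr (hstep n (ltnSn n)) V5 k.
  have tT : t_n + tau <= T by rewrite -nS.
  pose v := twist t_n w.
  have [vc vd] := twist_solution mu T r t_n tau w hr hw tn0 t0 tT iw.
  have hv s : 0 <= s <= tau -> Hle (r + gamma) (v s) (rho / 2).
    move=> hs; apply: Hle_nc (hwM (t_n + s) (itv_shift _ _ _ _ tn0 tT hs)) => k.
    by rewrite nc_twist.
  have hvl s : 0 <= s <= tau -> Hle (r' + g') (v s) (rho / 2).
    by move=> hs; exact: Hle_wt hr3 (hv s hs).
  have v0E k : v 0 k = w t_n k by rewrite /v /twist mulr0 cis0 mul1r addr0.
  have t01 : 0 < tau <= 1 by rewrite t0.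
  have dl := locl tau v t01 hvl vc vd; have dh := loch tau v t01 hv vc vd.
  have z00 : 0 <= (0 : R) <= tau by rewrite lexx ltW.
  have ztt : 0 <= tau <= tau by rewrite lexx ltW.
  have hvr s : 0 <= s <= tau -> Hle r (v s) (rho / 2) by move=> hs; exact: Hle_wt hr1 (hv s hs).
  have hvr' s : 0 <= s <= tau -> Hle r' (v s) (rho / 2) by move=> hs; exact: Hle_wt hr2 (hv s hs).
  have hl' : Hle r' (fun k => v 0 k - a k) (El n) by apply: Hle_eq hl => k; rewrite v0E.
  have hh' : Hle r (fun k => v 0 k - a k) (Eh n) by apply: Hle_eq hh => k; rewrite v0E.
  have haA : Hle r a A1 by apply: Hle_le ha; exact: Abound.
  have m1 : Hle r' (midpoint (v 0) (v tau)) (2 * rho).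
    by apply: Hle_midpoint (hvr' _ z00) (hvr' _ ztt) m1'.
  have m2 : Hle r' (midpoint a V) (2 * rho) by exact: Hle_midpoint ha0 V1 m2'.
  have m3 : Hle r (midpoint (v 0) (v tau)) (2 * A1).
    by apply: Hle_midpoint (hvr _ z00) (hvr _ ztt) m3'.
  have m4 : Hle r (midpoint a V) (2 * A1) by exact: Hle_midpoint haA V2 m4'.
  have s1 := hel tau (2 * rho) (El n) _ _ a V (v 0) (v tau) t0 V4 dl hl' m1 m2
     (HleB _ _ _ _ _ (hvr' _ ztt) V1) tyl.
  have s2 := heh tau (2 * A1) (Eh n) _ _ a V (v 0) (v tau) t0 V4 dh hh' m3 m4
     (HleB _ _ _ _ _ (hvr _ ztt) V2) tyh.
  (* [free tau] has modulus 1 and undoes the twist at s = tau, so the error may be measured in the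
     twisted variable. *)
  have err k : nc (w (n.+1%:R * tau) k - alpha n.+1 k) = nc (v tau k - V k).
    have -> : nc (v tau k - V k) = nc (free tau k * (v tau k - V k)) by rewrite ncM nc_free mul1r.
    rewrite mulrBr -eV nS /v /twist mulrA.
    by rewrite (mulrC _ tau) freeNK mul1r.
  split.
  - apply: Hle_mono s1 => //; last by move=> k; rewrite err.
    by apply: gronwall_step; rewrite ?mulr_ge0 ?powR_ge0// ltW.
  - by apply: Hle_nc V3 => k; rewrite eV ncM nc_free mul1r.
  - apply: Hle_mono s2 => //; last by move=> k; rewrite err.
    by apply: gronwall_step; rewrite ?mulr_ge0 ?powR_ge0// ltW.
move=> n nT hstep; have [hl ha hh] := P n nT hstep; split.
  apply: Hle_le hh; apply: le_trans (Ebound Ch gamma yh n Ch0 yh0 nT) _.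
  rewrite -/Dh; apply: ler_wpM2r; first exact: powR_ge0.
  by rewrite lerDl.
have [_ [V [_ V2 _ _ V5]]] := solve n (alpha n) nT hl ha.
exists (fun k => free tau k * V k) => //.
by exists (2 * A1); apply: Hle_nc V2 => k; rewrite ncM nc_free mul1r.
Qed.

End SequenceConvergence.

(** * Fourier coefficients of functions *)

Section ComplexIntegration.
Context {R : realType}.
Notation mu := (@lebesgue_measure R).
Notation period := (`[0%R, (2 * pi)%R]%classic).
Implicit Types (f g : R -> R[i]).

Definition cmeas f := measurable_fun setT (fun x => Re (f x)) /\
  measurable_fun setT (fun x => Im (f x)).

Definition cintegrable f := mu.-integrable period (fun x => (Re (f x))%:E) /\
  mu.-integrable period (fun x => (Im (f x))%:E).

Lemma twopi_gt0 : 0 < 2 * pi :> R.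
Proof. by rewrite mulr_gt0// pi_gt0. Qed.

Lemma measurable_period : measurable (period : set (measurableTypeR R)).
Proof. exact: measurable_itv. Qed.

Lemma mu_period : fine (mu period) = 2 * pi.
Proof. by rewrite lebesgue_measure_itv /= lte_fin twopi_gt0 -EFinD /= subr0. Qed.

Lemma integrable_period_cst (c : R) : mu.-integrable period (EFin \o cst c).
Proof.
apply: continuous_compact_integrable; first exact: segment_compact.
by apply: continuous_subspaceT => x; exact: cst_continuous.
Qed.

Lemma cmeas_nc2 f : cmeas f -> measurable_fun setT (fun x => nc (f x) ^+ 2).
Proof.
move=> [f1 f2]; rewrite (_ : (fun x => _) = (fun x => Re (f x) ^+ 2 + Im (f x) ^+ 2)).
  by apply: measurable_funD; exact: measurable_funX.
by apply/funext => x; rewrite nc_sqr.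
Qed.

Lemma cmeas_cst (c : R[i]) : cmeas (fun=> c).
Proof. by split; exact: measurable_cst. Qed.

Lemma cmeasD f g : cmeas f -> cmeas g -> cmeas (fun x => f x + g x).
Proof.
move=> [f1 f2] [g1 g2]; split.
  by under eq_fun do rewrite ReD; exact: measurable_funD.
by under eq_fun do rewrite ImD; exact: measurable_funD.
Qed.

Lemma cmeasM f g : cmeas f -> cmeas g -> cmeas (fun x => f x * g x).
Proof.
move=> [f1 f2] [g1 g2]; split.
  by under eq_fun do rewrite ReM; apply: measurable_funB; exact: measurable_funM.
by under eq_fun do rewrite ImM; apply: measurable_funD; exact: measurable_funM.
Qed.

Lemma cmeas_conj f : cmeas f -> cmeas (fun x => (f x)^*%C).
Proof.
move=> [f1 f2]; split.
  by rewrite (_ : (fun x => _) = (fun x => Re (f x)))//; apply/funext => x; case: (f x).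
rewrite (_ : (fun x => _) = (fun x => - Im (f x))); first exact: measurableT_comp.
by apply/funext => x; case: (f x).
Qed.

Lemma cmeas_derive f (h : R -> R[i]) : (forall t, is_cderive f t (h t)) -> cmeas f.
Proof.
move=> hf; split; apply: continuous_measurable_fun.
  by apply: (is_derive_continuous _ (fun t => Re (h t))) => t; have [] := hf t.
by apply: (is_derive_continuous _ (fun t => Im (h t))) => t; have [] := hf t.
Qed.

Lemma cmeas_cis (w : R) : cmeas (fun x => cis (w * x)).
Proof. exact: cmeas_derive (is_cderive_cis w). Qed.

Lemma cmeas_sum (I : Type) (J : seq I) (F : I -> R -> R[i]) :
  (forall i, cmeas (F i)) -> cmeas (fun x => \sum_(i <- J) F i x).
Proof.
move=> hF; elim: J => [|i J IH].
  rewrite (_ : (fun x => _) = (fun=> 0)); first exact: cmeas_cst.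
  by apply/funext => x; rewrite big_nil.
rewrite (_ : (fun x => _) = (fun x => F i x + \sum_(i <- J) F i x)); first exact: cmeasD.
by apply/funext => x; rewrite big_cons.
Qed.

Lemma cmeas_lim (F : nat -> R -> R[i]) f : (forall n, cmeas (F n)) ->
  (forall x n, nc (F n x - f x) <= n.+1%:R^-1) -> cmeas f.
Proof.
move=> hF hf.
have key (g : R[i] -> R) : (forall z w, `|g z - g w| <= nc (z - w)) ->
    (forall n, measurable_fun setT (fun x => g (F n x))) -> measurable_fun setT (fun x => g (f x)).
  move=> hg mg; apply: (measurable_fun_cvg mg) => x _.
  apply/cvgrPdist_le => e e0.
  near=> n; rewrite distrC.
  apply: le_trans (hg _ _) _; apply: le_trans (hf x n) _.
  by apply: ltW; near: n; exact: (near_infty_natSinv_lt (PosNum e0)).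
split; apply: key.
- by move=> z w; rewrite -ReN -ReD nc_Re.
- by move=> n; have [] := hF n.
- by move=> z w; rewrite -ImN -ImD nc_Im.
- by move=> n; have [] := hF n.
Unshelve. all: by end_near.
Qed.

Lemma le_integrable_real (f G : R -> R) : measurable_fun setT f ->
  (forall x, `|f x| <= G x) -> mu.-integrable period (fun x => (G x)%:E) ->
  mu.-integrable period (fun x => (f x)%:E).
Proof.
move=> mf fG iG; apply: (le_integrable measurable_period _ _ iG).
  by apply/measurable_EFinP; exact: measurable_funTS.
move=> x _; rewrite /= lee_fin; apply: le_trans (fG x) _; exact: ler_norm.
Qed.

Lemma cintegrableD f g : cintegrable f -> cintegrable g -> cintegrable (fun x => f x + g x).
Proof.
move=> [f1 f2] [g1 g2]; split.
  rewrite (_ : (fun x => _) = (fun x => (Re (f x))%:E) \+ (fun x => (Re (g x))%:E))%E.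
    exact: (integrableD measurable_period f1 g1).
  by apply/funext => x; rewrite ReD EFinD.
rewrite (_ : (fun x => _) = (fun x => (Im (f x))%:E) \+ (fun x => (Im (g x))%:E))%E.
  exact: (integrableD measurable_period f2 g2).
by apply/funext => x; rewrite ImD EFinD.
Qed.

Lemma integrable_absD f : cintegrable f ->
  mu.-integrable period (fun x => (`|Re (f x)| + `|Im (f x)|)%:E).
Proof.
move=> [f1 f2]; have h1 := integrable_norm f1; have h2 := integrable_norm f2.
rewrite (_ : (fun x => _) = (EFin \o (Num.Def.normr \o (fun x => Re (f x)))) \+ (EFin \o (Num.Def.normr \o (fun x => Im (f x)))))%E.
  exact: (integrableD measurable_period h1 h2).
by apply/funext => x; rewrite EFinD.
Qed.

Lemma cintegrable_le f (G : R -> R) : cmeas f -> (forall x, nc (f x) <= G x) ->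
  mu.-integrable period (fun x => (G x)%:E) -> cintegrable f.
Proof.
move=> [f1 f2] fG iG; split.
  by apply: le_integrable_real iG => // x; apply: le_trans (fG x); exact: nc_Re.
by apply: le_integrable_real iG => // x; apply: le_trans (fG x); exact: nc_Im.
Qed.

Lemma cintegrable_bounded f B : cmeas f -> (forall x, nc (f x) <= B) -> cintegrable f.
Proof.
move=> mf fB; apply: (cintegrable_le _ (fun=> B)) => //.
exact: integrable_period_cst.
Qed.

Lemma cintegrableM f g B : cmeas f -> cmeas g -> cintegrable f -> (forall x, nc (g x) <= B) ->
  cintegrable (fun x => g x * f x).
Proof.
move=> mf mg hf gB; apply: (cintegrable_le _ (fun x => B * (`|Re (f x)| + `|Im (f x)|))).
- exact: cmeasM.
- move=> x; rewrite ncM; apply: ler_pM; rewrite ?nc_ge0//.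
  exact: nc_le_ReIm.
- rewrite (_ : (fun x => _) = (fun x => B%:E * (`|Re (f x)| + `|Im (f x)|)%:E)%E).
    exact: (integrableZl measurable_period B (integrable_absD _ hf)).
  by apply/funext => x; rewrite EFinM.
Qed.

Lemma cintegralD f g : cintegrable f -> cintegrable g ->
  cintegral 0 (2 * pi) (fun x => f x + g x) = cintegral 0 (2 * pi) f + cintegral 0 (2 * pi) g.
Proof.
move=> [f1 f2] [g1 g2]; rewrite /cintegral; apply: complexP => /=.
  rewrite -(RintegralD measurable_period f1 g1).
  by apply: eq_Rintegral => x _; rewrite ReD.
rewrite -(RintegralD measurable_period f2 g2).
by apply: eq_Rintegral => x _; rewrite ImD.
Qed.

Lemma integrable_lin (h1 h2 : R -> R) (a b : R) :
  mu.-integrable period (fun x => (h1 x)%:E) -> mu.-integrable period (fun x => (h2 x)%:E) ->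
  \int[mu]_(x in period) (a * h1 x + b * h2 x) =
  a * \int[mu]_(x in period) h1 x + b * \int[mu]_(x in period) h2 x.
Proof.
move=> i1 i2.
have j1 : mu.-integrable period (EFin \o (fun x => a * h1 x)).
  rewrite (_ : _ \o _ = (fun x => a%:E * (h1 x)%:E)%E).
    exact: (integrableZl measurable_period _ i1).
  by apply/funext => x; rewrite /= EFinM.
have j2 : mu.-integrable period (EFin \o (fun x => b * h2 x)).
  rewrite (_ : _ \o _ = (fun x => b%:E * (h2 x)%:E)%E).
    exact: (integrableZl measurable_period _ i2).
  by apply/funext => x; rewrite /= EFinM.
rewrite (RintegralD measurable_period j1 j2).
by rewrite (RintegralZl _ measurable_period i1) (RintegralZl _ measurable_period i2).
Qed.

Lemma cintegralZ f c : cintegrable f ->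
  cintegral 0 (2 * pi) (fun x => c * f x) = c * cintegral 0 (2 * pi) f.
Proof.
move=> [f1 f2]; rewrite /cintegral; apply: complexP; rewrite ?ReM ?ImM /=.
  rewrite -mulNr -(integrable_lin _ _ _ _ f1 f2).
  by apply: eq_Rintegral => x _; rewrite ReM mulNr.
rewrite -(integrable_lin _ _ _ _ f2 f1).
by apply: eq_Rintegral => x _; rewrite ImM.
Qed.

Lemma eq_cintegral f g : (forall x, f x = g x) -> cintegral 0 (2 * pi) f = cintegral 0 (2 * pi) g.
Proof. by move=> fg; congr cintegral; apply/funext. Qed.

(** The factor 2 results from estimating real and imaginary parts apart. *)
Lemma cintegral_le f B : cintegrable f -> (forall x, nc (f x) <= B) ->
  nc (cintegral 0 (2 * pi) f) <= 2 * (2 * pi) * B.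
Proof.
move=> [f1 f2] fB.
have B0 : 0 <= B by apply: le_trans (fB 0); exact: nc_ge0.
have key (h : R -> R) : mu.-integrable period (EFin \o h) -> (forall x, `|h x| <= B) ->
    `|\int[mu]_(x in period) h x| <= B * (2 * pi).
  move=> ih hB; apply: le_trans (le_normr_Rintegral measurable_period ih) _.
  have := le_Rintegral (f2 := cst B) measurable_period (integrable_norm ih)
    (integrable_period_cst B) (fun x _ => hB x).
  rewrite Rintegral_cst; last exact: measurable_period.
  move=> H; apply: le_trans H _; apply: le_eq; congr (_ * _); exact: mu_period.
apply: le_trans (nc_le_ReIm _) _.
have h1 := key _ f1 (fun x => le_trans (nc_Re _) (fB x)).
have h2 := key _ f2 (fun x => le_trans (nc_Im _) (fB x)).
by apply: le_trans (lerD h1 h2) _; apply: le_eq; ring.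
Qed.

Lemma cintegral_ae f g : cmeas f -> cmeas g ->
  {ae mu, forall x, period x -> f x = g x} ->
  cintegral 0 (2 * pi) f = cintegral 0 (2 * pi) g.
Proof.
move=> [f1 f2] [g1 g2] fg; rewrite /cintegral /Rintegral; congr (_ +i* _)%C.
  congr fine; apply: ae_eq_integral measurable_period _ _ _.
  - by apply/measurable_EFinP; exact: measurable_funTS.
  - by apply/measurable_EFinP; exact: measurable_funTS.
  - apply: filterS fg; first exact: (ae_filter_ringOfSetsType mu).
    by move=> x h Dx; rewrite h.
congr fine; apply: ae_eq_integral measurable_period _ _ _.
- by apply/measurable_EFinP; exact: measurable_funTS.
- by apply/measurable_EFinP; exact: measurable_funTS.
- apply: filterS fg; first exact: (ae_filter_ringOfSetsType mu).
    by move=> x h Dx; rewrite h.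
Qed.

Lemma torus_cmeas f : torus_L2 f -> cmeas f.
Proof. by case. Qed.

Lemma torus_cintegrable f : torus_L2 f -> cintegrable f.
Proof.
move=> [_ f1 f2 f3]; apply: (cintegrable_le _ (fun x => 1 + nc (f x) ^+ 2)) => //.
  move=> x; have := nc_ge0 (f x); set z := nc (f x) => z0.
  have := sqr_ge0 (z - 1); nra.
rewrite (_ : (fun x => _) = (fun x => 1%:E) \+ (fun x => (nc (f x) ^+ 2)%:E))%E; last first.
  by apply/funext => x; rewrite EFinD.
apply: (integrableD measurable_period (integrable_period_cst 1)); apply/integrableP; split.
  by apply/measurable_EFinP; exact: measurable_funTS (cmeas_nc2 _ (conj f1 f2)).
by under eq_integral do rewrite /= ger0_norm ?sqr_ge0//.
Qed.

Definition char (m : int) (x : R) : R[i] := cis (- (m%:~R * x)).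

Lemma cmeas_char m : cmeas (char m).
Proof.
rewrite (_ : char m = (fun x => cis (- m%:~R * x))); first exact: cmeas_cis.
by apply/funext => x; rewrite /char mulNr.
Qed.

Lemma cintegrable_char f m : cmeas f -> cintegrable f ->
  cintegrable (fun x => char m x * f x).
Proof.
move=> mf hf; apply: (cintegrableM _ _ 1) => //; first exact: cmeas_char.
by move=> x; rewrite nc_cis.
Qed.

Lemma fcoefD f g m : cmeas f -> cmeas g -> cintegrable f -> cintegrable g ->
  fcoef (fun x => f x + g x) m = fcoef f m + fcoef g m.
Proof.
move=> mf mg hf hg; rewrite /fcoef -mulrDr; congr (_ * _).
rewrite -cintegralD; [|exact: cintegrable_char..].
by apply: eq_cintegral => x; rewrite mulrDr.
Qed.

Lemma fcoefZ f c m : cmeas f -> cintegrable f -> fcoef (fun x => c * f x) m = c * fcoef f m.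
Proof.
move=> mf hf; rewrite /fcoef [in RHS]mulrCA; congr (_ * _).
rewrite -cintegralZ; last exact: cintegrable_char.
by apply: eq_cintegral => x; rewrite mulrCA.
Qed.

Lemma fcoef_le f B m : cmeas f -> (forall x, nc (f x) <= B) -> nc (fcoef f m) <= 2 * B.
Proof.
move=> mf fB; have hf := cintegrable_bounded _ _ mf fB.
have h : nc (cintegral 0 (2 * pi) (fun x => char m x * f x)) <= 2 * (2 * pi) * B.
  apply: cintegral_le; first exact: cintegrable_char.
  by move=> x; rewrite ncM nc_cis mul1r.
have p0 := twopi_gt0; rewrite /fcoef ncM nc_real gtr0_norm ?invr_gt0//.
rewrite mulrC ler_pdivrMr//.
by have -> : 2 * B * (2 * pi) = 2 * (2 * pi) * B by ring.
Qed.

Lemma eq_fcoef f g m : (forall x, f x = g x) -> fcoef f m = fcoef g m.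
Proof. by move=> fg; rewrite (_ : f = g)//; apply/funext. Qed.

Lemma fcoef_sum (I : Type) (J : seq I) (F : I -> R -> R[i]) m :
  (forall i, cmeas (F i)) -> (forall i, cintegrable (F i)) ->
  fcoef (fun x => \sum_(i <- J) F i x) m = \sum_(i <- J) fcoef (F i) m.
Proof.
move=> hF iF; have i0 : cintegrable (fun=> 0).
  by apply: (cintegrable_bounded _ 0 (cmeas_cst _)) => x; rewrite nc0.
elim: J => [|i J IH].
  rewrite big_nil (_ : (fun x => _) = (fun x => 0 * 0)); last first.
    by apply/funext => x; rewrite big_nil mul0r.
  by rewrite (fcoefZ (fun=> 0))// ?mul0r//; exact: cmeas_cst.
rewrite big_cons -IH -fcoefD//; first by apply: eq_fcoef => x; rewrite big_cons.
  exact: cmeas_sum.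
elim: J {IH} => [|j J IH].
    by rewrite (_ : (fun x => _) = (fun=> 0))//; apply/funext => x; rewrite big_nil.
  rewrite (_ : (fun x => _) = (fun x => F j x + \sum_(i <- J) F i x)); first exact: cintegrableD.
  by apply/funext => x; rewrite big_cons.
Qed.

Lemma cis_2pi (n : int) : cis (n%:~R * (2 * pi)) = 1 :> R[i].
Proof.
have e2 : 2 * pi = pi *+ 2 :> R by rewrite mulr_natl.
have h (k : nat) : cis (k%:R * (2 * pi)) = 1 :> R[i].
  elim: k => [|k IH]; first by rewrite mul0r cis0.
  by rewrite -natr1 mulrDl mul1r cisD IH mul1r e2 /cis cos2pi sin2pi.
case: n => k; first exact: h.
by rewrite NegzE mulrNz mulNr cisN h conjc1.
Qed.

Lemma fcoef_cis (k m : int) : fcoef (fun x => cis (k%:~R * x)) m = (k == m)%:R :> R[i].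
Proof.
rewrite /fcoef.
rewrite (_ : (fun x => _) = (fun x : R => cis ((k%:~R - m%:~R) * x))); last first.
  by apply/funext => x; rewrite -cisD; congr cis; ring.
rewrite (cintegral_FTC _ _ _ _ _ twopi_gt0 (is_cderive_primitive _) (is_cderive_cis _)).
rewrite cis_primitive0 subr0 /cis_primitive subr_eq0 eqr_int.
case: eqVneq => [_|km].
  by rewrite -rmorphM mulVf ?gt_eqF ?twopi_gt0.
have := cis_2pi (k - m); rewrite rmorphB /= /cis => -[-> ->].
by rewrite subrr !mul0r mulr0.
Qed.

End ComplexIntegration.

(** * Absolutely convergent trigonometric series *)

Section TrigonometricSeries.
Context {R : realType}.
Notation mu := (@lebesgue_measure R).
Notation period := (`[0%R, (2 * pi)%R]%classic).
Implicit Types (a : int -> R[i]).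

Definition trig a (x : R) : R[i] := csum [set: int] (fun k => cis (k%:~R * x) * a k).

Definition l1_bounded a (A : R) := abs_bounded [set: int] a A.

Definition trig_sum (J : seq int) a (x : R) : R[i] := \sum_(k <- J) cis (k%:~R * x) * a k.

Lemma trig_abs a A x : l1_bounded a A -> abs_bounded [set: int] (fun k => cis (k%:~R * x) * a k) A.
Proof. by move=> ha; apply: le_abs_bounded ha _ => k _; rewrite ncM nc_cis mul1r. Qed.

Lemma nc_trig a A x : l1_bounded a A -> nc (trig a x) <= A.
Proof. by move=> ha; exact: csum_norm (trig_abs a A x ha). Qed.

Lemma nc_trig_sum a A J x : l1_bounded a A -> uniq J -> nc (trig_sum J a x) <= A.
Proof.
move=> ha uJ; apply: le_trans (nc_sum _ _ _ _) _; apply: le_trans (ha J uJ _) => //.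
by apply: ler_sum => k _; rewrite ncM nc_cis mul1r.
Qed.

(** [csum_tail_ge] is uniform over dominated families: the family with phases gives the estimate for
    all [x], the family supported at [m] the one for coefficients, with the same [J]. *)
Lemma trig_approx a A : l1_bounded a A -> forall e, 0 < e -> exists2 J0, uniq J0 &
  forall J, uniq J -> {subset J0 <= J} ->
   (forall x, nc (trig a x - trig_sum J a x) <= e) /\
   (forall m, nc (a m - (if m \in J then a m else 0)) <= e).
Proof.
move=> ha e e0; have [J0 [uJ0 _ h]] := csum_tail_ge _ _ _ ha e e0.
exists J0 => // J uJ J0J; split=> [x|m].
  by apply: h => // k _; rewrite ncM nc_cis mul1r.
have := h J uJ (fun _ _ => I) J0J (fun k => if k == m then a m else 0).
have -> : csum [set: int] (fun k => if k == m then a m else 0) = a m.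
  have hs : has_csum [set: int] (fun k => if k == m then a m else 0) (a m).
    have := @has_csum_finite R int [set: int] (fun k => if k == m then a m else 0) [:: m] isT (fun _ _ => I).
    rewrite big_seq1 eqxx; apply=> k _; rewrite inE => /negPf -> //.
  have hb : abs_bounded [set: int] (fun k => if k == m then a m else 0) A.
    apply: le_abs_bounded ha _ => k _; case: eqVneq => [->//|_].
    by rewrite nc0 nc_ge0.
  exact: has_csum_unique (csum_has _ _ _ hb) hs.
have -> : \sum_(k <- J) (if k == m then a m else 0) = if m \in J then a m else 0.
  case: ifP => mJ.
    rewrite (bigD1_seq m)//= eqxx big1 ?addr0// => k /negPf -> //.
  by rewrite big1_seq// => k /andP[_ kJ]; case: eqVneq => // km; rewrite -km kJ in mJ.
apply=> k _; case: eqVneq => [->//|_]; by rewrite nc0 nc_ge0.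
Qed.

Lemma cmeas_trig_sum J a : cmeas (trig_sum J a).
Proof.
apply: cmeas_sum => k; apply: cmeasM; [exact: cmeas_cis|exact: cmeas_cst].
Qed.

Lemma cmeas_trig a A : l1_bounded a A -> cmeas (trig a).
Proof.
move=> ha.
have /choice[J hJ] : forall n : nat, exists J, forall x, nc (trig_sum J a x - trig a x) <= n.+1%:R^-1.
  move=> n; have n0 : 0 < n.+1%:R^-1 :> R by rewrite invr_gt0.
  have [J uJ h] := trig_approx a A ha _ n0; exists J => x.
  by rewrite nc_distC; have [+ _] := h J uJ (fun _ => id); exact.
apply: (cmeas_lim (fun n => trig_sum (J n) a)) => // n; exact: cmeas_trig_sum.
Qed.

Lemma trig_torus a A : l1_bounded a A -> torus_L2 (trig a).
Proof.
move=> ha; have [m1 m2] := cmeas_trig a A ha; split=> // [x|].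
  rewrite /trig; congr csum; apply/funext => k.
  by rewrite mulrDr cisD cis_2pi mulr1.
have A0 : 0 <= A by apply: le_trans (nc_trig a A 0 ha); exact: nc_ge0.
have : mu.-integrable period (fun x => (nc (trig a x) ^+ 2)%:E).
  apply: (le_integrable_real _ (fun=> A ^+ 2)) (integrable_period_cst _).
    exact: cmeas_nc2 (conj m1 m2).
  move=> x; rewrite ger0_norm ?sqr_ge0// ler_pXn2r ?nnegrE ?nc_ge0//.
  exact: nc_trig.
move=> /integrableP[_]; apply: le_lt_trans.
rewrite le_eqVlt; apply/orP; left; apply/eqP; apply: eq_integral => x _ /=.
by rewrite ger0_norm// sqr_ge0.
Qed.

Lemma fcoef_trig_sum J a m : uniq J -> fcoef (trig_sum J a) m = if m \in J then a m else 0.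
Proof.
move=> uJ; rewrite /trig_sum (fcoef_sum int J (fun k x => cis (k%:~R * x) * a k)).
- rewrite (eq_bigr (fun k => if k == m then a m else 0)); last first.
    move=> k _; rewrite (eq_fcoef _ (fun x => a k * cis (k%:~R * x))); last first.
      by move=> x; rewrite mulrC.
    rewrite fcoefZ; last 2 first.
    + exact: cmeas_cis.
    + by apply: (cintegrable_bounded _ 1 (cmeas_cis _)) => x; rewrite nc_cis.
    rewrite fcoef_cis; case: eqVneq => [->|_]; by rewrite ?mulr1 ?mulr0.
  case: ifP => mJ.
    rewrite (bigD1_seq m)//= eqxx big1 ?addr0// => k /negPf -> //.
  by rewrite big1_seq// => k /andP[_ kJ]; case: eqVneq => // km; rewrite -km kJ in mJ.
- by move=> k; apply: cmeasM; [exact: cmeas_cis|exact: cmeas_cst].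
- move=> k; apply: (cintegrable_bounded _ (nc (a k))) => [|x].
    by apply: cmeasM; [exact: cmeas_cis|exact: cmeas_cst].
  by rewrite ncM nc_cis mul1r.
Qed.

Lemma fcoefB (f g : R -> R[i]) m : cmeas f -> cmeas g -> cintegrable f -> cintegrable g ->
  fcoef (fun x => f x - g x) m = fcoef f m - fcoef g m.
Proof.
move=> mf mg hf hg.
have mg' : cmeas (fun x => -1 * g x) by apply: cmeasM => //; exact: cmeas_cst.
have ig' : cintegrable (fun x => -1 * g x).
  apply: (cintegrableM g (fun=> -1) 1) => // x.
  by rewrite ncN Normc.normc1.
rewrite (eq_fcoef _ (fun x => f x + -1 * g x)); last by move=> x; rewrite mulN1r.
by rewrite fcoefD// fcoefZ// mulN1r.
Qed.

Lemma nc_fcoefB_le (f g : R -> R[i]) m B e : cmeas f -> cmeas g ->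
  (forall x, nc (f x) <= B) -> (forall x, nc (g x) <= B) ->
  (forall x, nc (f x - g x) <= e) -> nc (fcoef f m - fcoef g m) <= 2 * e.
Proof.
move=> mf mg fB gB fg; rewrite -fcoefB//; [|exact: cintegrable_bounded fB|exact: cintegrable_bounded gB].
apply: fcoef_le => //; apply: cmeasD => //.
rewrite (_ : (fun x => _) = (fun x => -1 * g x)); last by apply/funext => x; rewrite mulN1r.
by apply: cmeasM => //; exact: cmeas_cst.
Qed.

Lemma fcoef_trig a A m : l1_bounded a A -> fcoef (trig a) m = a m.
Proof.
move=> ha; apply: nc_eq_lim => e e0; have e4 : 0 < e / 4 by lra.
have [J uJ h] := trig_approx a A ha _ e4; have [h1 h2] := h J uJ (fun _ => id).
have := nc_fcoefB_le (trig a) (trig_sum J a) m A (e / 4) (cmeas_trig _ _ ha)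
  (cmeas_trig_sum _ _) (fun x => nc_trig _ _ x ha) (fun x => nc_trig_sum _ _ _ x ha uJ) h1.
rewrite fcoef_trig_sum//; have := h2 m; set z := if _ then _ else _.
have -> : fcoef (trig a) m - a m = (fcoef (trig a) m - z) - (a m - z) by ring.
move=> x1 x2; apply: le_trans (ncB _ _) _; lra.
Qed.

Lemma fcoef_ae (f g : R -> R[i]) m : cmeas f -> cmeas g ->
  {ae mu, forall x, period x -> f x = g x} -> fcoef f m = fcoef g m.
Proof.
move=> mf mg fg; rewrite /fcoef; congr (_ * _).
apply: cintegral_ae.
- by apply: cmeasM => //; exact: cmeas_char.
- by apply: cmeasM => //; exact: cmeas_char.
- apply: filterS fg; first exact: (ae_filter_ringOfSetsType mu).
  by move=> x h Dx; rewrite h.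
Qed.

Definition cube (f : R -> R[i]) (x : R) : R[i] := (nc (f x) ^+ 2)%:C%C * f x.

Lemma cubeE f x : cube f x = (f x)^*%C * f x * f x.
Proof.
rewrite /cube; congr (_ * _); rewrite nc_sqr.
by case: (f x) => u v /=; apply: complexP => /=; ring.
Qed.

Lemma cmeas_cube f : cmeas f -> cmeas (cube f).
Proof.
move=> mf; rewrite (_ : cube f = (fun x => (f x)^*%C * f x * f x)).
  by apply: cmeasM => //; apply: cmeasM => //; exact: cmeas_conj.
by apply/funext => x; rewrite cubeE.
Qed.

Lemma nc_cubeB (f g : R -> R[i]) x A e : 0 <= A -> nc (f x) <= A -> nc (g x) <= A -> nc (f x - g x) <= e ->
  nc (cube f x - cube g x) <= 3 * A ^+ 2 * e.
Proof.
move=> A0 fA gA fg; rewrite !cubeE; set z := f x in fA fg *; set w := g x in gA fg *.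
have -> : z^*%C * z * z - w^*%C * w * w =
   (z - w)^*%C * z * z + w^*%C * (z - w) * z + w^*%C * w * (z - w).
  by rewrite conjcD conjcN; ring.
have n0 := nc_ge0 (z - w).
have H (p q : R[i]) : nc p <= A -> nc q <= A -> nc p * nc q * nc (z - w) <= A ^+ 2 * e.
  move=> pA qA; apply: ler_pM; rewrite ?mulr_ge0 ?nc_ge0// expr2.
  by apply: ler_pM; rewrite ?nc_ge0.
apply: le_trans (ncD _ _) _; apply: le_trans (lerD (ncD _ _) (lexx _)) _.
rewrite !ncM !nc_conj.
have := H z z fA fA; have := H w z gA fA; have := H w w gA gA.
have -> : nc (z - w) * nc z * nc z = nc z * nc z * nc (z - w) by ring.
have -> : nc w * nc (z - w) * nc z = nc w * nc z * nc (z - w) by ring.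
have -> : 3 * A ^+ 2 * e = A ^+ 2 * e + A ^+ 2 * e + A ^+ 2 * e by ring.
lra.
Qed.

Lemma nc_cube (f : R -> R[i]) x A : nc (f x) <= A -> nc (cube f x) <= A ^+ 3.
Proof.
move=> fA; have n0 := nc_ge0 (f x); rewrite cubeE !ncM nc_conj.
have -> : nc (f x) * nc (f x) * nc (f x) = nc (f x) ^+ 3 by ring.
by rewrite ler_pXn2r ?nnegrE// (le_trans n0).
Qed.

Definition restrict (J : seq int) a k : R[i] := if k \in J then a k else 0.

(** Expanding the product yields the frequencies k2 + k3 - k1; orthogonality keeps those equal to
    [k], which are the triples in [quad k]. *)
Lemma fcoef_cube_trig_sum J a k : uniq J ->
  fcoef (cube (trig_sum J a)) k = tri one_kernel (restrict J a) (restrict J a) (restrict J a) k.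
Proof.
move=> uJ.
pose Q := [seq (p, k3) | p <- [seq (k1, k2) | k1 <- J, k2 <- J], k3 <- J].
have uQ : uniq Q.
  by rewrite !allpairs_uniq// => [[x y] [x' y'] _ _ [-> ->]|[x y] [x' y'] _ _ [-> ->]].
pose t (p : int * int * int) : R[i] := (a p.1.1)^*%C * a p.1.2 * a p.2.
pose fr (p : int * int * int) : int := p.1.2 + p.2 - p.1.1.
rewrite (eq_fcoef _ (fun x => \sum_(p <- Q) t p * cis ((fr p)%:~R * x))); last first.
  move=> x; rewrite cubeE !big_allpairs /= /trig_sum.
  rewrite rmorph_sum /= mulr_suml mulr_suml; apply: eq_bigr => k1 _.
  rewrite -mulrA [X in _ * X]mulr_suml mulr_sumr; apply: eq_bigr => k2 _.
  rewrite mulrA mulr_sumr; apply: eq_bigr => k3 _.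
  rewrite /t /fr /= conjcM conjc_cis rmorphB rmorphD /=.
  have -> : (k2%:~R + k3%:~R - k1%:~R) * x = - (k1%:~R * x) + k2%:~R * x + k3%:~R * x :> R by ring.
  rewrite !cisD; ring.
have mt p : cmeas (fun x => t p * cis ((fr p)%:~R * x)).
  by apply: cmeasM; [exact: cmeas_cst|exact: cmeas_cis].
rewrite (fcoef_sum _ Q (fun p x => t p * cis ((fr p)%:~R * x))) //; last first.
  move=> p; apply: (cintegrable_bounded _ (nc (t p))) => // x.
  by rewrite ncM nc_cis mulr1.
have eT p : fcoef (fun x => t p * cis ((fr p)%:~R * x)) k = t p * (fr p == k)%:R.
  rewrite fcoefZ ?fcoef_cis//; first exact: cmeas_cis.
  by apply: (cintegrable_bounded _ 1 (cmeas_cis _)) => x; rewrite nc_cis.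
under eq_bigr do rewrite eT.
pose P := [seq p <- Q | fr p == k].
have -> : \sum_(p <- Q) t p * (fr p == k)%:R = \sum_(p <- P) t p.
  rewrite /P big_filter [RHS]big_mkcond /=; apply: eq_bigr => p _.
  by case: ifP; rewrite ?mulr1 ?mulr0.
have frk p : (fr p == k) <-> quad k p.
  case: p => [[k1 k2] k3]; rewrite /fr /quad /=; split=> [/eqP <-|<-]; first by rewrite subrK.
  by rewrite addrK.
have inQ p : p \in Q = [&& p.1.1 \in J, p.1.2 \in J & p.2 \in J].
  apply/idP/idP => [|/and3P[h1 h2 h3]].
    by move=> /allpairsP[[[x y] z] [/allpairsP[[x' y'] [/= h1 h2 [-> ->]]] h3 ->]] /=; apply/and3P.
  case: p h1 h2 h3 => [[x y] z] /= h1 h2 h3.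
  by apply: (allpairs_f (fun p k3 => (p, k3))) => //; exact: (allpairs_f (fun k1 k2 => (k1, k2))).
pose T := tri_term one_kernel (restrict J a) (restrict J a) (restrict J a) k.
have TE p : p \in P -> T p = t p.
  rewrite mem_filter inQ => /and4P[_ h1 h2 h3].
  by rewrite /T /tri_term /restrict h1 h2 h3 mul1r.
have T0 p : quad k p -> p \notin P -> T p = 0.
  move=> qp; rewrite mem_filter (introT idP ((frk p).2 qp)) /= inQ !negb_and /T /tri_term /restrict.
  by move=> /or3P[] /negPf ->; rewrite ?(raddf0 (@conjc R)) ?mul0r ?mulr0 ?mul0r ?mulr0.
have uP : uniq P by exact: filter_uniq.
have PD : inD (quad k) P by move=> p; rewrite mem_filter => /andP[/frk].
have hs := has_csum_finite (quad k) T P uP PD T0.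
have hb : abs_bounded (quad k) T (\sum_(p <- P) nc (T p)).
  move=> L uL LD; rewrite (bigID (fun p => p \in P)) /= [X in _ + X]big1_seq ?addr0; last first.
    by move=> p /andP[pP pL]; rewrite T0 ?nc0//; exact: LD.
  rewrite -big_filter; apply: sum_subseq_le => //; first by move=> p; exact: nc_ge0.
    exact: filter_uniq.
  by move=> p; rewrite mem_filter => /andP[].
rewrite /tri (has_csum_unique _ _ _ _ (csum_has _ _ _ hb) hs).
by apply: eq_big_seq => p /TE ->.
Qed.

(** Truncated series converge uniformly, which handles the left side; on the right the tail estimate
    is uniform over truncations, and [J] is made to contain every frequency occurring in [P], so
    that truncation does not alter the finite sum. *)
Lemma fcoef_cube_trig s a A k : 2^-1 < s -> in_Hs s a -> l1_bounded a A ->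
  fcoef (cube (trig a)) k = tri one_kernel a a a k.
Proof.
move=> hs ia ha; apply: nc_eq_lim => e e0.
have b1 : bounded_kernel (one_kernel (R := R)) by exists 1 => // j p; rewrite Normc.normc1.
have [N hN] := tri_summable s hs _ _ _ _ b1 ia ia ia.
have A0 : 0 <= A by apply: le_trans (nc_trig a A 0 ha); exact: nc_ge0.
(* 6 A^2 is the Lipschitz bound 3 A^2 of the cube times the factor 2 of [nc_fcoefB_le]; the added 2
   counts the two tails [d1] and [d2]. *)
pose C := 6 * A ^+ 2 + 2; have C0 : 0 < C by rewrite /C; have := sqr_ge0 A; lra.
pose e1 := e / C; have e10 : 0 < e1 by rewrite divr_gt0.
have [P [uP PD hP]] := csum_tail _ _ _ (hN k) e1 e10.
have [J0 uJ0 hJ0] := trig_approx a A ha e1 e10.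
pose J := undup (J0 ++ [seq p.1.1 | p <- P] ++ [seq p.1.2 | p <- P] ++ [seq p.2 | p <- P]).
have uJ : uniq J by exact: undup_uniq.
have J0J : {subset J0 <= J} by move=> i iJ; rewrite mem_undup !mem_cat iJ.
have [h1 _] := hJ0 J uJ J0J.
have := nc_fcoefB_le (cube (trig a)) (cube (trig_sum J a)) k (A ^+ 3) (3 * A ^+ 2 * e1)
  (cmeas_cube _ (cmeas_trig _ _ ha)) (cmeas_cube _ (cmeas_trig_sum _ _))
  (fun x => nc_cube _ _ _ (nc_trig _ _ x ha)) (fun x => nc_cube _ _ _ (nc_trig_sum _ _ _ x ha uJ))
  (fun x => nc_cubeB _ _ x A e1 A0 (nc_trig _ _ x ha) (nc_trig_sum _ _ _ x ha uJ) (h1 x)).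
rewrite fcoef_cube_trig_sum//.
set T := tri_term one_kernel a a a k; set TJ := tri_term one_kernel (restrict J a) (restrict J a) (restrict J a) k.
have d1 : nc (csum (quad k) T - \sum_(p <- P) T p) <= e1 by exact: hP.
have d2 : nc (csum (quad k) TJ - \sum_(p <- P) T p) <= e1.
  have -> : \sum_(p <- P) T p = \sum_(p <- P) TJ p.
    apply: eq_big_seq => p pP; rewrite /T /TJ /tri_term /restrict !mem_undup !mem_cat.
    have -> : p.1.1 \in [seq p.1.1 | p <- P] by apply/mapP; exists p.
    have -> : p.1.2 \in [seq p.1.2 | p <- P] by apply/mapP; exists p.
    have -> : p.2 \in [seq p.2 | p <- P] by apply/mapP; exists p.
    by rewrite !orbT.
  apply: hP => p _; rewrite !nc_tri_term; apply: ler_wpM2l; first exact: nc_ge0.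
  have R1 j : nc (restrict J a j) <= nc (a j) by rewrite /restrict; case: ifP => // _; rewrite nc0 nc_ge0.
  by apply: ler_pM; rewrite ?mulr_ge0 ?nc_ge0//; apply: ler_pM; rewrite ?nc_ge0.
move=> d3.
have -> : fcoef (cube (trig a)) k - tri one_kernel a a a k =
  (fcoef (cube (trig a)) k - csum (quad k) TJ) +
  ((csum (quad k) TJ - \sum_(p <- P) T p) - (csum (quad k) T - \sum_(p <- P) T p)).
  by rewrite /tri -/T; ring.
apply: le_trans (ncD _ _) _; apply: le_trans (lerD d3 (ncB _ _)) _.
apply: le_trans (lerD (lexx _) (lerD d2 d1)) _.
have -> : 2 * (3 * A ^+ 2 * e1) + (e1 + e1) = C * e1 by rewrite /C; ring.
by rewrite /e1 mulrC divfK// gt_eqF.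
Qed.

End TrigonometricSeries.

(** * Uniqueness of Fourier coefficients *)

Section Uniqueness.
Context {R : realType}.
Notation mu := (@lebesgue_measure R).
Notation period := (`[0%R, (2 * pi)%R]%classic).
Implicit Types (p h : R -> R) (u v : R -> R[i]).

(** A family known from elementary proofs of the Stone-Weierstrass theorem. The competition between
    q^n and the exponent 2^n places the jump at q = 1/2. *)
Definition step_poly (n : nat) (q : R) : R := 1 - (1 - q ^+ n) ^+ (2 ^ n).

Lemma bernoulli_sub (x : R) m : 0 <= x <= 1 -> 1 - m%:R * x <= (1 - x) ^+ m.
Proof.
move=> /andP[x0 x1]; elim: m => [|m IH]; first by rewrite mul0r subr0 expr0.
have -> : (1 - x) ^+ m.+1 = (1 - x) ^+ m - x * (1 - x) ^+ m by rewrite exprS; ring.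
have h : (1 - x) ^+ m <= 1 by rewrite exprn_ile1//; lra.
have h2 : x * (1 - x) ^+ m <= x by rewrite ler_piMr.
by rewrite -natr1; lra.
Qed.

Lemma bernoulli_add (x : R) m : 0 <= x -> 1 + m%:R * x <= (1 + x) ^+ m.
Proof.
move=> x0; elim: m => [|m IH]; first by rewrite mul0r addr0 expr0.
have -> : (1 + x) ^+ m.+1 = (1 + x) ^+ m + x * (1 + x) ^+ m by rewrite exprS; ring.
have h : 1 <= (1 + x) ^+ m by rewrite exprn_ege1//; lra.
have h2 : x <= x * (1 + x) ^+ m by rewrite ler_peMr.
by rewrite -natr1; lra.
Qed.

Lemma expr_unit (q : R) n : 0 <= q <= 1 -> 0 <= q ^+ n <= 1.
Proof. by move=> /andP[q0 q1]; rewrite exprn_ge0//= exprn_ile1. Qed.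

Lemma step_poly_bounds n (q : R) : 0 <= q <= 1 -> 0 <= step_poly n q <= 1.
Proof.
move=> hq; have /andP[h0 h1] := expr_unit q n hq.
have : 0 <= (1 - q ^+ n) ^+ (2 ^ n) <= 1 by apply: expr_unit; lra.
by rewrite /step_poly => /andP[a b]; lra.
Qed.

Lemma step_poly_low n (q : R) : 0 <= q <= 1 -> step_poly n q <= (2 * q) ^+ n.
Proof.
move=> hq; have := bernoulli_sub (q ^+ n) (2 ^ n) (expr_unit q n hq).
by rewrite /step_poly exprMn natrX; lra.
Qed.

(** The product of (1 - q^n)^(2^n) and (1 + q^n)^(2^n) is at most 1, while the second factor is at
    least 1 + (2q)^n by Bernoulli's inequality. *)
Lemma step_poly_high n (q : R) : 0 < q <= 1 -> 1 - step_poly n q <= ((2 * q)^-1) ^+ n.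
Proof.
move=> /andP[q0 q1]; have hq : 0 <= q <= 1 by rewrite ltW.
have /andP[h0 h1] := expr_unit q n hq.
have hb := bernoulli_add (q ^+ n) (2 ^ n) h0.
rewrite /step_poly opprB addrC subrK exprVn -[leRHS]mul1r ler_pdivlMr ?exprn_gt0 ?mulr_gt0//.
apply: (@le_trans _ _ ((1 - q ^+ n) ^+ (2 ^ n) * (1 + q ^+ n) ^+ (2 ^ n))).
  apply: ler_wpM2l; first by rewrite exprn_ge0//; lra.
  by rewrite exprMn -natrX; lra.
rewrite -exprMn.
have -> : (1 - q ^+ n) * (1 + q ^+ n) = 1 - (q ^+ n) ^+ 2 by ring.
have /andP[s0 s1] : 0 <= (q ^+ n) ^+ 2 <= 1 by apply: expr_unit; rewrite h0.
by apply: exprn_ile1; lra.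
Qed.

Lemma step_poly_cvg (q : R) : 0 <= q <= 1 -> q != 2^-1 ->
  step_poly ^~ q @ \oo --> (if 2^-1 < q then 1 else 0 : R).
Proof.
move=> hq qN; case: ltP => q2.
  have q0 : 0 < q <= 1 by lra.
  apply: (@squeeze_cvgr _ _ _ _ (fun n => 1 - ((2 * q)^-1) ^+ n) (fun=> 1)).
  - apply: nearW => n; have := step_poly_high n q q0; have := step_poly_bounds n q hq; lra.
  - rewrite -[X in _ --> X]subr0; apply: cvgB; first exact: cvg_cst.
    apply: cvg_expr; rewrite ger0_norm ?invr_ge0; last by lra.
    by rewrite invf_lt1; lra.
  - exact: cvg_cst.
have {qN}q2 : q < 2^-1 by rewrite lt_neqAle qN.
apply: (@squeeze_cvgr _ _ _ _ (fun=> 0) (fun n => (2 * q) ^+ n)).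
- apply: nearW => n; have := step_poly_low n q hq; have := step_poly_bounds n q hq; lra.
- exact: cvg_cst.
- by apply: cvg_expr; rewrite ger0_norm; lra.
Qed.

(** Pairs of coefficient and frequency, repetitions allowed, so that sums and products are plain
    list operations. *)
Definition trig_poly (f : R -> R[i]) := exists s : seq (R[i] * int),
  forall x, f x = \sum_(z <- s) z.1 * cis (z.2%:~R * x).

Lemma trig_poly_cst c : trig_poly (fun=> c).
Proof. by exists [:: (c, 0)] => x; rewrite big_seq1 /= mul0r cis0 mulr1. Qed.

Lemma trig_polyD f g : trig_poly f -> trig_poly g -> trig_poly (fun x => f x + g x).
Proof. by move=> [s hs] [t ht]; exists (s ++ t) => x; rewrite big_cat /= hs ht. Qed.

Lemma trig_polyM f g : trig_poly f -> trig_poly g -> trig_poly (fun x => f x * g x).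
Proof.
move=> [s hs] [t ht]; exists [seq (a.1 * b.1, a.2 + b.2) | a <- s, b <- t] => x.
rewrite hs ht mulr_suml big_allpairs_dep /=; apply: eq_bigr => a _.
rewrite mulr_sumr; apply: eq_bigr => b _ /=.
by rewrite rmorphD /= mulrDl cisD; ring.
Qed.

Lemma trig_polyX f n : trig_poly f -> trig_poly (fun x => f x ^+ n).
Proof.
move=> hf; elim: n => [|n IH]; first exact: trig_poly_cst.
by under eq_fun do rewrite exprS; exact: trig_polyM.
Qed.

Lemma trig_poly_step f p n : (forall x, f x = (p x)%:C%C) -> trig_poly f ->
  trig_poly (fun x => (step_poly n (p x))%:C%C).
Proof.
move=> fp hf.
rewrite (_ : (fun x => _) = (fun x => 1 + (-1) * (1 + (-1) * f x ^+ n) ^+ (2 ^ n))).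
  apply: trig_polyD; first exact: trig_poly_cst.
  apply: trig_polyM; first exact: trig_poly_cst.
  apply: trig_polyX; apply: trig_polyD; first exact: trig_poly_cst.
  by apply: trig_polyM; [exact: trig_poly_cst|exact: trig_polyX].
by apply/funext => x; rewrite /step_poly fp !mulN1r rmorphB rmorphXn rmorphB rmorphXn rmorph1.
Qed.

Lemma cmeas_trig_poly f : trig_poly f -> cmeas f.
Proof.
move=> [s hs]; rewrite (_ : f = fun x => \sum_(z <- s) z.1 * cis (z.2%:~R * x)); last exact/funext.
by apply: cmeas_sum => z; apply: cmeasM; [exact: cmeas_cst|exact: cmeas_cis].
Qed.

Lemma fcoef0_cintegral u k : (forall m, fcoef u m = 0) ->
  cintegral 0 (2 * pi) (fun x => cis (k%:~R * x) * u x) = 0.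
Proof.
move=> u0; have /eqP := u0 (- k); rewrite /fcoef mulf_eq0 => /orP[|/eqP <-].
  by move=> /eqP /(congr1 (@complex.Re R)) /= /eqP; rewrite invr_eq0 gt_eqF// twopi_gt0.
by apply: eq_cintegral => x; rewrite rmorphN /= mulNr opprK.
Qed.

Lemma trig_poly_annihilate u f : cmeas u -> cintegrable u -> (forall m, fcoef u m = 0) ->
  trig_poly f -> cintegral 0 (2 * pi) (fun x => f x * u x) = 0.
Proof.
move=> mu_ iu u0 [s hs].
rewrite (eq_cintegral _ (fun x => \sum_(z <- s) z.1 * (cis (z.2%:~R * x) * u x))); last first.
  by move=> x; rewrite hs mulr_suml; apply: eq_bigr => z _; rewrite mulrA.
have ic k : cintegrable (fun x => cis (k%:~R * x) * u x).
  by apply: (cintegrableM u _ 1) => // [|x]; [exact: cmeas_cis|rewrite nc_cis].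
have mc k : cmeas (fun x => cis (k%:~R * x) * u x) by apply: cmeasM => //; exact: cmeas_cis.
have mz c : cmeas (fun _ : R => c : R[i]) by exact: cmeas_cst.
have iz c k : cintegrable (fun x => c * (cis (k%:~R * x) * u x)).
  by apply: (cintegrableM _ (fun=> c) (nc c)).
suff [_ ->] : cintegrable (fun x => \sum_(z <- s) z.1 * (cis (z.2%:~R * x) * u x)) /\
  cintegral 0 (2 * pi) (fun x => \sum_(z <- s) z.1 * (cis (z.2%:~R * x) * u x)) = 0 by [].
elim: s {hs} => [|z s [IH1 IH2]].
  under eq_fun do rewrite big_nil; split.
    by apply: (cintegrable_bounded _ 0) => // x; rewrite nc0.
  rewrite (eq_cintegral _ (fun x => 0 * (cis (0%:~R * x) * u x))); last by move=> x; rewrite mul0r.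
  by rewrite cintegralZ// mul0r.
under eq_fun do rewrite big_cons; split; first exact: cintegrableD.
by rewrite cintegralD// IH2 cintegralZ// fcoef0_cintegral// mulr0 addr0.
Qed.

(* At [x] in the open period this exceeds [1/2] exactly when [x < b], because
   [cos (x - b/2) - cos (b/2) = 2 sin (x/2) sin ((b - x)/2)]. *)
Definition threshold (b x : R) : R := (cos (x - b / 2) - cos (b / 2) + 2) / 4.

Lemma threshold_unit b x : 0 <= threshold b x <= 1.
Proof.
have := cos_le1 (x - b / 2); have := cos_geN1 (x - b / 2).
have := cos_le1 (b / 2); have := cos_geN1 (b / 2).
by rewrite /threshold; lra.
Qed.

Lemma thresholdE b x : threshold b x = 2^-1 + sin (x / 2) * sin ((b - x) / 2) / 2.
Proof.
have e1 : x - b / 2 = x / 2 - (b - x) / 2 by field.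
have e2 : b / 2 = x / 2 + (b - x) / 2 by field.
by rewrite /threshold [in cos (x - _)]e1 [in cos (b / 2)]e2 cosB cosD; field.
Qed.

Lemma threshold_lt b x : 0 < x < 2 * pi -> 0 <= b <= 2 * pi -> x < b -> 2^-1 < threshold b x.
Proof.
move=> /andP[x0 x1] /andP[b0 b1] xb; rewrite thresholdE.
have : 0 < sin (x / 2) * sin ((b - x) / 2) by apply: mulr_gt0; apply: sin_gt0_pi; lra.
lra.
Qed.

Lemma threshold_gt b x : 0 < x < 2 * pi -> 0 <= b <= 2 * pi -> b < x -> threshold b x < 2^-1.
Proof.
move=> /andP[x0 x1] /andP[b0 b1] xb; rewrite thresholdE.
have : 0 < sin (x / 2) * sin ((x - b) / 2) by apply: mulr_gt0; apply: sin_gt0_pi; lra.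
have -> : (b - x) / 2 = - ((x - b) / 2) by field.
rewrite sinN; lra.
Qed.

Lemma trig_poly_threshold b : trig_poly (fun x => (threshold b x)%:C%C).
Proof.
(* cos(x - b/2)/4 is an eighth of e^{i(x - b/2)} + e^{-i(x - b/2)}; the third entry is the constant
   part. *)
exists [:: ((8^-1)%:C%C * cis (- (b / 2)), 1); ((8^-1)%:C%C * cis (b / 2), -1);
   (((2 - cos (b / 2)) / 4)%:C%C, 0)] => x.
rewrite !big_cons big_nil /= mul0r cis0 mul1r mulN1r mulr1 addr0.
rewrite /threshold cosB /cis !cosN !sinN; apply: complexP => /=; by field.
Qed.

Lemma cvg_step_threshold b x : 0 < x < 2 * pi -> 0 <= b <= 2 * pi -> x != b ->
  step_poly ^~ (threshold b x) @ \oo --> (if x <= b then 1 else 0 : R).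
Proof.
move=> hx hb xb; have [lt|gt|e] := ltgtP x b; last by rewrite e eqxx in xb.
  have h := threshold_lt _ _ hx hb lt.
  have := @step_poly_cvg _ (threshold_unit b x); rewrite h; apply.
  by rewrite gt_eqF.
have h := threshold_gt _ _ hx hb gt.
have := @step_poly_cvg _ (threshold_unit b x); rewrite ltNge (ltW h); apply.
by rewrite lt_eqF.
Qed.

Lemma ae_neq (a : R) : {ae mu, forall x : R, x != a}.
Proof.
exists [set a]; split; [exact: measurable_set1|exact: lebesgue_measure_set1|].
by move=> x /= /negP; rewrite negbK => /eqP.
Qed.

Lemma ae_zero_of_annihilate h : measurable_fun setT h ->
  mu.-integrable period (EFin \o h) ->
  (forall p, trig_poly (fun x => (p x)%:C%C) -> \int[mu]_(x in period) (p x * h x) = 0) ->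
  {ae mu, forall x, period x -> h x = 0}.
Proof.
move=> mh ih h0.
have ae_filter := ae_filter_ringOfSetsType mu.
pose g := h \_ period.
have zero b : 0 <= b <= 2 * pi -> \int[mu]_(x in `[0, b]) g x = 0.
  move=> hb.
  pose fn n x := step_poly n (threshold b x) * h x.
  pose f x := if x <= b then h x else 0.
  have tp n : trig_poly (fun x => (step_poly n (threshold b x))%:C%C).
    exact: (@trig_poly_step (fun x => (threshold b x)%:C%C) _ n (fun=> erefl) (trig_poly_threshold b)).
  have mfn n : measurable_fun setT (fn n).
    by apply: measurable_funM => //; have [+ _] := cmeas_trig_poly _ (tp n).
  have bfn n x : `|fn n x| <= `|h x|.
    have := step_poly_bounds n _ (threshold_unit b x); move=> /andP[s0 s1].
    by rewrite normrM ger0_norm// ler_piMl.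
  have mf : measurable_fun setT f.
    by apply: measurable_fun_ifT => //; apply: measurable_fun_ler => //.
  have ifn n : mu.-integrable period (EFin \o fn n).
    apply: (le_integrable_real _ (fun x => `|h x|)) => //.
    exact: integrable_norm ih.
  have mE (k : R -> R) : measurable_fun setT k -> measurable_fun period (EFin \o k).
    by move=> mk; apply/measurable_EFinP; exact: measurable_funTS.
  (* At 0, [2 * pi] and [b] the threshold equals exactly 1/2, where [step_poly_cvg] says nothing;
     these points form a null set. *)
  have cv : {ae mu, forall x, period x -> (EFin \o fn n) x @[n --> \oo] --> (EFin \o f) x}.
    apply: filterS3 (ae_neq 0) (ae_neq (2 * pi)) (ae_neq b) => x x0 x2 xb Dx.
    have {x0 x2 Dx}hx : 0 < x < 2 * pi.
      by move: Dx; rewrite /= in_itv /= !lt_neqAle => /andP[-> ->]; rewrite eq_sym x0 x2.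
    apply: cvg_EFin; first exact: nearW.
    rewrite /f (_ : (if x <= b then h x else 0) = (if x <= b then 1 else 0) * h x).
      by apply: cvgMl; exact: cvg_step_threshold.
    by case: ifP; rewrite ?mul1r ?mul0r.
  have dom : {ae mu, forall x n, period x -> (`|(EFin \o fn n) x| <= `|h x|%:E)%E}.
    by apply: aeW => x n _; rewrite lee_fin.
  have [_ _] := dominated_convergence measurable_period (fun n => mE _ (mfn n)) (mE _ mf) cv
    (integrable_norm ih) dom.
  have z n : (\int[mu]_(x in period) (EFin \o fn n) x)%E = 0%E.
    by rewrite -[LHS]fineK ?(integrable_fin_num measurable_period (ifn n))//; congr EFin; exact: h0.
  rewrite (_ : [sequence _]_n = fun=> 0%E); last by apply/funext => n; exact: z.
  move=> /(cvg_unique _ (cvg_cst 0%E)) e0.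
  have {}e0 : \int[mu]_(x in period) f x = 0.
    by rewrite /Rintegral -e0.
  rewrite -[RHS]e0 Rintegral_mkcond [RHS]Rintegral_mkcond; apply: eq_Rintegral => x _.
  rewrite /g /f !patchE; move: hb => /andP[b0 b2].
  case: ifPn; rewrite ?inE ?notin_setE /= !in_itv /=.
    by move=> /andP[x0 xb]; rewrite mem_set /= ?in_itv /= ?x0 ?xb// (le_trans xb).
  move=> hn; case: ifPn => //; rewrite inE /= in_itv /= => /andP[x0 x2].
  by case: ifP => // xb; case: hn; rewrite x0.
(* Cutting [h] to the period makes it locally integrable on the line, as [FTC1] requires. Near an
   interior point its primitive is identically zero, and [FTC1] identifies the derivative of the
   primitive with [h] almost everywhere. *)
have loc : locally_integrable [set: R] g.
  exact: (integrable_locally_restrict measurable_period ih).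
have ig y : mu.-integrable [set` Interval (BLeft 0) (BRight y)] (EFin \o g).
  rewrite /g -restrict_EFin; apply/(integrable_restrict _ measurable_period) => //.
  apply: (integrableS measurable_period _ _ ih); last by move=> x [].
  by apply: measurableI; [exact: measurable_itv|exact: measurable_period].
apply: filterS3 (FTC1 ig loc) (ae_neq 0) (ae_neq (2 * pi)) => x F1 x0 x2 Dx.
have {x0 x2 Dx}[x0 x2] : 0 < x /\ x < 2 * pi.
  by move: Dx; rewrite /= in_itv /= !lt_neqAle => /andP[-> ->]; rewrite eq_sym x0 x2.
have [|_] := F1; first by rewrite /= lte_fin.
have -> : g x = h x by rewrite /g patchE mem_set//= in_itv /= !ltW.
move=> <-; rewrite derive1E (near_eq_derive _ (_ : \near x, _ = cst 0 x)) ?derive_cst//.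
have nx : \forall y \near x, y \in `]0, (2 * pi)[.
  by apply: near_in_itvoo; rewrite in_itv /= x0.
near=> y; rewrite zero//.
have : y \in `]0, (2 * pi)[ by near: y.
by rewrite in_itv /= => /andP[/ltW -> /ltW ->].
Unshelve. all: by end_near. Qed.

Lemma ae_zero_of_fcoef u : cmeas u -> cintegrable u -> (forall m, fcoef u m = 0) ->
  {ae mu, forall x, period x -> u x = 0}.
Proof.
move=> mu_ iu u0; have [m1 m2] := mu_; have [i1 i2] := iu.
(* A real multiplier keeps real and imaginary parts apart, so the real statement applies to each of
   them. *)
have an p : trig_poly (fun x => (p x)%:C%C) ->
  \int[mu]_(x in period) (p x * Re (u x)) = 0 /\ \int[mu]_(x in period) (p x * Im (u x)) = 0.
  move=> tp; have := trig_poly_annihilate _ _ mu_ iu u0 tp; rewrite /cintegral => h.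
  split.
    have := congr1 (@complex.Re R) h => /= {2}<-; apply: eq_Rintegral => x _.
    by rewrite ReM /= mul0r subr0.
  have := congr1 (@complex.Im R) h => /= {2}<-; apply: eq_Rintegral => x _.
  by rewrite ImM /= mul0r addr0.
have ae_filter := ae_filter_ringOfSetsType mu.
have a1 := ae_zero_of_annihilate _ m1 i1 (fun p hp => (an p hp).1).
have a2 := ae_zero_of_annihilate _ m2 i2 (fun p hp => (an p hp).2).
by apply: filterS2 a1 a2 => x h1 h2 Dx; apply: complexP; rewrite ?h1 ?h2.
Qed.

(** A function and its Fourier series have the same coefficients, so [ae_zero_of_fcoef] applies to
    their difference. *)
Lemma trig_fcoef_ae u A : torus_L2 u -> l1_bounded (fcoef u) A ->
  {ae mu, forall x, period x -> u x = trig (fcoef u) x}.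
Proof.
move=> tu hA; have tt := trig_torus _ _ hA.
have mu_ := torus_cmeas _ tu; have mt := torus_cmeas _ tt.
have iu := torus_cintegrable _ tu; have it := torus_cintegrable _ tt.
have ae_filter := ae_filter_ringOfSetsType mu.
have mn : cmeas (fun x => (-1) * trig (fcoef u) x) by apply: cmeasM => //; exact: cmeas_cst.
have iN : cintegrable (fun x => (-1) * trig (fcoef u) x).
  by apply: (cintegrableM _ (fun=> -1) 1) => // [x]; rewrite ncN Normc.normc1.
have := @ae_zero_of_fcoef (fun x => u x + (-1) * trig (fcoef u) x) (cmeasD _ _ mu_ mn)
  (cintegrableD _ _ iu iN) _.
have z m : fcoef (fun x => u x + -1 * trig (fcoef u) x) m = 0.
  by rewrite fcoefD// fcoefZ// (fcoef_trig _ _ _ hA) mulN1r subrr.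
move=> /(_ z); apply: filterS => x h Dx.
by apply/eqP; rewrite -subr_eq0 -mulN1r h.
Qed.

(** Integrals do not distinguish [u] from its series, for which the cube is already expanded. *)
Lemma fcoef_cube s u A k : 2^-1 < s -> torus_L2 u -> in_Hs s (fcoef u) -> l1_bounded (fcoef u) A ->
  fcoef (cube u) k = tri one_kernel (fcoef u) (fcoef u) (fcoef u) k.
Proof.
move=> hs tu iu hA; rewrite -(fcoef_cube_trig s _ A k hs iu hA).
apply: fcoef_ae; [exact: cmeas_cube (torus_cmeas _ tu)|exact: cmeas_cube (cmeas_trig _ _ hA)|].
have ae_filter := ae_filter_ringOfSetsType mu.
apply: filterS (trig_fcoef_ae _ _ tu hA) => x h Dx.
by rewrite /cube h.
Qed.

End Uniqueness.

(** * From functions to coefficient sequences and back *)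

Section Transfer.
Context {R : realType}.
Implicit Types (a b : int -> R[i]) (u v w : R -> R[i]).

Lemma Hnorm_le s u B : 0 <= B -> (Hnorm s u <= B%:E)%E <-> Hle s (fcoef u) B.
Proof.
move=> B0.
have -> : B%:E = sqrte (B ^+ 2)%:E by rewrite /= sqrtr_sqr ger0_norm.
pose g m : R := (wt s m * nc (fcoef u m)) ^+ 2.
rewrite /Hnorm lee_sqrt ?lee_fin ?sqr_ge0//.
have -> : (fun m => (bracket m `^ (2 * s) * nc (fcoef u m) ^+ 2)%:E) = (fun m => (g m)%:E).
  apply/funext => m; congr EFin; rewrite /g exprMn /wt (mulrC 2) powRrM.
  by rewrite powR_mulrn// powR_ge0.
have g0 m : 0 <= g m by exact: sqr_ge0.
split=> [h|[_ h]]; last by apply: esum_seq => // J uJ _; exact: h.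
split=> // J uJ; rewrite -lee_fin; apply: le_trans h; exact: esum_seq_ge.
Qed.

Lemma Hnorm_ge0 s u : (0 <= Hnorm s u)%E.
Proof. exact: sqrte_ge0. Qed.

Lemma inH_in_Hs s u : inH s u -> in_Hs s (fcoef u).
Proof.
move=> [_ h]; exists (fine (Hnorm s u)); apply/Hnorm_le; first exact: fine_ge0 (Hnorm_ge0 _ _).
by rewrite fineK// ge0_fin_numE// Hnorm_ge0.
Qed.

Lemma fcoef_torusB u v m : torus_L2 u -> torus_L2 v -> fcoef (u \- v) m = fcoef u m - fcoef v m.
Proof.
move=> tu tv; exact: (fcoefB u v m (torus_cmeas _ tu) (torus_cmeas _ tv)
  (torus_cintegrable _ tu) (torus_cintegrable _ tv)).
Qed.

Lemma Hnorm_leB s u v B : 0 <= B -> torus_L2 u -> torus_L2 v ->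
  (Hnorm s (u \- v)%R <= B%:E)%E <-> Hle s (fun k => fcoef u k - fcoef v k) B.
Proof.
move=> B0 tu tv; apply: (iff_trans (Hnorm_le s _ B B0)).
by split; apply: Hle_eq => k; rewrite fcoef_torusB.
Qed.

(** The epsilon form in which [Hnorm_le] can be applied; values of [f] may be infinite at first,
    hence the detour through [fine_cvgP]. *)
Lemma cvge0_leP (T : Type) (F : set_system T) (FF : Filter F) (f : T -> \bar R) :
  (forall t, 0 <= f t)%E ->
  f @ F --> 0%E <-> forall e : R, 0 < e -> \forall t \near F, (f t <= e%:E)%E.
Proof.
move=> f0; split=> [/fine_cvgP[ff /cvgr0_norm_le h] e e0|h].
  near=> t; rewrite -[f t]fineK; last by near: t.
  by rewrite lee_fin -[leLHS]ger0_norm ?fine_ge0//; near: t; exact: h.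
apply/fine_cvgP; split.
  near=> t; rewrite ge0_fin_numE//; apply: (@le_lt_trans _ _ 1%:E); last exact: ltry.
  by near: t; exact: h.
apply/cvgr0Pnorm_le => e e0; near=> t.
have he : (f t <= e%:E)%E by near: t; exact: h.
rewrite ger0_norm ?fine_ge0//= -lee_fin fineK// ge0_fin_numE//.
by apply: le_lt_trans he _; exact: ltry.
Unshelve. all: by end_near. Qed.

Section Order.
Context (r : R) (hr : 2^-1 < r).

Lemma in_Hs_l1 a : in_Hs r a -> exists A, l1_bounded a A.
Proof.
move=> [M hM]; have [C _ hC] := l1_bound r hr; exists (C * M) => J uJ _.
have h0 : Hle (r + 0) a M by rewrite addr0.
by have := hC 0 a M h0 J uJ; under eq_bigr do rewrite wt0 mul1r.
Qed.

Lemma trig_in_Hs a : in_Hs r a -> torus_L2 (trig a) /\ forall k, fcoef (trig a) k = a k.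
Proof.
move=> /in_Hs_l1[A hA]; split; first exact: trig_torus hA.
by move=> k; exact: fcoef_trig hA.
Qed.

Lemma inH_trig a : in_Hs r a -> inH r (trig a).
Proof.
move=> ha; have [t e] := trig_in_Hs _ ha; split=> //; have [M hM] := ha.
apply: (@le_lt_trans _ _ M%:E); last exact: ltry.
apply/Hnorm_le; first exact: Hle_ge0 hM.
by apply: Hle_eq hM => k; rewrite e.
Qed.

Lemma trigD a b : in_Hs r a -> in_Hs r b ->
  trig (fun k => a k + b k) = (fun x => trig a x + trig b x).
Proof.
move=> /in_Hs_l1[A hA] /in_Hs_l1[B hB]; apply/funext => x.
rewrite /trig -(csumD _ _ _ _ _ (trig_abs a A x hA) (trig_abs b B x hB)).
by congr csum; apply/funext => k; rewrite mulrDr.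
Qed.

Lemma trigZ c a : in_Hs r a -> trig (fun k => c * a k) = (fun x => c * trig a x).
Proof.
move=> /in_Hs_l1[A hA]; apply/funext => x.
rewrite /trig -(csumZ _ _ c _ (trig_abs a A x hA)).
by congr csum; apply/funext => k; rewrite mulrCA.
Qed.

Lemma in_Hs_free t a : in_Hs r a -> in_Hs r (fun k => free t k * a k).
Proof.
move=> [M hM]; exists M; apply: Hle_nc hM => k.
by rewrite ncM nc_free mul1r.
Qed.

Lemma schrodingerE t u : schrodinger t u = trig (fun k => free t k * fcoef u k).
Proof.
apply/funext => x; rewrite /schrodinger /trig; congr csum; apply/funext => k.
by rewrite mulrA.
Qed.

Lemma in_Hs_tri K a : bounded_kernel K -> in_Hs r a -> in_Hs r (tri K a a a).
Proof.
move=> [kap k0 hK] [M hM]; have [C C0 [h _]] := cubic_bounds r 0 hr (lexx 0).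
have e : r + 2 * 0 = r by rewrite mulr0 addr0.
rewrite e in h; exists (C * kap * (M * M * M)); apply: h => // k p _.
by rewrite wt4_0 mulr1.
Qed.

Lemma kernel_bounded tau : 0 < tau -> bounded_kernel (kernel tau : int -> int * int * int -> R[i]).
Proof. by move=> t0; exists 3 => // k p; exact: nc_kernel. Qed.

Lemma in_Hs_midpoint a b : in_Hs r a -> in_Hs r b -> in_Hs r (midpoint a b).
Proof. by move=> ha hb; apply: in_HsZ; exact: in_HsD. Qed.

Lemma in_Hs_seq_map tau c a b : 0 < tau -> in_Hs r a -> in_Hs r b -> in_Hs r (seq_map tau c a b).
Proof.
move=> t0 ha hb; apply: in_HsD => //; apply: in_HsZ; apply: in_HsZ; apply: in_Hs_tri.
  exact: kernel_bounded.
exact: in_Hs_midpoint.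
Qed.

Lemma in_Hs_seq_iter tau c a j : 0 < tau -> in_Hs r a -> in_Hs r (seq_iter tau c a j).
Proof. by move=> t0 ha; elim: j => [//|j IH]; exact: in_Hs_seq_map. Qed.

Lemma free_opp t k : free (- t) k * free t k = 1 :> R[i].
Proof. by rewrite /free mulNr opprK cisMN. Qed.

Lemma rbm_FE mu tau w : rbm_F mu tau w =
  fun x => - ('i%C * mu%:C%C) * trig (tri (kernel tau) (fcoef w) (fcoef w) (fcoef w)) x.
Proof. by []. Qed.

(** An equality of functions everywhere, not only almost everywhere: [v] enters [rbm_map] through
    its Fourier coefficients alone, and every operation on them produces an absolutely convergent
    series. *)
Lemma rbm_fixpoint_iterE mu tau v j : 0 < tau -> inH r v ->
  rbm_fixpoint_iter mu tau v j =
  trig (fun k => free tau k * seq_iter tau (- ('i%C * mu%:C%C)) (fcoef v) j k).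
Proof.
move=> t0 hv; have iv := inH_in_Hs _ _ hv; have [tv _] := hv.
set c := - _; elim: j => [|j IH]; first by rewrite /rbm_fixpoint_iter /= schrodingerE.
rewrite /rbm_fixpoint_iter iterS -/(rbm_fixpoint_iter mu tau v j) IH.
set W := seq_iter tau c (fcoef v) j.
have iW : in_Hs r W by exact: in_Hs_seq_iter.
have iFW := in_Hs_free tau _ iW; have [tW eW] := trig_in_Hs _ iFW; have [tW' eW'] := trig_in_Hs _ iW.
have iM := in_Hs_midpoint _ _ iv iW.
rewrite /rbm_map rbm_FE.
have sW : schrodinger (- tau) (trig (fun k => free tau k * W k)) = trig W.
  rewrite schrodingerE; congr trig; apply/funext => k.
  by rewrite eW mulrA free_opp mul1r.
rewrite sW.
have em : fcoef (fun x => (2^-1)%:C%C * (v x + trig W x)) = midpoint (fcoef v) W.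
  have [m1 m2] := (torus_cmeas _ tv, torus_cmeas _ tW').
  have [i1 i2] := (torus_cintegrable _ tv, torus_cintegrable _ tW').
  apply/funext => k; rewrite fcoefZ; [|exact: cmeasD|exact: cintegrableD].
  by rewrite fcoefD// eW'.
rewrite em !schrodingerE -/c; set tm := tri _ _ _ _.
have iT : in_Hs r tm by apply: in_Hs_tri => //; exact: kernel_bounded.
have icT : in_Hs r (fun k => c * tm k) by exact: in_HsZ.
have [_ ecT] := trig_in_Hs _ icT.
rewrite -(trigZ c _ iT).
have -> : (fun k => free tau k * fcoef (trig (fun k0 => c * tm k0)) k) = (fun k => free tau k * (c * tm k)).
  by apply/funext => k; rewrite ecT.
have iF := in_Hs_free tau _ icT.
have -> : (fun x => trig (fun k => free tau k * fcoef v k) x +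
  tau%:C%C * trig (fun k => free tau k * (c * tm k)) x) =
  trig (fun k => free tau k * fcoef v k + tau%:C%C * (free tau k * (c * tm k))).
  rewrite trigD; [|exact: in_Hs_free|exact: in_HsZ].
  by rewrite trigZ.
congr trig; apply/funext => k.
by rewrite /seq_iter iterS -/(seq_iter _ _ _ _) -/W /seq_map -/tm; ring.
Qed.

Lemma rbm_stepP mu tau v v' : 0 < tau -> inH r v -> inH r v' ->
  rbm_step mu r tau v v' <-> seq_step r tau (- ('i%C * mu%:C%C)) (fcoef v) (fcoef v').
Proof.
move=> t0 hv hv'; have iv := inH_in_Hs _ _ hv; have [tv' _] := hv'.
set c := - _.
have it j := in_Hs_free tau _ (in_Hs_seq_iter tau c _ j t0 iv).
have E j e : 0 < e -> (Hnorm r (rbm_fixpoint_iter mu tau v j \- v')%R <= e%:E)%E <->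
    Hle r (fun k => free tau k * seq_iter tau c (fcoef v) j k - fcoef v' k) e.
  move=> e0; rewrite rbm_fixpoint_iterE// -/c; have [tj ej] := trig_in_Hs _ (it j).
  apply: (iff_trans (Hnorm_leB _ _ _ _ (ltW e0) tj tv')).
  by split; apply: Hle_eq => k; rewrite ej.
split=> [[_ /(cvge0_leP _ _ _ _ (fun=> Hnorm_ge0 _ _)) h] e e0|h].
  by have [j0 _ hj0] := h e e0; exists j0 => j jj; apply/E => //; exact: hj0.
split=> //; apply/cvge0_leP; first by move=> j; exact: Hnorm_ge0.
by move=> e e0; have [j0 hj0] := h e e0; exists j0 => // j jj; apply/E => //; exact: hj0.
Qed.

(** Continuity in H^r controls each coefficient because r >= 0, and [fcoef_cube] turns the nonlinear
    term into [tri]. *)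
Lemma nls_solution_coeffs mu T u0 (u : R -> R -> R[i]) : nls_solution mu r T u0 u ->
  nls_coeffs mu T (fun t => fcoef (u t)).
Proof.
move=> [uH uc _ ud]; have r0 : 0 <= r by move: hr; lra.
split=> k t ht; last first.
  have [d dd e] := ud t k ht.
  have htT : 0 <= t <= T by move: ht; lra.
  have iu := inH_in_Hs _ _ (uH t htT); have [A hA] := in_Hs_l1 _ iu; have [tu _] := uH t htT.
  rewrite -(fcoef_cube r (u t) A k hr tu iu hA).
  suff -> : - 'i%C * ((k%:~R ^+ 2)%:C%C * fcoef (u t) k + mu%:C%C * fcoef (cube (u t)) k) = d by [].
  by rewrite /cube -e mulrA mulNr -expr2 sqr_i opprK mul1r.
move=> e e0; have /(cvge0_leP _ _ _ _ (fun=> Hnorm_ge0 _ _)) /(_ e e0) := uc t ht.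
rewrite near_withinE => /nbhs_ballP[d /= d0 hd]; exists d => // s hs st.
have h : (Hnorm r (u s \- u t)%R <= e%:E)%E.
  by apply: hd; rewrite /ball /= ?in_itv//= distrC.
have [ts _] := uH s hs; have [tt _] := uH t ht.
by move/(Hnorm_leB _ _ _ _ (ltW e0) ts tt): h => /Hle_coef; apply.
Qed.

End Order.

End Transfer.

Theorem theorem4p19 (R : realType) (mu : R) (T r rho gamma : R)
    (hT : 0 < T) (hr : 2^-1 < r) (hrho : 0 < rho) (hgamma : 0 <= gamma <= 2) :
  exists tau_R C : R, [/\ 0 < tau_R, 0 < C &
    forall tau : R, 0 < tau < tau_R ->
    forall (u0 : R -> R[i]) (u : R -> R -> R[i]),
      nls_solution mu r T u0 u ->
      (ereal_sup [set Hnorm (r + gamma) (u t) | t in `[0%R, T]]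
         < (rho / 2)%:E)%E ->
      let N := Num.truncn (T / tau) in
      (exists U : nat -> R -> R[i], rbm_iterates mu r tau u0 N U) /\
      (forall U : nat -> R -> R[i], rbm_iterates mu r tau u0 N U ->
         forall n : nat, (n <= N)%N ->
           (Hnorm r (u (n%:R * tau) \- U n)%R <= (C * tau `^ gamma)%:E)%E)].
Proof.
have [tau_R [C [tR0 C0 main]]] := seq_convergence mu T r rho gamma hT hr hrho hgamma.
exists tau_R, C; split=> // tau htau u0 u sol sup N.
have /andP[t0 _] := htau; have [uH _ uu0 _] := sol.
pose w t := fcoef (u t).
have hw := nls_solution_coeffs _ hr _ _ _ _ sol.
have hb t : 0 <= t <= T -> Hle (r + gamma) (w t) (rho / 2).
  move=> ht; apply/Hnorm_le; first by rewrite divr_ge0// ltW.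
  apply: le_trans (ltW sup); apply: ereal_sup_ubound.
  by exists t => //=; rewrite in_itv.
have hn n : (n <= N)%N -> 0 <= n%:R * tau <= T.
  move=> nN; rewrite mulr_ge0 ?(ltW t0)//= -ler_pdivlMr//.
  apply: (@le_trans _ _ N%:R); first by rewrite ler_nat.
  by rewrite Num.Theory.truncn_le divr_ge0// ltW.
have T00 : 0 <= (0 : R) <= T by rewrite lexx ltW.
have u0H : inH r u0 by rewrite -uu0; exact: uH.
(* Stated for a partial run of [n] steps, so that it serves both the error bound for given iterates
   and the construction of iterates. *)
have key (U : nat -> R -> R[i]) n : U 0%N = u0 -> (n <= N)%N ->
    (forall i, (i < n)%N -> rbm_step mu r tau (U i) (U i.+1)) ->
    inH r (U n) /\
    Hle r (fun k => w (n%:R * tau) k - fcoef (U n) k) (C * tau `^ gamma) /\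
    exists2 b, in_Hs r b & seq_step r tau (- ('i%C * mu%:C%C)) (fcoef (U n)) b.
  move=> U0 nN hU.
  have UH i : (i <= n)%N -> inH r (U i).
    by case: i => [_|i /hU[]]; rewrite ?U0.
  split; first exact: UH.
  apply: (main tau htau w hw hb (fun i => fcoef (U i))) => [|//|i ni].
  - by rewrite /= U0 /w uu0.
  - by have /andP[] := hn _ nN.
  - have [h _] := rbm_stepP r hr mu tau (U i) (U i.+1) t0 (UH i (ltnW ni)) (UH i.+1 ni).
    exact: h (hU i ni).
split; last first.
  move=> U [U0 hU] n nN.
  have hU' i : (i < n)%N -> rbm_step mu r tau (U i) (U i.+1).
    by move=> ni; apply: hU; exact: leq_trans nN.
  have [Un [h _]] := key U n U0 nN hU'.
  apply/Hnorm_leB => //; first by rewrite mulr_ge0 ?powR_ge0// ltW.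
    by have [] := uH _ (hn _ nN).
  by case: Un.
(* [next] picks a step whenever there is one; elsewhere its value is arbitrary, which makes it a
   total function that can be iterated. *)
have /choice[next hnext] : forall v, exists v', (exists v'', rbm_step mu r tau v v'') ->
    rbm_step mu r tau v v'.
  move=> v; have [[v' h]|h] := pselect (exists v', rbm_step mu r tau v v').
    by exists v'.
  by exists v => /h.
pose U n := iter n next u0; exists U; split; first by [].
move=> n nN.
(* Strong induction, because [key] asks for all earlier steps. It returns the coefficients [b] of
   the next value, which the series [trig b] realises as a function. *)
elim/ltn_ind: n nN => n IH nN.
have [Un [_ [b ib hb']]] := key U n erefl (ltnW nN) (fun i ni => IH i ni (ltn_trans ni nN)).
apply: hnext; exists (trig b).
have [tb eb] := trig_in_Hs r hr _ ib.
have [_ h] := rbm_stepP r hr mu tau (U n) (trig b) t0 Un (inH_trig r hr _ ib).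
by apply: h; rewrite (_ : fcoef (trig b) = b)//; apply/funext.
Qed.
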